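(* Let $X$ be a continuous random variable with a moment-generating function and let $X_1,X_2,\dots$ be i.i.d. samples with the law of $X$. Then for every $n\in\mathbb{N}$, almost surely $\lim_{m\to\infty}\widehat h_n(\{X_j\}_{j=1}^m)=h_n(X)$. Furthermore $h(X)=\lim_{n\to\infty}\lim_{m\to\infty}\widehat h_n(\{X_j\}_{j=1}^m)$, where the inner limit holds almost surely.
   Context: $N\sim\mathcal{N}(0,1)$ independent of everything; for a random variable $R$ with finite $2n$-th moment, $\mathrm{pmmse}_n(R,t):=\min_{\boldsymbol{c}\in\mathbb{R}^{n+1}}\mathbb{E}[(R-\boldsymbol{c}^T(1,Z,\dots,Z^n)^T)^2]$ with $Z=\sqrt{t}R+N$, and $h_n(R):=\frac12\int_0^\infty(\mathrm{pmmse}_n(R,t)-\frac{1}{2\pi e+t})\,dt$. For a multiset of samples $\mathcal{S}=\{X_j\}_{j=1}^m$, $\widehat h_n(\mathcal{S}):=h_n(U)$ where $U$ is uniformly distributed over the multiset $\mathcal{S}$ (defined when $\mathcal{S}$ has more than $n$ distinct values). $h$ denotes differential entropy. *)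

(* Defs.v *)
From HB Require Import structures.
From mathcomp Require Import all_boot all_order all_algebra.
From mathcomp Require Import all_classical all_reals all_analysis.
Set Implicit Arguments. Unset Strict Implicit. Unset Printing Implicit Defensive.
Import Order.TTheory GRing.Theory Num.Def Num.Theory.
Local Open Scope classical_set_scope.
Local Open Scope ring_scope.

Section defs.
Context {R : realType}.

(* An "expectation functional" for a real random variable W: E g = E[g(W)]
   for nonnegative (extended-real valued) g. *)

(* E[(W - c^T (1, Z, ..., Z^n))^2] with Z = sqrt t W + N, N ~ N(0,1)
   independent of W: the inner integral integrates over N, the outer
   functional E integrates over the law of W. *)
Definition pmmse_err (n : nat) (E : (R -> \bar R) -> \bar R) (t : R)
    (c : 'I_n.+1 -> R) : \bar R :=
  E (fun r : R => (\int[@lebesgue_measure R]_(z in [set: R])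
       (normal_pdf 0 1 z *
         (r - \sum_(i < n.+1) c i * (Num.sqrt t * r + z) ^+ i) ^+ 2)%:E)%E).

Definition pmmse (n : nat) (E : (R -> \bar R) -> \bar R) (t : R) : \bar R :=
  ereal_inf (range (@pmmse_err n E t)).

Definition h_n (n : nat) (E : (R -> \bar R) -> \bar R) : \bar R :=
  (((2 : R)^-1)%R%:E *
  (\int[@lebesgue_measure R]_(t in `[0%R, +oo[%classic)
     (pmmse n E t - ((2 * pi * expR 1 + t)^-1)%R%:E)))%E.

Definition rv_expect d (T : measurableType d) (P : probability T R)
    (X : T -> R) : (R -> \bar R) -> \bar R :=
  fun g => (\int[P]_(w in [set: T]) g (X w))%E.

Definition unif_expect (m : nat) (x : nat -> R) : (R -> \bar R) -> \bar R :=
  fun g => (((m%:R)^-1)%R%:E * \sum_(j < m) g (x j))%E.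

Definition h_n_hat (n m : nat) (x : nat -> R) : \bar R :=
  h_n n (unif_expect m x).

Definition diff_entropy (f : R -> R) : \bar R :=
  (- \int[@lebesgue_measure R]_(x in [set: R]) (f x * ln (f x))%R%:E)%E.

Definition is_density d (T : measurableType d) (P : probability T R)
    (X : T -> R) (f : R -> R) : Prop :=
  measurable_fun setT f /\ (forall x, 0 <= f x) /\
  forall A : set R, measurable A ->
    P (X @^-1` A) = (\int[@lebesgue_measure R]_(x in A) (f x)%:E)%E.

Definition has_mgf d (T : measurableType d) (P : probability T R)
    (X : T -> R) : Prop :=
  exists e : R, 0 < e /\
    forall s : R, `|s| < e -> P.-integrable setT (fun w => (expR (s * X w))%:E).

Definition mutually_independent d (T : measurableType d) (P : probability T R)
    (Xs : nat -> T -> R) : Prop :=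
  forall (s : seq nat) (A : nat -> set R), uniq s ->
    (forall i, i \in s -> measurable (A i)) ->
    P (\bigcap_(i in [set` s]) (Xs i @^-1` A i)) =
    (\prod_(i <- s) P (Xs i @^-1` A i))%E.

Definition identically_distributed_as d (T : measurableType d)
    (P : probability T R) (Xs : nat -> T -> R) (X : T -> R) : Prop :=
  forall i (A : set R), measurable A -> P (Xs i @^-1` A) = P (X @^-1` A).

End defs.

(* Main.v *)
(* For fixed n and t, pmmse_n is the infimum over c of a quadratic form whose coefficients
   are polynomials in the first moments. When the law has a density the form is positive
   definite, so a small perturbation of the moments changes pmmse_n by a small relative
   amount. Moreover 1/t - K/t^2 <= pmmse_n <= 1/t for n >= 1 and t >= 1, with K locally
   uniform in the moments, so h_n depends continuously on the moments by dominated
   convergence; for n = 0 both sides are infinite. The strong law of large numbers for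
   the powers of X then gives the first claim.

   The moment generating function makes polynomials dense in L2 of the law of
   sqrt t X + N, so pmmse_n decreases to the mmse of X given sqrt t X + N. By the I-MMSE
   relation the integral of mmse / 2 over [0, k^2] is h(k X + N) - h(N), and
   h(k X + N) - ln k = h(X + N / k) tends to h(X): relative entropy to the Gaussian is
   lower semicontinuous by Fatou's lemma and at most increased by 1 / (2 k^2) by Jensen's
   inequality. The constant 2 pi e is such that h(N) = ln (2 pi e) / 2. *)
Require Import Defs.
From HB Require Import structures.
From mathcomp Require Import all_boot all_order all_algebra.
From mathcomp Require Import all_classical all_reals all_analysis.
From mathcomp Require Import measurable_realfun ring lra.
Import Order.TTheory GRing.Theory Num.Def Num.Theory.
Local Open Scope classical_set_scope.
Local Open Scope ring_scope.
Import numFieldNormedType.Exports HBNNSimple.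
Set Implicit Arguments. Unset Strict Implicit. Unset Printing Implicit Defensive.

(** The empirical laws have no density, so positive definiteness is not proved for them directly: it
    is proved for the law of [X], with a quantitative constant, and reaches large samples through a
    relative perturbation bound. An absolute bound would not do, because the infimum defining
    [pmmse] runs over unbounded coefficients. The lower bound on [pmmse] for large [t] rests on a
    duality: an estimate of [X] from [Z] is, up to the factor [- 1 / sqrt t], an estimate of the
    noise [N] from [X + N / sqrt t], and a polynomial in the latter is only weakly correlated with
    [N]. The differential entropy may be [-oo]. Limits are therefore taken in the extended reals,
    and every possibly infinite quantity is kept as the integral of a nonnegative function.
    Polynomial density in L2 is reached from the exponential tail through sines of small frequency:
    their Taylor series converge in L2, and polynomials in them approximate indicators of rays. The
    entropy computation runs in [g = sqrt t], where all functions are differentiable at [0]. *)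

Section tools.
Context d (T : measurableType d) (R : realType) (mu : {measure set T -> \bar R}).

Lemma integrable_dom (f g : T -> R) : measurable_fun setT f ->
  mu.-integrable setT (fun x => (g x)%:E) -> (forall x, `|f x| <= g x) ->
  mu.-integrable setT (fun x => (f x)%:E).
Proof.
move=> mf ig fg; apply: le_integrable ig => //; first by apply/measurable_EFinP.
by move=> x _; rewrite /= lee_fin (le_trans (fg x))// ler_norm.
Qed.

Lemma integrableZ (c : R) (g : T -> R) :
  mu.-integrable setT (fun x => (g x)%:E) ->
  mu.-integrable setT (fun x => (c * g x)%:E).
Proof. by move=> ig; under eq_fun do rewrite EFinM; exact: integrableZl. Qed.

Lemma integrableDE (f g : T -> R) :
  mu.-integrable setT (fun x => (f x)%:E) ->
  mu.-integrable setT (fun x => (g x)%:E) ->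
  mu.-integrable setT (fun x => (f x + g x)%:E).
Proof. by move=> jf jg; under eq_fun do rewrite EFinD; exact: integrableD. Qed.

Lemma integrableBE (f g : T -> R) :
  mu.-integrable setT (fun x => (f x)%:E) ->
  mu.-integrable setT (fun x => (g x)%:E) ->
  mu.-integrable setT (fun x => (f x - g x)%:E).
Proof. by move=> jf jg; under eq_fun do rewrite EFinB; exact: integrableB. Qed.

Lemma RintE (f : T -> R) : mu.-integrable setT (fun x => (f x)%:E) ->
  (\int[mu]_x (f x)%:E)%E = (\int[mu]_x f x)%:E.
Proof. by move=> jf; rewrite /Rintegral fineK// integrable_fin_num. Qed.

Lemma is_derive_Rintegral (k dk : R -> T -> R) (G : T -> R) (a u v : R) : u < a < v ->
  (forall s, u < s < v -> mu.-integrable setT (fun w => (k s w)%:E)) ->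
  (forall s w, u < s < v -> is_derive s 1 (k^~ w) (dk s w)) ->
  mu.-integrable setT (fun w => (G w)%:E) ->
  (forall s w, u < s < v -> `|dk s w| <= G w) ->
  is_derive a 1 (fun s => \int[mu]_w k s w) (\int[mu]_w dk a w).
Proof.
move=> auv ik dkP iG dkG.
have E : forall s : R, `]u, v[%classic s -> u < s < v by move=> s; rewrite /= in_itv.
have Ia : `]u, v[%classic a by rewrite /= in_itv.
have d1 s w : u < s < v -> partial1of2 k s w = dk s w.
  by move=> suv; rewrite partial1of2E; apply: derive_val; exact: dkP.
have G0 w : 0 <= G w by rewrite (le_trans _ (dkG a w auv)).
have h1 s w : `]u, v[%classic s -> setT w -> derivable (k^~ w) s 1.
  by move=> /E suv _; apply: ex_derive; exact: dkP.
have h2 s w : `]u, v[%classic s -> setT w -> `|partial1of2 k s w| <= G w.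
  by move=> /E suv _; rewrite d1//; exact: dkG.
have h0 s : `]u, v[%classic s -> mu.-integrable setT (EFin \o k s) by move=> /E; exact: ik.
apply: DeriveDef.
  exact: (derivable_under_integral measurableT Ia h0 h1 G0 iG h2).
rewrite -derive1E (differentiation_under_integral measurableT Ia h0 h1 G0 iG h2).
by apply: eq_Rintegral => w _; rewrite d1.
Qed.

Lemma Rintegral_cstP d' (T' : measurableType d') (P : probability T' R) (c : R) :
  \int[P]_w c = c.
Proof.
rewrite Rintegral_cst//.
have h := probability_setT P; by rewrite [X in fine X]h mulr1.
Qed.

End tools.

Lemma integrable_domR (R : realType) (f g : R -> R) : measurable_fun setT f ->
  (@lebesgue_measure R).-integrable setT (fun x => (g x)%:E) -> (forall x, `|f x| <= g x) ->
  (@lebesgue_measure R).-integrable setT (fun x => (f x)%:E).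
Proof. move=> mf; exact: (@integrable_dom _ (measurableTypeR R) R). Qed.

(** * The Gaussian density *)

Section gauss.
Context {R : realType}.
Local Notation phi := (@normal_pdf R 0 1).

Lemma phiE (w : R) : phi w = normal_peak 1 * expR (- (w ^+ 2) / 2).
Proof.
rewrite normal_pdfE ?oner_neq0// /normal_fun subr0; congr (_ * expR (_ / _)).
by rewrite expr1n.
Qed.

Lemma normal_peak1_gt0 : 0 < normal_peak (1 : R).
Proof. by rewrite normal_peak_gt0 ?oner_neq0. Qed.

Lemma normal_peak1_le1 : normal_peak (1 : R) <= 1.
Proof.
have p2 := @pi_ge2 R; have pp : 0 < (pi : R) *+ 2 by rewrite mulr2n; lra.
rewrite /normal_peak expr1n mul1r invf_le1 ?sqrtr_gt0//.
by rewrite -[leLHS]sqrtr1 ler_wsqrtr// mulr2n; lra.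
Qed.

Lemma phi_gt0 w : 0 < phi w.
Proof. by rewrite phiE mulr_gt0 ?normal_peak1_gt0 ?expR_gt0. Qed.

Lemma phi_le1 w : phi w <= 1.
Proof. by rewrite (le_trans (normal_pdf_ub _ _ _)) ?oner_neq0 ?normal_peak1_le1. Qed.

(** Compares [expR (w^2 / 2)], written as the [n]-th power of [expR (w^2 / (2 n))], with
    [(1 + w^2 / (2 n))^n]; multiplying by [(2 n)^n] turns the latter into [(2 n + w^2)^n]. *)
Lemma phi_bound (n : nat) (w : R) : (1 + w ^+ 2) ^+ n * phi w <= (2 * n%:R) ^+ n.
Proof.
case: n => [|n]; first by rewrite !expr0 mul1r phi_le1.
set m : R := n.+1%:R; have m0 : 0 < m by rewrite ltr0Sn.
have m1 : 1 <= m by rewrite /m ler1n.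
rewrite phiE mulrCA -[leRHS]mul1r.
have w2 := sqr_ge0 w.
apply: ler_pM; [exact: normal_peak_ge0| |exact: normal_peak1_le1|].
  by apply: mulr_ge0; [apply: exprn_ge0; lra|exact: expR_ge0].
rewrite mulNr expRN ler_pdivrMr ?expR_gt0//.
have u0 : 0 <= w ^+ 2 / (2 * m) by rewrite divr_ge0// mulr_ge0// ltW.
have h : (1 + w ^+ 2 / (2 * m)) ^+ n.+1 <= expR (w ^+ 2 / 2).
  have -> : w ^+ 2 / 2 = m * (w ^+ 2 / (2 * m)) by field; rewrite gt_eqF.
  by rewrite expRM_natl; apply: lerXn2r; rewrite ?nnegrE ?expR_ge0 ?addr_ge0// expR_ge1Dx.
have m2 : 0 <= (2 * m) ^+ n.+1 by apply: exprn_ge0; lra.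
apply: le_trans (ler_wpM2l m2 h); rewrite -exprMn; apply: lerXn2r; rewrite ?nnegrE.
- by lra.
- by apply: mulr_ge0; [lra|rewrite addr_ge0].
- have -> : 2 * m * (1 + w ^+ 2 / (2 * m)) = 2 * m + w ^+ 2 by field; rewrite gt_eqF.
  by lra.
Qed.

Lemma phi_bound3 w : (1 + w ^+ 2) ^+ 3 * phi w <= 6 ^+ 3.
Proof. by have := phi_bound 3 w; rewrite -natrM. Qed.

(** Decay in [w] becomes decay in the shifted point [w + b] at a polynomial price in [b]. Three
    factors [2 (1 + w^2)] are spent on [phi_bound3], whence [12^3 = 2^3 6^3]. The square on the left
    leaves one power for integrability and one for a logarithm growing like the square of the
    point. *)
Lemma phi_shift_bound (w b : R) :
  (1 + (w + b) ^+ 2) ^+ 2 * ((1 + `|w|) * phi w) <= 12 ^+ 3 * (1 + b ^+ 2) ^+ 2.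
Proof.
have p0 := ltW (phi_gt0 w); have w2 := sqr_ge0 w; have b2 := sqr_ge0 b.
have h1 : 1 + (w + b) ^+ 2 <= 2 * (1 + w ^+ 2) * (1 + b ^+ 2).
  have := sqr_ge0 (w - b); have := mulr_ge0 w2 b2; nra.
have h2 : 1 + `|w| <= 2 * (1 + w ^+ 2).
  rewrite -(real_normK (num_real w)); have := sqr_ge0 (`|w| - 1).
  have := sqr_ge0 `|w|; nra.
apply: (@le_trans _ _ ((2 * (1 + w ^+ 2) * (1 + b ^+ 2)) ^+ 2 * ((2 * (1 + w ^+ 2)) * phi w))).
  apply: ler_pM.
  - by rewrite exprn_ge0// addr_ge0// sqr_ge0.
  - by rewrite mulr_ge0// addr_ge0.
  - by apply: lerXn2r => //; rewrite nnegrE ?addr_ge0 ?sqr_ge0// ?mulr_ge0 ?addr_ge0.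
  - exact: ler_wpM2r.
rewrite (_ : _ * _ = 8 * (1 + b ^+ 2) ^+ 2 * ((1 + w ^+ 2) ^+ 3 * phi w)); last by ring.
rewrite (_ : 12 ^+ 3 * _ = 8 * (1 + b ^+ 2) ^+ 2 * 6 ^+ 3); last by ring.
by apply: ler_wpM2l (phi_bound3 w); rewrite mulr_ge0// exprn_ge0// addr_ge0.
Qed.

Lemma is_derive_phi (w : R) : is_derive w 1 phi (- w * phi w).
Proof.
rewrite (_ : phi = fun w => normal_peak 1 * expR (- (w ^+ 2) / 2)); last by apply/funext => x; exact: phiE.
apply: is_derive_eq.
by rewrite /GRing.scale/=; field.
Qed.

Lemma continuous_phi : continuous phi.
Proof. by apply: continuous_normal_pdf; rewrite oner_neq0. Qed.

Lemma measurable_phi : measurable_fun setT phi.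
Proof. exact: measurable_normal_pdf. Qed.

Lemma is_derive_phi_affine (c m s : R) :
  is_derive s 1 (fun s => phi (c + m * s)) (- m * (c + m * s) * phi (c + m * s)).
Proof.
have dphi := is_derive_phi (c + m * s).
have h : is_derive s 1 (fun s => c + m * s) m.
  have := is_deriveD (is_derive_cst c s 1) (is_deriveZ m (is_derive_id s (1 : R))).
  by rewrite add0r /GRing.scale/= mulr1.
have dc := @is_derive1_comp _ _ (fun s => c + m * s) _ _ _ dphi h.
have -> : - m * (c + m * s) * phi (c + m * s) = - (c + m * s) * phi (c + m * s) * m by ring.
exact: dc.
Qed.

End gauss.

(** * Dominated convergence and integrals over the real line *)

Section dct.
Context d (T : measurableType d) (R : realType) (mu : {measure set T -> \bar R}).

Lemma measurable_funT_EFin (f : T -> R) :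
  measurable_fun setT f -> measurable_fun setT (fun x => (f x)%:E).
Proof. by move=> mf; apply/measurable_EFinP. Qed.

Lemma Rdominated (f_ : nat -> T -> R) (f g : T -> R) :
  (forall n, measurable_fun setT (f_ n)) ->
  (forall x, f_ ^~ x @ \oo --> f x) ->
  mu.-integrable setT (fun x => (g x)%:E) ->
  (forall n x, `|f_ n x| <= g x) ->
  mu.-integrable setT (fun x => (f x)%:E) /\
  (fun n => \int[mu]_x f_ n x) @ \oo --> \int[mu]_x f x.
Proof.
move=> mf_ f_f ig fg.
have mf : measurable_fun setT f by apply: (measurable_fun_cvg mf_) => x _; exact: f_f.
have cE (x : T) : setT x -> (fun n => (f_ n x)%:E) @ \oo --> (f x)%:E.
  by move=> _; apply: cvg_EFin; [exact: nearW|exact: f_f].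
have [jf _ cf] := @dominated_convergence _ _ _ mu setT measurableT
  (fun n x => (f_ n x)%:E) (fun x => (f x)%:E) (fun x => (g x)%:E)
  (fun n => measurable_funT_EFin (mf_ n)) (measurable_funT_EFin mf)
  (aeW mu cE) ig
  (aeW mu (fun x n _ => fg n x)).
split => //; apply: fine_cvg.
by rewrite fineK ?integrable_fin_num.
Qed.

End dct.

Section lebR.
Context {R : realType}.
Local Notation leb := (@lebesgue_measure R).

Lemma integrable_oneDsqrV : leb.-integrable setT (fun y : R => ((1 + y ^+ 2)^-1)%:E).
Proof.
have c : continuous (fun y : R => (1 + y ^+ 2)^-1) by exact: continuous_oneDsqrV.
have p y : 0 <= (1 + y ^+ 2)^-1 :> R by rewrite invr_ge0 addr_ge0 ?sqr_ge0.
apply/integrableP; split.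
  by apply/measurable_EFinP; exact: continuous_measurable_fun.
under eq_integral => y _ do rewrite /= ger0_norm//.
rewrite ge0_symfun_integralT//; last by move=> x /=; rewrite sqrrN.
by rewrite -set_itvcy integral0y_oneDsqr -EFinM ltry.
Qed.

Lemma cvg_Rintegral_itv (h : R -> R) :
  leb.-integrable setT (fun x => (h x)%:E) ->
  (fun n => \int[leb]_(x in `[(- n%:R), n%:R]) h x) @ \oo --> \int[leb]_x h x.
Proof.
move=> ih.
have mh : measurable_fun setT h by apply/measurable_EFinP; exact: measurable_int ih.
under eq_fun do rewrite Rintegral_mkcond.
have H := @Rdominated _ _ _ leb (fun n => h \_ `[(- n%:R), n%:R]) h (fun x => `|h x|).
apply: (H _ _ _ _).2 => //.
- by move=> n; apply/(measurable_restrictT _ _).1 => //; exact: measurable_funTS.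
- move=> x; apply/cvgrPdist_lt => e e0; near=> n.
  rewrite patchE mem_set ?subrr ?normr0//= in_itv/= -ler_norml.
  by near: n; exact: nbhs_infty_ger.
- exact: integrable_norm.
- by move=> n x; rewrite patchE; case: ifP => // _; rewrite normr0.
Unshelve. all: end_near. Qed.

(** Replaces integration by parts on the line: by the fundamental theorem on [[-n, n]] only boundary
    values of [F] remain, and these are at most of order [1 / n]. *)
Lemma Rintegral_derivative0 (F f : R -> R) (C : R) :
  (forall y : R, is_derive y 1 F (f y)) -> continuous f ->
  leb.-integrable setT (fun x => (f x)%:E) ->
  (forall y, `|F y| <= C / (1 + y ^+ 2)) ->
  \int[leb]_y f y = 0.
Proof.
move=> dF cf jf FC.
have cF : continuous F.
  by move=> y; apply/differentiable_continuous/derivable1_diffP; exact: ex_derive.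
have h1 := cvg_Rintegral_itv jf.
have h2 : (fun n => \int[leb]_(x in `[(- n%:R), n%:R]) f x) @ \oo --> (0 : R).
  (* Indexed by [n.+1], as the fundamental theorem is applied on an interval of positive length. *)
  have E n : \int[leb]_(x in `[(- n.+1%:R), n.+1%:R]) f x = F n.+1%:R - F (- n.+1%:R).
    rewrite /Rintegral (@continuous_FTC2 _ f F)//.
    - by rewrite ltrNl (lt_trans _ (ltr0Sn _ _))// ltrNl oppr0 ltr0Sn.
    - exact: continuous_subspaceT.
    - split; [by move=> x _; exact: ex_derive|..].
        by apply: cvg_at_right_filter; exact: cF.
      by apply: cvg_at_left_filter; exact: cF.
    - by move=> x _; rewrite derive1E; exact: derive_val.
  have bnd n : `|F n.+1%:R - F (- n.+1%:R)| <= 2 * `|C| * n.+1%:R^-1.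
    have n0 : 0 < n.+1%:R :> R by rewrite ltr0Sn.
    have B : C / (1 + n.+1%:R ^+ 2) <= `|C| * n.+1%:R^-1.
      have q : 0 < 1 + n.+1%:R ^+ 2 :> R by rewrite ltr_wpDr// sqr_ge0.
      apply: (@le_trans _ _ (`|C| / (1 + n.+1%:R ^+ 2))).
        by apply: ler_wpM2r; [rewrite invr_ge0 ltW|exact: ler_norm].
      by apply: ler_wpM2l => //; rewrite lef_pV2 ?posrE//; nra.
    apply: (le_trans (ler_normB _ _)).
    have := le_trans (FC n.+1%:R) B; have := FC (- n.+1%:R); rewrite sqrrN => /le_trans/(_ B) h3 h4.
    by apply: (le_trans (lerD h4 h3)); rewrite -mulrA mulr_natl mulr2n.
  rewrite -(cvg_shiftS (fun n => \int[leb]_(x in `[(- n%:R), n%:R]) f x)).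
  rewrite (_ : (fun n => _) = (fun n => F n.+1%:R - F (- n.+1%:R))); last by apply/funext.
  apply: norm_cvg0.
  apply: (@squeeze_cvgr _ _ _ _ (cst 0) (fun n => 2 * `|C| * n.+1%:R^-1)).
  - by apply: nearW => n; rewrite normr_ge0 bnd.
  - exact: cvg_cst.
  - rewrite -[X in _ --> X](mulr0 (2 * `|C|)); apply: cvgMr; exact: cvg_harmonic.
exact: (cvg_unique _ h1 h2).
Qed.

End lebR.

(** * The I-MMSE relation *)

Section kernel.
Context {R : realType} d (T : measurableType d) (P : probability T R) (X : T -> R).
Hypothesis mX : measurable_fun setT X.
Hypothesis hm : forall k, P.-integrable setT (fun w => (`|X w| ^+ k)%:E).
Local Notation phi := (@normal_pdf R 0 1).

(** The expectations of these functions close up under differentiation: [d/dy] takes [gmom j 0] to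
    [- gmom j 1], [d/dg] takes it to [gmom j.+1 1], and [gmom_rec] expresses the index [i = 1]
    through [i = 0]. So [i <= 1] suffices throughout. *)
Definition gker (j i : nat) (g y : R) (w : T) : R :=
  X w ^+ j * (y - g * X w) ^+ i * phi (y - g * X w).

Definition gmom (j i : nat) (g y : R) : R := \int[P]_w gker j i g y w.

(** Expanded in powers of [|X w|], so that it is integrable term by term from the moments; [gdomE]
    is the form in which it dominates [gker], uniformly for [|g| <= B]. *)
Definition gdom (j : nat) (B : R) (w : T) : R :=
  12 ^+ 3 * (`|X w| ^+ j + 2 * B ^+ 2 * `|X w| ^+ j.+2 + B ^+ 4 * `|X w| ^+ j.+4).

Lemma gdomE j B w : gdom j B w = 12 ^+ 3 * (`|X w| ^+ j * (1 + (B * X w) ^+ 2) ^+ 2).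
Proof.
rewrite /gdom -(real_normK (num_real (B * X w))) normrM exprMn real_normK ?num_real//.
by rewrite !exprS; ring.
Qed.

Lemma integrable_gdom j B : P.-integrable setT (fun w => (gdom j B w)%:E).
Proof.
apply: integrableZ; apply: integrableDE; [apply: integrableDE|]; [exact: hm|..];
by apply: integrableZ; exact: hm.
Qed.

Lemma gdom_ge0 j B w : 0 <= gdom j B w.
Proof.
rewrite gdomE; apply: mulr_ge0; first exact: exprn_ge0.
by apply: mulr_ge0; apply: exprn_ge0 => //; rewrite addr_ge0// sqr_ge0.
Qed.

(** This is [phi_shift_bound] at the point [y - g X] with shift [g X]. The bound separates [w] from
    [y], so it dominates under the expectation and, once integrated over [w], also in [y]. *)
Lemma gker_le j i (B g y : R) w : (i <= 1)%N -> `|g| <= B ->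
  `|gker j i g y w| <= gdom j B w / (1 + y ^+ 2) ^+ 2.
Proof.
move=> i1 gB; have y2 := sqr_ge0 y.
rewrite ler_pdivlMr ?exprn_gt0// ?ltr_wpDr//.
rewrite gdomE /gker !normrM !normrX (ger0_norm (ltW (phi_gt0 _))).
have h := phi_shift_bound (y - g * X w) (g * X w); rewrite subrK in h.
set x := X w in h *; set u := y - g * x in h *.
have wi : `|u| ^+ i <= 1 + `|u|.
  by have := normr_ge0 u; case: i i1 => [|[]]// _; rewrite ?expr0 ?expr1 => ?; lra.
have K0 : 0 <= 12 ^+ 3 :> R by exact: exprn_ge0.
move: (12 ^+ 3) K0 h => K K0 h; rewrite -!mulrA [leRHS]mulrCA; apply: ler_wpM2l; first exact: exprn_ge0.
apply: (@le_trans _ _ ((1 + y ^+ 2) ^+ 2 * ((1 + `|u|) * phi u))).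
  rewrite mulrA mulrC; apply: ler_wpM2l; first by rewrite exprn_ge0// addr_ge0.
  by apply: ler_wpM2r => //; exact/ltW/phi_gt0.
apply: (le_trans h); apply: ler_wpM2l => //.
apply: lerXn2r; rewrite ?nnegrE ?addr_ge0 ?sqr_ge0//.
rewrite lerD2l !exprMn; apply: ler_wpM2r; first exact: sqr_ge0.
by rewrite -(real_normK (num_real g)) lerXn2r ?nnegrE// (le_trans _ gB).
Qed.

Lemma gker_ledom j i (B g y : R) w : (i <= 1)%N -> `|g| <= B ->
  `|gker j i g y w| <= gdom j B w.
Proof.
move=> i1 gB; apply: (le_trans (gker_le j y w i1 gB)).
have y2 := sqr_ge0 y; rewrite ler_pdivrMr ?exprn_gt0 ?ltr_wpDr//.
by apply: ler_peMr; [exact: gdom_ge0|nra].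
Qed.

Lemma measurable_gker j i (g y : R) : measurable_fun setT (gker j i g y).
Proof.
have mw : measurable_fun setT (fun w => y - g * X w).
  by apply: measurable_funB => //; exact: measurable_funM.
apply: measurable_funM; last by apply: measurableT_comp mw; exact: measurable_phi.
by apply: measurable_funM; apply: measurable_funX.
Qed.

Lemma integrable_gker j i (g y : R) : (i <= 1)%N ->
  P.-integrable setT (fun w => (gker j i g y w)%:E).
Proof.
move=> i1; apply: (integrable_dom (measurable_gker j i g y) (integrable_gdom j `|g|)) => x.
exact: gker_ledom.
Qed.

Definition gbnd (j : nat) (B : R) : R := \int[P]_w gdom j B w.

Lemma gbnd_ge0 j B : 0 <= gbnd j B.
Proof. by apply: Rintegral_ge0 => x _; exact: gdom_ge0. Qed.

Lemma gmom_le j i (B g y : R) : (i <= 1)%N -> `|g| <= B ->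
  `|gmom j i g y| <= gbnd j B / (1 + y ^+ 2) ^+ 2.
Proof.
move=> i1 gB; apply: (le_trans (le_normr_Rintegral measurableT (integrable_gker j g y i1))).
rewrite /gbnd -RintegralZr//; last exact: integrable_gdom.
apply: le_Rintegral => //.
- exact: integrable_norm (integrable_gker j g y i1).
- under eq_fun do rewrite mulrC; exact/integrableZ/integrable_gdom.
- by move=> x _; exact: gker_le.
Qed.

Lemma is_derive_gmom_y j (g y : R) :
  is_derive y 1 (gmom j 0 g) (- gmom j 1 g y).
Proof.
have -> : - gmom j 1 g y = \int[P]_w (- gker j 1 g y w).
  rewrite /gmom -[LHS]mulN1r -RintegralZl//; last exact: integrable_gker.
  by apply: eq_Rintegral => w _; rewrite mulN1r.
apply: (@is_derive_Rintegral _ _ _ P (gker j 0 g) (fun s w => - gker j 1 g s w)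
  (gdom j `|g|) y (y - 1) (y + 1)).
- by apply/andP; split; lra.
- by move=> s _; exact: integrable_gker.
- move=> s w _; rewrite /gker.
  have := is_derive_phi_affine (- (g * X w)) 1 s; rewrite !mul1r !(addrC (- _)) => h.
  rewrite (_ : (fun s => _) = (X w ^+ j) *: (fun s => phi (- (g * X w) + 1 * s))).
    by apply: is_derive_eq; rewrite /GRing.scale/= expr1; ring.
  by apply/funext => s0; rewrite /GRing.scale/= expr0 mulr1 mul1r addrC.
- exact: integrable_gdom.
- by move=> s w _; rewrite normrN; exact: gker_ledom.
Qed.

Lemma is_derive_gmom_g j (g y : R) :
  is_derive g 1 (fun g => gmom j 0 g y) (gmom j.+1 1 g y).
Proof.
apply: (@is_derive_Rintegral _ _ _ P (fun g => gker j 0 g y) (fun g => gker j.+1 1 g y)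
  (gdom j.+1 (`|g| + 1)) g (g - 1) (g + 1)).
- by apply/andP; split; lra.
- by move=> s _; exact: integrable_gker.
- move=> s w _; rewrite /gker.
  have h := is_derive_phi_affine y (- X w) s.
  rewrite (_ : (fun s => _) = (X w ^+ j) *: (fun s => phi (y + - X w * s))).
    apply: is_derive_eq; rewrite (_ : y + - X w * s = y - s * X w); last by ring.
    by rewrite /GRing.scale/= expr1 exprS; ring.
  by apply/funext => s0; rewrite /GRing.scale/= expr0 mulr1 mulNr (mulrC s0).
- exact: integrable_gdom.
- move=> s w /andP[s1 s2]; apply: gker_ledom => //.
  have := ler_norm g; have := ler_norm (- g); rewrite normrN.
  by rewrite ler_norml => h1 h2; apply/andP; split; lra.
Qed.

Lemma continuous_gmom j i g : (i <= 1)%N -> continuous (gmom j i g).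
Proof.
move=> i1 y.
have Iy : y \in `]y - 1, y + 1[%classic by rewrite inE/= in_itv/=; apply/andP; split; lra.
apply: (@continuity_under_integral R _ T P (gker j i g) setT measurableT (y - 1) (y + 1) _ _
  (gdom j `|g|)) Iy.
- by move=> s _; exact: integrable_gker.
- apply/aeW => w _ s _; rewrite /gker.
  have cw : {for s, continuous (fun s => s - g * X w)} by apply: cvgB => //; exact: cvg_cst.
  apply: cvgM; last by apply: (cvg_comp _ phi cw); exact: continuous_phi.
  apply: cvgM; first exact: cvg_cst.
  by apply: (cvg_comp _ (fun x => x ^+ i) cw); exact: exprn_continuous.
- exact: integrable_gdom.
- by move=> s _; apply/aeW => w _; exact: gker_ledom.
Qed.

Lemma gmom_rec j (g y : R) : gmom j 1 g y = y * gmom j 0 g y - g * gmom j.+1 0 g y.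
Proof.
rewrite /gmom -!RintegralZl//; try exact: integrable_gker.
rewrite -RintegralB//; try (apply: integrableZ; exact: integrable_gker).
by apply: eq_Rintegral => w _; rewrite /gker expr1 !expr0 exprS; ring.
Qed.

Lemma gmom00_le1 (g y : R) : gmom 0 0 g y <= 1.
Proof.
have -> : (1 : R) = \int[P]_w 1 by rewrite Rintegral_cstP.
apply: le_Rintegral => //; first exact: integrable_gker.
  exact: finite_measure_integrable_cst.
by move=> w _; rewrite /gker !expr0 !mul1r phi_le1.
Qed.

Lemma measurable_gmom j i g : (i <= 1)%N -> measurable_fun setT (gmom j i g).
Proof. by move=> i1; apply: continuous_measurable_fun; exact: continuous_gmom. Qed.

(* Jensen's inequality for the exponential, through its tangent line at the mean. *)
Lemma gmom00_lb (g y : R) :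
  normal_peak 1 * expR (- (y ^+ 2 + g ^+ 2 * \int[P]_w (X w ^+ 2))) <= gmom 0 0 g y.
Proof.
have i2 : P.-integrable setT (fun w => (X w ^+ 2)%:E).
  by have := hm 2; under eq_fun do rewrite real_normK ?num_real//.
set m2 := \int[P]_w (X w ^+ 2).
set u0 := - (y ^+ 2 + g ^+ 2 * m2); set c0 := normal_peak 1.
have i1 : P.-integrable setT (fun w => (1 + (- (y ^+ 2 + g ^+ 2 * X w ^+ 2) - u0))%:E).
  apply: integrableDE; first exact: finite_measure_integrable_cst.
  apply: integrableBE; last exact: finite_measure_integrable_cst.
  under eq_fun do rewrite -mulN1r; apply: integrableZ; apply: integrableDE; first exact: finite_measure_integrable_cst.
  exact: integrableZ.
have E1 : \int[P]_w (1 + (- (y ^+ 2 + g ^+ 2 * X w ^+ 2) - u0)) = 1.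
  have -> : (fun w => 1 + (- (y ^+ 2 + g ^+ 2 * X w ^+ 2) - u0)) = (fun w => (1 - y ^+ 2 - u0) - g ^+ 2 * X w ^+ 2).
    by apply/funext => w; ring.
  rewrite RintegralB//; [|exact: finite_measure_integrable_cst|exact: integrableZ].
  rewrite RintegralZl// Rintegral_cstP/= /u0 -/m2; ring.
rewrite -[leLHS]mulr1 -E1 -RintegralZl//; apply: le_Rintegral => //.
- exact: integrableZ.
- exact: integrable_gker.
- move=> w _; rewrite /gker !expr0 !mul1r phiE -/c0 -mulrA; apply: ler_wpM2l; first exact: normal_peak_ge0.
  set v := - (y ^+ 2 + g ^+ 2 * X w ^+ 2).
  apply: (@le_trans _ _ (expR v)).
    have -> : expR v = expR u0 * expR (v - u0) by rewrite -expRD addrC subrK.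
    apply: ler_wpM2l; first exact: expR_ge0.
    exact: expR_ge1Dx.
  (* The exponents differ by [(y + g X)^2 / 2]. *)
  by rewrite ler_expR /v; have := sqr_ge0 (y + g * X w); nra.
Qed.

End kernel.

(** * Entropy of [g X + N] and its derivative in [g] *)

Section entropy.
Context {R : realType} d (T : measurableType d) (P : probability T R) (X : T -> R).
Hypothesis mX : measurable_fun setT X.
Hypothesis hm : forall k, P.-integrable setT (fun w => (`|X w| ^+ k)%:E).
Local Notation phi := (@normal_pdf R 0 1).
Local Notation leb := (@lebesgue_measure R).
Local Notation p := (gmom P X 0 0).
Local Notation a := (gmom P X 1 0).
Local Notation c := (gmom P X 2 0).

Lemma gmom00_gt0 (g y : R) : 0 < p g y.
Proof.
by apply: lt_le_trans (gmom00_lb mX hm g y); rewrite mulr_gt0 ?expR_gt0 ?normal_peak1_gt0.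
Qed.

(** By [p <= 1] and [gmom00_lb], [ln p] grows at most like [y^2]. The constant exceeds by one what
    [ln p] itself requires; this leaves room for [1 + ln p], the factor in the derivative of
    [p ln p]. *)
Definition lbnd (B : R) : R := 2 + B ^+ 2 * \int[P]_w (X w ^+ 2) - ln (normal_peak 1).

Lemma ln_gmom00_le (g y B : R) : `|g| <= B -> `|ln (p g y)| <= (lbnd B - 1) * (1 + y ^+ 2).
Proof.
move=> gB; have p0 := gmom00_gt0 g y; have p1 := gmom00_le1 mX hm g y.
have y2 := sqr_ge0 y.
have M0 : 0 <= \int[P]_w (X w ^+ 2) by apply: Rintegral_ge0 => w _; exact: sqr_ge0.
have g2 : g ^+ 2 <= B ^+ 2.
  by rewrite -(real_normK (num_real g)) lerXn2r ?nnegrE// (le_trans _ gB).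
rewrite ler0_norm ?ln_le0//.
have L0 : ln (normal_peak 1) <= 0 :> R by rewrite ln_le0 ?normal_peak1_le1.
have : ln (normal_peak 1 * expR (- (y ^+ 2 + g ^+ 2 * \int[P]_w (X w ^+ 2)))) <= ln (p g y).
  by rewrite ler_ln ?posrE ?gmom00_lb// mulr_gt0 ?expR_gt0 ?normal_peak1_gt0.
rewrite lnM ?posrE ?expR_gt0 ?normal_peak1_gt0// expRK /lbnd.
have := ler_wpM2r M0 g2.
set M := \int[P]_w (X w ^+ 2) in M0 *; set L := ln _ in L0 *; set q := ln (p g y) => h1 h2.
have B2 := sqr_ge0 B; have := mulr_ge0 (mulr_ge0 B2 M0) y2; nra.
Qed.

Lemma lnD1_gmom00_le (g y B : R) : `|g| <= B -> `|1 + ln (p g y)| <= lbnd B * (1 + y ^+ 2).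
Proof.
move=> gB; apply: (le_trans (ler_normD _ _)); have := ln_gmom00_le y gB.
by rewrite normr1 mulrBl mul1r; have := sqr_ge0 y; lra.
Qed.

(** The decay [(1 + y^2)^-2] of [gmom] pays for the growth of the logarithm and still leaves an
    integrable bound. *)
Lemma gmom_log_bound j i (g y B L : R) : (i <= 1)%N -> `|g| <= B -> `|L| <= lbnd B * (1 + y ^+ 2) ->
  `|gmom P X j i g y * L| <= gbnd P X j B * lbnd B / (1 + y ^+ 2).
Proof.
move=> i1 gB hL; have y2 := sqr_ge0 y; have q : 0 < 1 + y ^+ 2 by lra.
rewrite normrM; apply: (le_trans (ler_pM _ _ (gmom_le mX hm j y i1 gB) hL)) => //.
by rewrite le_eqVlt; apply/orP; left; apply/eqP; field; rewrite gt_eqF.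
Qed.

Lemma is_derive_log_g (g y : R) :
  is_derive g 1 (fun g => ln (p g y)) (gmom P X 1 1 g y / p g y).
Proof.
have h1 := is_derive_gmom_g mX hm 0 g y.
have h2 := is_derive1_ln (gmom00_gt0 g y).
have := @is_derive1_comp _ _ (fun g => p g y) _ _ _ h2 h1.
by rewrite mulrC.
Qed.

Lemma is_derive_log_y (g y : R) :
  is_derive y 1 (fun y => ln (p g y)) (- gmom P X 0 1 g y / p g y).
Proof.
have h1 := is_derive_gmom_y mX hm 0 g y.
have h2 := is_derive1_ln (gmom00_gt0 g y).
have := @is_derive1_comp _ _ (p g) _ _ _ h2 h1.
by rewrite mulrC.
Qed.

Definition entk (g y : R) : R := - (p g y * ln (p g y)).
Definition dentk (g y : R) : R := - (gmom P X 1 1 g y * (1 + ln (p g y))).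
(** The differential entropy of [g X + N]. In the variable [g = sqrt t] it is differentiable on the
    whole line, so that [g = 0] is an ordinary interior point. *)
Definition Ent (g : R) : R := \int[leb]_y entk g y.

Lemma is_derive_entk (g y : R) : is_derive g 1 (fun g => entk g y) (dentk g y).
Proof.
have h1 := is_derive_gmom_g mX hm 0 g y.
have h2 := is_derive_log_g g y.
have p0 := gmom00_gt0 g y.
have := is_deriveN (is_deriveM h1 h2).
rewrite /GRing.scale/= /dentk.
rewrite (_ : - (_ + _) = - (gmom P X 1 1 g y * (1 + ln (p g y)))) //.
by field; rewrite gt_eqF.
Qed.

Lemma continuous_log_y (g : R) : continuous (fun y => ln (p g y)).
Proof.
move=> y; apply/differentiable_continuous/derivable1_diffP.
by apply: ex_derive; exact: is_derive_log_y.
Qed.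

Lemma measurable_entk (g : R) : measurable_fun setT (entk g).
Proof.
apply: continuous_measurable_fun => y; apply: cvgN; apply: cvgM.
  exact: continuous_gmom.
exact: continuous_log_y.
Qed.

Lemma integrable_bnd (f : R -> R) (C : R) : measurable_fun setT f ->
  (forall y, `|f y| <= C / (1 + y ^+ 2)) -> leb.-integrable setT (fun y => (f y)%:E).
Proof.
move=> mf fC; apply: (integrable_domR mf _ fC); apply: integrableZ.
exact: integrable_oneDsqrV.
Qed.

Lemma entk_le (g y B : R) : `|g| <= B -> `|entk g y| <= gbnd P X 0 B * lbnd B / (1 + y ^+ 2).
Proof.
move=> gB; rewrite normrN; apply: gmom_log_bound => //.
apply: (le_trans (ln_gmom00_le y gB)); apply: ler_wpM2r; last by lra.
by rewrite addr_ge0 ?sqr_ge0.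
Qed.

Lemma dentk_le (g y B : R) : `|g| <= B -> `|dentk g y| <= gbnd P X 1 B * lbnd B / (1 + y ^+ 2).
Proof. by move=> gB; rewrite normrN; apply: gmom_log_bound => //; exact: lnD1_gmom00_le. Qed.

Lemma is_derive_Ent_dentk (g : R) : is_derive g 1 Ent (\int[leb]_y dentk g y).
Proof.
set B := `|g| + 1.
have sB s : g - 1 < s < g + 1 -> `|s| <= B.
  have := ler_norm g; have := ler_norm (- g); rewrite normrN /B.
  by rewrite ler_norml => h1 h2 /andP[s1 s2]; apply/andP; split; lra.
apply: (@is_derive_Rintegral _ _ _ leb entk dentk
  (fun y => gbnd P X 1 B * lbnd B / (1 + y ^+ 2)) g (g - 1) (g + 1)).
- by apply/andP; split; lra.
- move=> s /sB sB'; apply: integrable_bnd; first exact: measurable_entk.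
  by move=> y; exact: entk_le.
- by move=> s y _; exact: is_derive_entk.
- by apply: integrableZ; exact: integrable_oneDsqrV.
- by move=> s y /sB sB'; exact: dentk_le.
Qed.

(* [p g] is the density of [g X + N], [a g / p g] is the conditional mean of [X] given
   [g X + N = y], and [mmsek g] is the conditional variance times [p g]. *)
Definition mmsek (g y : R) : R := c g y - a g y ^+ 2 / p g y.
Definition mmse (g : R) : R := \int[leb]_y mmsek g y.

(* Cauchy-Schwarz: [c - 2 l a + l^2 p] is the integral of [(X - l)^2 phi]. *)
Lemma mmsek_ge0 (g y : R) : 0 <= mmsek g y.
Proof.
have p0 := gmom00_gt0 g y.
have -> : mmsek g y = \int[P]_w (gker X 2 0 g y w
    - (2 * (a g y / p g y)) * gker X 1 0 g y w + (a g y / p g y) ^+ 2 * gker X 0 0 g y w).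
  rewrite RintegralD//; last first.
  - by apply: integrableZ; exact: integrable_gker.
  - apply: integrableBE; first exact: integrable_gker.
    by apply: integrableZ; exact: integrable_gker.
  rewrite RintegralB//; [|exact: integrable_gker|by apply: integrableZ; exact: integrable_gker].
  rewrite !RintegralZl//; try exact: integrable_gker.
  rewrite -/(gmom P X 2 0 g y) -/(gmom P X 1 0 g y) -/(gmom P X 0 0 g y) /mmsek.
  by field; rewrite gt_eqF.
apply: Rintegral_ge0 => w _; set l := a g y / p g y.
rewrite /gker !expr0 !mulr1 expr1 mul1r.
have -> : forall u, X w ^+ 2 * u - 2 * l * (X w * u) + l ^+ 2 * u = (X w - l) ^+ 2 * u.
  by move=> u; ring.
by rewrite mulr_ge0 ?sqr_ge0// ltW// phi_gt0.
Qed.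

Lemma mmsek_le (g y B : R) : `|g| <= B -> `|mmsek g y| <= gbnd P X 2 B / (1 + y ^+ 2).
Proof.
move=> gB; rewrite ger0_norm ?mmsek_ge0//.
have y2 := sqr_ge0 y.
apply: (@le_trans _ _ (c g y)).
  by rewrite gerBl divr_ge0 ?sqr_ge0// ltW// gmom00_gt0.
apply: (le_trans (ler_norm _)); apply: (le_trans (gmom_le mX hm 2 y (isT : (0 <= 1)%N) gB)).
apply: ler_wpM2l; first exact: gbnd_ge0.
by rewrite lef_pV2 ?posrE ?exprn_gt0//; nra.
Qed.

Lemma continuous_mmsek_y (g : R) : continuous (mmsek g).
Proof.
move=> y; apply: cvgB; first exact: continuous_gmom.
apply: cvgM; last by apply: cvgV; [rewrite gt_eqF// gmom00_gt0|exact: continuous_gmom].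
by apply: (cvg_comp _ (fun x => x ^+ 2)); [exact: continuous_gmom|exact: exprn_continuous].
Qed.

Lemma integrable_mmsek (g : R) : leb.-integrable setT (fun y => (mmsek g y)%:E).
Proof.
apply: (@integrable_bnd _ (gbnd P X 2 `|g|)).
  by apply: continuous_measurable_fun; exact: continuous_mmsek_y.
by move=> y; exact: mmsek_le.
Qed.

Lemma continuous_gmom_g j (y : R) : continuous (fun g => gmom P X j 0 g y).
Proof.
move=> g; apply/differentiable_continuous/derivable1_diffP; apply: ex_derive.
exact: is_derive_gmom_g.
Qed.

Lemma continuous_mmse : continuous mmse.
Proof.
move=> g; set B := `|g| + 1.
have sB s : `]g - 1, g + 1[%classic s -> `|s| <= B.
  rewrite /= in_itv/=; have := ler_norm g; have := ler_norm (- g); rewrite normrN /B.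
  by rewrite ler_norml => h1 h2 /andP[s1 s2]; apply/andP; split; lra.
have Ig : g \in `]g - 1, g + 1[%classic by rewrite inE/= in_itv/=; apply/andP; split; lra.
apply: (@continuity_under_integral R _ _ leb mmsek setT measurableT (g - 1) (g + 1) _ _
  (fun y => gbnd P X 2 B / (1 + y ^+ 2))) Ig.
- by move=> s _; exact: integrable_mmsek.
- apply/aeW => y _ s _; apply: cvgB; first exact: continuous_gmom_g.
  apply: cvgM; last by apply: cvgV; [rewrite gt_eqF// gmom00_gt0|exact: continuous_gmom_g].
  by apply: (cvg_comp _ (fun x => x ^+ 2)); [exact: continuous_gmom_g|exact: exprn_continuous].
- by apply: integrableZ; exact: integrable_oneDsqrV.
- by move=> s /sB sB'; apply/aeW => y _; exact: mmsek_le.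
Qed.

(* [a ln p] vanishes at infinity and has derivative [dentk - g mmsek] in [y]. *)
Lemma dentkE (g : R) : \int[leb]_y dentk g y = g * mmse g.
Proof.
have idk : leb.-integrable setT (fun y => (dentk g y)%:E).
  apply: (@integrable_bnd _ (gbnd P X 1 `|g| * lbnd `|g|)); last by move=> y; exact: dentk_le.
  apply: continuous_measurable_fun => y; apply: cvgN; apply: cvgM.
    exact: continuous_gmom.
  by apply: cvgD; [exact: cvg_cst|exact: continuous_log_y].
have H : \int[leb]_y (dentk g y - g * mmsek g y) = 0.
  apply: (@Rintegral_derivative0 _ (fun y => a g y * ln (p g y)) _ (gbnd P X 1 `|g| * lbnd `|g|)).
  - move=> y; have p0 := gmom00_gt0 g y.
    have h1 := is_derive_gmom_y mX hm 1 g y.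
    have h2 := is_derive_log_y g y.
    have := is_deriveM h1 h2; rewrite /GRing.scale/=.
    rewrite (_ : _ + _ = dentk g y - g * mmsek g y)//.
    (* After [gmom_rec] the logarithmic terms match, the terms [y * a] cancel, and what is left is
       [g * (c - a^2 / p)]. *)
    rewrite /dentk /mmsek !gmom_rec//; field; by rewrite gt_eqF.
  - move=> y; apply: cvgB; last first.
      by apply: cvgM; [exact: cvg_cst|exact: continuous_mmsek_y].
    apply: cvgN; apply: cvgM; first exact: continuous_gmom.
    by apply: cvgD; [exact: cvg_cst|exact: continuous_log_y].
  - by apply: integrableBE => //; apply: integrableZ; exact: integrable_mmsek.
  - move=> y; apply: gmom_log_bound => //.
    apply: (le_trans (ln_gmom00_le y (lexx _))); apply: ler_wpM2r; last by lra.
    by rewrite addr_ge0 ?sqr_ge0.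
move: H; rewrite RintegralB//; last by apply: integrableZ; exact: integrable_mmsek.
rewrite RintegralZl//; last exact: integrable_mmsek.
by move/eqP; rewrite subr_eq0 => /eqP.
Qed.

Lemma is_derive_Ent (g : R) : is_derive g 1 Ent (g * mmse g).
Proof. by rewrite -dentkE; exact: is_derive_Ent_dentk. Qed.

(** The factor [1 / (2 sqrt t)] from the chain rule cancels the [g] in the derivative of [Ent]. At
    [0] the square root is merely continuous, which is all that the fundamental theorem asks at an
    endpoint. *)
Lemma integral_mmse (b : R) : 0 < b ->
  (\int[leb]_(t in `[0%R, b]) (mmse (Num.sqrt t) / 2)%:E = (Ent (Num.sqrt b) - Ent 0)%:E)%E.
Proof.
move=> b0.
have cE : continuous Ent.
  move=> g; apply/differentiable_continuous/derivable1_diffP; apply: ex_derive; exact: is_derive_Ent.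
have cF : continuous (Ent \o Num.sqrt).
  by move=> t; apply: (cvg_comp _ Ent); [exact: sqrt_continuous|exact: cE].
have dF (t : R) : 0 < t -> is_derive t 1 (Ent \o Num.sqrt) (mmse (Num.sqrt t) / 2).
  move=> t0; have h1 := is_derive1_sqrt t0; have h2 := is_derive_Ent (Num.sqrt t).
  have := is_derive1_comp h2 h1.
  rewrite (_ : _ * _ = mmse (Num.sqrt t) / 2)//.
  by field; rewrite gt_eqF// sqrtr_gt0.
have h1 : {within `[0, b], continuous (fun t => mmse (Num.sqrt t) / 2)}.
  apply: continuous_subspaceT => t; apply: cvgM; last exact: cvg_cst.
  by apply: (cvg_comp _ mmse); [exact: sqrt_continuous|exact: continuous_mmse].
have h2 : derivable_oo_LRcontinuous (Ent \o Num.sqrt) 0 b.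
  split.
  + by move=> t tab; have t0 : 0 < t by [rewrite (itvP tab)]; exact: (@ex_derive _ _ _ _ _ _ _ (dF t t0)).
  + by apply: cvg_at_right_filter; exact: cF.
  + by apply: cvg_at_left_filter; exact: cF.
have h3 : {in `]0, b[, derive1 (Ent \o Num.sqrt) =1 (fun t => mmse (Num.sqrt t) / 2)}.
  by move=> t tab; have t0 : 0 < t by [rewrite (itvP tab)]; rewrite derive1E; exact: (@derive_val _ _ _ _ _ _ _ (dF t t0)).
have := continuous_FTC2 b0 h1 h2 h3; rewrite -EFinB /comp sqrtr0; exact.
Qed.

Lemma integrable_phiX (k : nat) : leb.-integrable setT (fun z => (`|z| ^+ k * phi z)%:E).
Proof.
apply: (@integrable_bnd _ ((2 * k.+1%:R) ^+ k.+1)).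
  apply: measurable_funM; last exact: measurable_phi.
  by apply: measurable_funX; exact: normr_measurable.
move=> z; have z2 := sqr_ge0 z; have p0 := ltW (phi_gt0 z).
have q : 0 < 1 + z ^+ 2 by lra.
rewrite ger0_norm; last by rewrite mulr_ge0// exprn_ge0.
rewrite ler_pdivlMr//; apply: le_trans (phi_bound k.+1 z).
rewrite mulrAC; apply: ler_wpM2r => //; rewrite (exprSr _ k); apply: ler_wpM2r; first exact: ltW.
apply: lerXn2r; rewrite ?nnegrE ?(ltW q)//.
by rewrite -(real_normK (num_real z)); have := sqr_ge0 (`|z| - 1); have := sqr_ge0 `|z|; nra.
Qed.

(** [y * phi y] has derivative [phi y - y^2 * phi y] and vanishes at infinity. *)
Lemma integral_phi_sqr : \int[leb]_y (y ^+ 2 * phi y) = 1.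
Proof.
have E1 : \int[leb]_y phi y = 1 by rewrite /Rintegral integral_normal_pdf.
have i1 : leb.-integrable setT (fun y => (phi y)%:E) by exact: integrable_normal_pdf.
have i2 : leb.-integrable setT (fun y => (y ^+ 2 * phi y)%:E).
  by have := integrable_phiX 2; under eq_fun do rewrite real_normK ?num_real//.
have : \int[leb]_y (phi y - y ^+ 2 * phi y) = 0.
  apply: (@Rintegral_derivative0 _ (fun y => y * phi y) _ (6 ^+ 3)).
  - move=> y; have := is_deriveM (is_derive_id y (1 : R)) (is_derive_phi y).
    rewrite /GRing.scale/= (_ : _ + _ = phi y - y ^+ 2 * phi y)//; ring.
  - move=> y; apply: cvgB; first exact: continuous_phi.
    by apply: cvgM; [exact: exprn_continuous|exact: continuous_phi].
  - exact: integrableBE.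
  - move=> y; have p0 := ltW (phi_gt0 y); have y2 := sqr_ge0 y.
    rewrite ler_pdivlMr; last by lra.
    apply: le_trans (phi_bound3 y); rewrite normrM (ger0_norm p0) mulrAC.
    apply: ler_wpM2r => //; rewrite exprS; rewrite mulrC; apply: ler_wpM2l; first lra.
    apply: (@le_trans _ _ (1 + y ^+ 2)); last by rewrite expr2 ler_peMr//; lra.
    by rewrite -(real_normK (num_real y)); have := sqr_ge0 (`|y| - 1); have := sqr_ge0 `|y|; nra.
by rewrite RintegralB// E1 => /eqP; rewrite subr_eq0 => /eqP.
Qed.

Lemma Ent0 : Ent 0 = (ln (pi *+ 2) + 1) / 2.
Proof.
have p0 y : p 0 y = phi y.
  rewrite /gmom (_ : gker X 0 0 0 y = fun=> phi y) ?Rintegral_cstP//.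
  by apply/funext => w; rewrite /gker !expr0 !mul1r mul0r subr0.
have i1 : leb.-integrable setT (fun y => (phi y)%:E) by exact: integrable_normal_pdf.
have i2 : leb.-integrable setT (fun y => (y ^+ 2 * phi y)%:E).
  by have := integrable_phiX 2; under eq_fun do rewrite real_normK ?num_real//.
have -> : Ent 0 = \int[leb]_y (- ln (normal_peak 1) * phi y + 2^-1 * (y ^+ 2 * phi y)).
  apply: eq_Rintegral => y _; rewrite /entk p0 {2}phiE lnM ?posrE ?expR_gt0 ?normal_peak1_gt0//.
  by rewrite expRK; field.
rewrite RintegralD//; try exact: integrableZ.
rewrite !RintegralZl// integral_phi_sqr /Rintegral integral_normal_pdf/=.
have pp : 0 < (pi : R) *+ 2 by rewrite pmulrn_lgt0 ?pi_gt0.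
rewrite /normal_peak expr1n mul1r lnV ?posrE ?sqrtr_gt0//.
rewrite -[in RHS](sqr_sqrtr (ltW pp)) lnXn ?sqrtr_gt0// mulr2n; by field.
Qed.

End entropy.

(** * Density of the polynomials in weighted L2 spaces *)

Section density.
Context {R : realType}.
Local Notation leb := (@lebesgue_measure R).
Variables (p : R -> R) (e0 : R).
Hypothesis mp : measurable_fun setT p.
Hypothesis p0 : forall y, 0 <= p y.
Hypothesis e00 : 0 < e0.
Hypothesis pexp : leb.-integrable setT (fun y => (expR (e0 * `|y|) * p y)%:E).

Definition wsq (f : R -> R) : \bar R := (\int[leb]_y (f y ^+ 2 * p y)%:E)%E.

Lemma measurable_wsq (f : R -> R) : measurable_fun setT f ->
  measurable_fun setT (fun y : R => (f y ^+ 2 * p y)%:E).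
Proof.
by move=> mf; apply/measurable_EFinP; apply: measurable_funM => //; exact: measurable_funX.
Qed.

Lemma wsq_ge0 f : (0 <= wsq f)%E.
Proof. by apply: integral_ge0 => y _; rewrite lee_fin mulr_ge0// sqr_ge0. Qed.

(** [(f + g)^2 <= 2 f^2 + 2 g^2] takes the place of the triangle inequality; hence the tolerances
    [e / 4] below. *)
Lemma wsqD (f g : R -> R) : measurable_fun setT f -> measurable_fun setT g ->
  (wsq (fun y => f y + g y)%R <= 2%:E * wsq f + 2%:E * wsq g)%E.
Proof.
move=> mf mg; rewrite /wsq.
have mf2 := measurable_wsq mf; have mg2 := measurable_wsq mg.
rewrite -!ge0_integralZl//=; try by move=> y _; rewrite lee_fin mulr_ge0 ?sqr_ge0.
have nn (h : R -> R) y : setT y -> (0 <= 2%:E * (h y ^+ 2 * p y)%:E)%E.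
  by move=> _; rewrite -EFinM lee_fin mulr_ge0// mulr_ge0 ?sqr_ge0.
rewrite -ge0_integralD//=; [|by move=> y _; exact: nn|exact: measurable_funeM|by move=> y _; exact: nn|exact: measurable_funeM].
apply: ge0_le_integral => //.
- by move=> y _; rewrite lee_fin mulr_ge0 ?sqr_ge0.
- by apply: measurable_wsq; exact: measurable_funD.
- by apply: emeasurable_funD; exact: measurable_funeM.
- move=> y _; rewrite -!EFinM -EFinD lee_fin.
  by have := p0 y; have := sqr_ge0 (f y - g y); nra.
Qed.

Definition papprox (v : R -> R) : Prop := measurable_fun setT v /\
  forall e, 0 < e -> exists q : {poly R}, (wsq (fun y => v y - q.[y])%R < e%:E)%E.

Lemma measurable_horner (q : {poly R}) : measurable_fun setT (fun y : R => q.[y]).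
Proof. by apply: continuous_measurable_fun; exact: continuous_horner. Qed.

Lemma papprox_closed (v : R -> R) : measurable_fun setT v ->
  (forall e, 0 < e -> exists u, papprox u /\ (wsq (fun y => v y - u y)%R < e%:E)%E) -> papprox v.
Proof.
move=> mv H; split => // e e1.
have e4 : 0 < e / 4 by rewrite divr_gt0.
have [u [[mu Hu] uv]] := H _ e4; have [q uq] := Hu _ e4; exists q.
have mq := measurable_horner q.
have -> : (fun y => v y - q.[y]) = (fun y => (v y - u y) + (u y - q.[y])).
  by apply/funext => y; ring.
apply: (le_lt_trans (wsqD _ _)); [exact: measurable_funB|exact: measurable_funB|].
have -> : e%:E = (2%:E * (e / 4)%:E + 2%:E * (e / 4)%:E)%E.
  by rewrite -!EFinM -EFinD; congr (_%:E); field.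
by apply: lteD; rewrite lte_pmul2l.
Qed.

Lemma papprox_poly (q : {poly R}) : papprox (fun y => q.[y]).
Proof.
split; first exact: measurable_horner.
move=> e e1; exists q; rewrite /wsq; under eq_integral do rewrite subrr expr0n/= mul0r.
by rewrite integral0 lte_fin.
Qed.

Lemma papproxD (u v : R -> R) : papprox u -> papprox v -> papprox (fun y => u y + v y).
Proof.
move=> [mu Hu] [mv Hv]; split; first exact: measurable_funD.
move=> e e1; have e4 : 0 < e / 4 by rewrite divr_gt0.
have [q uq] := Hu _ e4; have [r vr] := Hv _ e4; exists (q + r).
have -> : (fun y => u y + v y - (q + r).[y]) = (fun y => (u y - q.[y]) + (v y - r.[y])).
  by apply/funext => y; rewrite hornerD; ring.
apply: (le_lt_trans (wsqD _ _)); [by apply: measurable_funB => //; exact: measurable_horner..|].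
have -> : e%:E = (2%:E * (e / 4)%:E + 2%:E * (e / 4)%:E)%E.
  by rewrite -!EFinM -EFinD; congr (_%:E); field.
by apply: lteD; rewrite lte_pmul2l.
Qed.

Lemma papproxZ (k : R) (u : R -> R) : papprox u -> papprox (fun y => k * u y).
Proof.
move=> [mu Hu]; split; first exact: measurable_funM.
move=> e e1; have k2 : 0 < k ^+ 2 + 1 by rewrite ltr_wpDl// sqr_ge0.
have ek : 0 < e / (k ^+ 2 + 1) by rewrite divr_gt0.
have [q uq] := Hu _ ek; exists (k *: q).
have mq := measurable_horner q.
apply: (@le_lt_trans _ _ ((k ^+ 2 + 1)%:E * wsq (fun y => u y - q.[y])%R)%E).
  rewrite /wsq -ge0_integralZl//=; last 3 first.
  - by apply: measurable_wsq; exact: measurable_funB.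
  - by move=> y _; rewrite lee_fin mulr_ge0 ?sqr_ge0.
  - by rewrite lee_fin ltW.
  apply: ge0_le_integral => //.
  - by move=> y _; rewrite lee_fin mulr_ge0 ?sqr_ge0.
  - apply: measurable_wsq; apply: measurable_funB; first exact: measurable_funM.
    exact: measurable_horner.
  - by apply: measurable_funeM; apply: measurable_wsq; exact: measurable_funB.
  - move=> y _; rewrite -EFinM lee_fin hornerZ -mulrBr exprMn -mulrA; apply: ler_wpM2r; last by rewrite lerDl.
    by rewrite mulr_ge0 ?sqr_ge0.
rewrite (_ : e%:E = ((k ^+ 2 + 1)%:E * (e / (k ^+ 2 + 1))%:E)%E).
  by rewrite lte_pmul2l// lte_fin.
by rewrite -EFinM; congr (_%:E); field; rewrite gt_eqF.
Qed.

Lemma papprox_sum (I : Type) (s : seq I) (F : I -> R -> R) :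
  (forall i, papprox (F i)) -> papprox (fun y => \sum_(i <- s) F i y).
Proof.
move=> HF; elim: s => [|i s IH].
  rewrite (_ : (fun y => _) = (fun y => (0 : {poly R}).[y])); first exact: papprox_poly.
  by apply/funext => y; rewrite big_nil horner0.
rewrite (_ : (fun y => _) = (fun y => F i y + \sum_(j <- s) F j y)); first exact: papproxD.
by apply/funext => y; rewrite big_cons.
Qed.

Lemma papprox_dct (v_ : nat -> R -> R) (v G : R -> R) :
  (forall n, papprox (v_ n)) -> (forall y, v_ ^~ y @ \oo --> v y) ->
  leb.-integrable setT (fun y => (G y)%:E) ->
  (forall n y, (v y - v_ n y) ^+ 2 * p y <= G y) -> papprox v.
Proof.
move=> Hv cv iG vG.
have mv_ n : measurable_fun setT (v_ n) by exact: (Hv n).1.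
have mv : measurable_fun setT v by apply: (measurable_fun_cvg mv_) => x _; exact: cv.
apply: papprox_closed => // e e1.
have mD n : measurable_fun setT (fun y : R => (v y - v_ n y) ^+ 2 * p y).
  by apply: measurable_funM => //; apply: measurable_funX; exact: measurable_funB.
have cD (y : R) : (fun n => (v y - v_ n y) ^+ 2 * p y) @ \oo --> 0 * p y.
  apply: cvgM; last exact: cvg_cst.
  have h : (fun n => v y - v_ n y) @ \oo --> v y - v y by apply: cvgB => //; exact: cvg_cst.
  have := cvgM h h; rewrite subrr mulr0; exact.
have D0 n y : 0 <= (v y - v_ n y) ^+ 2 * p y by rewrite mulr_ge0 ?sqr_ge0.
have [_] := @Rdominated _ (measurableTypeR R) R leb (fun n (y : R) => (v y - v_ n y) ^+ 2 * p y) (fun y => 0 * p y) G mD cD iG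
  (fun n y => eq_ind_r (fun z => z <= G y) (vG n y) (ger0_norm (D0 n y))).
have -> : \int[leb]_x (0 * p x) = 0.
  by under eq_Rintegral do rewrite mul0r; rewrite /Rintegral integral0.
move/cvgrPdist_lt => /(_ _ e1)[N _ /(_ N (leqnn N))]; rewrite sub0r normrN => HN.
exists (v_ N); split => //.
have iD : leb.-integrable setT (fun y : R => ((v y - v_ N y) ^+ 2 * p y)%:E).
  by apply: integrable_domR iG _ => // y; rewrite ger0_norm.
rewrite /wsq RintE//lte_fin; apply: le_lt_trans HN; exact: ler_norm.
Qed.

Lemma pow_fact_le_expR (x : R) (j : nat) : 0 <= x -> x ^+ j <= j`!%:R * expR x.
Proof.
case: j => [|j] x0; first by rewrite expr0 fact0 mul1r -[leLHS]expR0 ler_expR.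
have f0 : 0 < j.+1`!%:R :> R by rewrite ltr0n fact_gt0.
have := expR_ge1Dxn j x0; rewrite -ler_pdivrMl// mulrC; lra.
Qed.

Lemma series_norm_le_expR (b : nat -> R) (x : R) (n : nat) :
  (forall i, `|b i| <= (i`!%:R)^-1) ->
  `|\sum_(0 <= i < n) b i * x ^+ i| <= expR `|x|.
Proof.
move=> hb; apply: (le_trans (ler_norm_sum _ _ _)).
apply: (@le_trans _ _ (series (exp_coeff `|x|) n)).
  apply: ler_sum => i _; rewrite normrM normrX /exp_coeff/= mulrC.
  by apply: ler_wpM2l => //; exact: exprn_ge0.
apply: nondecreasing_cvgn_le; last exact: is_cvg_series_exp_coeff.
apply/nondecreasing_seqP => k; rewrite /series/= big_nat_recr//= lerDl.
by rewrite /exp_coeff/= divr_ge0// exprn_ge0.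
Qed.

(** With [th <= e0 / 4] and [|y|^j] bounded by a multiple of [expR (e0 / 4 * |y|)], the product is
    of order [expR (e0 / 2 * |y|)], whose square is exactly what the weight tolerates. *)
Lemma wpow_exp_integrable (K : R) (j : nat) (th : R) : 0 <= th -> 4 * th <= e0 ->
  leb.-integrable setT (fun y => (K * (`|y| ^+ j * expR (th * `|y|)) ^+ 2 * p y)%:E).
Proof.
move=> th0 the.
set C := (j`!%:R * (4 / e0) ^+ j : R).
have C0 : 0 <= C by rewrite mulr_ge0// exprn_ge0// divr_ge0// ltW.
apply: (@integrable_domR _ _ (fun y => (`|K| * C ^+ 2) * (expR (e0 * `|y|) * p y))).
- apply: measurable_funM => //; apply: measurable_funM => //; apply: measurable_funX.
  apply: measurable_funM; first by apply: measurable_funX; exact: normr_measurable.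
  by apply: measurableT_comp => //; apply: measurable_funM => //; exact: normr_measurable.
- exact: integrableZ.
move=> y; move: (`|y|) (normr_ge0 y) => z z0.
rewrite normrM (ger0_norm (p0 y)) normrM (ger0_norm (sqr_ge0 _)).
have -> : `|K| * C ^+ 2 * (expR (e0 * z) * p y) = `|K| * (C ^+ 2 * expR (e0 * z)) * p y by ring.
apply: ler_wpM2r; first exact: p0.
apply: ler_wpM2l => //.
have h : z ^+ j * expR (th * z) <= C * expR (e0 / 2 * z).
  have ez : 0 <= e0 / 4 * z by rewrite mulr_ge0// divr_ge0// ltW.
  have -> : z ^+ j = (4 / e0) ^+ j * (e0 / 4 * z) ^+ j.
    by rewrite -exprMn; congr (_ ^+ _); field; rewrite gt_eqF.
  apply: (@le_trans _ _ ((4 / e0) ^+ j * (j`!%:R * expR (e0 / 4 * z)) * expR (th * z))).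
    apply: ler_wpM2r; first exact: expR_ge0.
    apply: ler_wpM2l; last exact: pow_fact_le_expR.
    by rewrite exprn_ge0// divr_ge0// ltW.
  rewrite mulrA (mulrC _ j`!%:R) -/C -mulrA -expRD; apply: ler_wpM2l => //.
  by rewrite ler_expR -mulrDl; apply: ler_wpM2r => //; lra.
have -> : C ^+ 2 * expR (e0 * z) = (C * expR (e0 / 2 * z)) ^+ 2.
  rewrite (exprMn _ C) -expRM_natl; congr (_ * expR _); by field.
apply: lerXn2r; rewrite ?nnegrE//; first by rewrite mulr_ge0 ?expR_ge0// exprn_ge0.
by rewrite mulr_ge0 ?expR_ge0.
Qed.

(** All powers are included because a Taylor series in [y] multiplies [v] by powers of [y]; the
    boundedness of [v] supplies the dominating function. *)
Definition papprox_all (v : R -> R) : Prop :=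
  (exists K : R, forall y, `|v y| <= K) /\ forall j, papprox (fun y => v y * y ^+ j).

(* For small [th] the Taylor series of [h (th * y)] converges in L2, being dominated by
   [expR (e0 * `|y|)]. *)
Lemma papprox_all_series (v h : R -> R) (b : nat -> R) (th : R) :
  papprox_all v -> 0 <= th -> 4 * th <= e0 ->
  (forall i, `|b i| <= (i`!%:R)^-1) -> (forall x, `|h x| <= 1) ->
  (forall x, (fun n => \sum_(0 <= i < n) b i * x ^+ i) @ \oo --> h x) ->
  papprox_all (fun y => v y * h (th * y)).
Proof.
move=> [[K vK] Hv] th0 the hb h1 ch.
have K0 : 0 <= K by exact: le_trans (vK 0).
split.
  exists K => y; rewrite normrM -[leRHS]mulr1; exact: ler_pM.
move=> j.
apply: (@papprox_dct (fun n y => \sum_(0 <= i < n) (b i * th ^+ i) * (v y * y ^+ (j + i))) _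
   (fun y => (4 * K ^+ 2) * (`|y| ^+ j * expR (th * `|y|)) ^+ 2 * p y)).
- by move=> n; apply: papprox_sum => i; exact: papproxZ.
- move=> y.
  rewrite (_ : (fun n => _) = (fun n => (v y * y ^+ j) * \sum_(0 <= i < n) b i * (th * y) ^+ i)).
    by rewrite (mulrAC (v y)); apply: cvgM; [exact: cvg_cst|exact: ch].
  apply/funext => n; rewrite big_distrr/=; apply: eq_bigr => i _.
  by rewrite exprD exprMn; ring.
- exact: wpow_exp_integrable.
- move=> n y; apply: ler_wpM2r; first exact: p0.
  have -> : \sum_(0 <= i < n) b i * th ^+ i * (v y * y ^+ (j + i)) =
     (v y * y ^+ j) * \sum_(0 <= i < n) b i * (th * y) ^+ i.
    rewrite big_distrr/=; apply: eq_bigr => i _; rewrite exprD exprMn; ring.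
  rewrite (mulrAC (v y)) -mulrBr -real_normK ?num_real//.
  have -> : 4 * K ^+ 2 * (`|y| ^+ j * expR (th * `|y|)) ^+ 2 =
    (K * `|y| ^+ j * (2 * expR (th * `|y|))) ^+ 2 by ring.
  have e1 : 1 <= expR (th * `|y|) by rewrite -expR0 ler_expR mulr_ge0.
  apply: lerXn2r; rewrite ?nnegrE//.
    by rewrite mulr_ge0 ?mulr_ge0 ?exprn_ge0 ?expR_ge0.
  rewrite normrM; apply: ler_pM => //.
    by rewrite normrM normrX; apply: ler_wpM2r => //; exact: exprn_ge0.
  apply: (le_trans (ler_normB _ _)).
  have := series_norm_le_expR (th * y) n hb; rewrite normrM (ger0_norm th0).
  have := h1 (th * y); lra.
Qed.

Lemma papprox_allD (u v : R -> R) : papprox_all u -> papprox_all v -> papprox_all (fun y => u y + v y).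
Proof.
move=> [[K uK] Hu] [[L vL] Hv]; split.
  by exists (K + L) => y; apply: (le_trans (ler_normD _ _)); exact: lerD.
move=> j; rewrite (_ : (fun y => _) = (fun y => u y * y ^+ j + v y * y ^+ j)); first exact: papproxD.
by apply/funext => y; rewrite mulrDl.
Qed.

Lemma papprox_allZ (k : R) (u : R -> R) : papprox_all u -> papprox_all (fun y => k * u y).
Proof.
move=> [[K uK] Hu]; split.
  by exists (`|k| * K) => y; rewrite normrM; apply: ler_wpM2l.
move=> j; rewrite (_ : (fun y => _) = (fun y => k * (u y * y ^+ j))); first exact: papproxZ.
by apply/funext => y; rewrite mulrA.
Qed.

Lemma papprox_all1 : papprox_all (fun=> 1).
Proof.
split; first by exists 1 => y; rewrite normr1.
move=> j; rewrite (_ : (fun y => _) = (fun y => ('X^j : {poly R}).[y])); first exact: papprox_poly.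
by apply/funext => y; rewrite mul1r hornerXn.
Qed.

Lemma papprox_all_cos (v : R -> R) (th : R) : papprox_all v -> 0 <= th -> 4 * th <= e0 ->
  papprox_all (fun y => v y * cos (th * y)).
Proof.
move=> Hv th0 the.
apply: (@papprox_all_series v cos (fun n => (~~ odd n)%:R * (-1) ^+ n./2 * (n`!%:R)^-1)) => //.
- move=> i; rewrite !normrM normrX normrN1 expr1n mulr1 (ger0_norm (_ : 0 <= (i`!%:R)^-1))//.
  by case: odd; rewrite /= ?normr0 ?normr1 ?mul0r ?mul1r.
- by move=> x; rewrite ler_norml cos_geN1 cos_le1.
- move=> x; rewrite cos.unlock; have := @is_cvg_series_cos_coeff R x; rewrite cos_coeffE /series/=.
  exact.
Qed.

Lemma papprox_all_sin (v : R -> R) (th : R) : papprox_all v -> 0 <= th -> 4 * th <= e0 ->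
  papprox_all (fun y => v y * sin (th * y)).
Proof.
move=> Hv th0 the.
apply: (@papprox_all_series v sin (fun n => (odd n)%:R * (-1) ^+ n.-1./2 * (n`!%:R)^-1)) => //.
- move=> i; rewrite !normrM normrX normrN1 expr1n mulr1 (ger0_norm (_ : 0 <= (i`!%:R)^-1))//.
  by case: odd; rewrite /= ?normr0 ?normr1 ?mul0r ?mul1r.
- by move=> x; rewrite ler_norml sin_geN1 sin_le1.
- move=> x; rewrite sin.unlock; have := @is_cvg_series_sin_coeff R x; rewrite sin_coeffE /series/=.
  exact.
Qed.

(** L2 approximability is not preserved by products in general, while the multipliers of
    [papprox_all] form an algebra. They contain the sines of small frequency, hence every polynomial
    in them. *)
Definition pmult (m : R -> R) : Prop := forall v, papprox_all v -> papprox_all (fun y => v y * m y).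

Lemma pmultD m1 m2 : pmult m1 -> pmult m2 -> pmult (fun y => m1 y + m2 y).
Proof.
move=> h1 h2 v hv; rewrite (_ : (fun y => _) = (fun y => v y * m1 y + v y * m2 y)).
  by apply: papprox_allD; [exact: h1|exact: h2].
by apply/funext => y; rewrite mulrDr.
Qed.

Lemma pmultM m1 m2 : pmult m1 -> pmult m2 -> pmult (fun y => m1 y * m2 y).
Proof.
move=> h1 h2 v hv; rewrite (_ : (fun y => _) = (fun y => (v y * m1 y) * m2 y)).
  by apply: h2; exact: h1.
by apply/funext => y; rewrite mulrA.
Qed.

Lemma pmultC (k : R) : pmult (fun=> k).
Proof.
move=> v hv; rewrite (_ : (fun y => _) = (fun y => k * v y)); first exact: papprox_allZ.
by apply/funext => y; rewrite mulrC.
Qed.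

Lemma pmultX m n : pmult m -> pmult (fun y => m y ^+ n).
Proof.
move=> hm; elim: n => [|n IH].
  by rewrite (_ : (fun y => _) = (fun=> 1))//; exact: pmultC.
by rewrite (_ : (fun y => _) = (fun y => m y * m y ^+ n)); [exact: pmultM|apply/funext => y; rewrite exprS].
Qed.

Lemma pmult_sin_shift (a th : R) : 0 <= th -> 4 * th <= e0 -> pmult (fun y => sin (th * (y - a))).
Proof.
move=> th0 the.
rewrite (_ : (fun y => _) = (fun y => sin (th * y) * cos (th * a) + - sin (th * a) * cos (th * y))).
  apply: pmultD; apply: pmultM; try exact: pmultC.
  - by move=> v hv; exact: papprox_all_sin.
  - by move=> v hv; exact: papprox_all_cos.
by apply/funext => y; rewrite mulrBr sinB; ring.
Qed.

(* [(1 - b ^ k) ^ (2 ^ k)] tends to [1] if [b < 1/2] and to [0] if [b > 1/2], at a rate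
   measured by Bernoulli's inequality.  The square term in [cutoff] pushes [y = a] to the
   side of [0], so that the limit is exactly the indicator of an open ray. *)
Definition cutoff (a : R) (n : nat) (y : R) : R :=
  2^-1 - 4^-1 * sin (n.+1%:R^-1 * (y - a)) + 4^-1 * (n.+1%:R^-1) ^+ 2.

(** The exponent [n.+1^3] outgrows the inverse of both gaps between [cutoff] and [1/2]: of order
    [1 / n] when [y > a], and at least of order [1 / n^2] when [y <= a]. *)
Definition approx_ray (a : R) (n : nat) (y : R) : R :=
  (1 - cutoff a n y ^+ (n.+1 ^ 3)) ^+ (2 ^ (n.+1 ^ 3)).

Lemma cutoff_itv a n y : 0 <= cutoff a n y <= 1.
Proof.
rewrite /cutoff; set s := sin _; set h := _ ^+ 2.
have : -1 <= s <= 1 by rewrite sin_geN1 sin_le1.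
have h0 : 0 <= h by exact: sqr_ge0.
have h1 : h <= 1.
  apply: exprn_ile1; first by rewrite invr_ge0.
  by rewrite invf_le1 ?ler1n ?ltr0n.
move=> /andP[? ?]; apply/andP; split; lra.
Qed.

Lemma approx_ray_itv a n y : 0 <= approx_ray a n y <= 1.
Proof.
have /andP[c0 c1] := cutoff_itv a n y.
have b0 : 0 <= cutoff a n y ^+ (n.+1 ^ 3) by exact: exprn_ge0.
have b1 : cutoff a n y ^+ (n.+1 ^ 3) <= 1 by exact: exprn_ile1.
rewrite /approx_ray; set b := _ ^+ (n.+1 ^ 3) in b0 b1 *.
by apply/andP; split; [apply: exprn_ge0; lra|apply: exprn_ile1; lra].
Qed.

Lemma bernoulli_ge (x : R) (n : nat) : -1 <= x -> 1 + n%:R * x <= (1 + x) ^+ n.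
Proof.
move=> x1; elim: n => [|n IH]; first by rewrite mul0r addr0 expr0.
have y0 : 0 <= 1 + x by lra.
rewrite exprS; apply: le_trans (ler_wpM2l y0 IH).
have : 0 <= n%:R * x ^+ 2 by rewrite mulr_ge0 ?sqr_ge0.
rewrite -natr1; set m := n%:R; lra.
Qed.

(** Multiply by [(1 + x)^n], which is at least [1 + n x], and use [(1 - x^2)^n <= 1]. *)
Lemma pow_1B_le (x : R) (n : nat) : 0 <= x <= 1 -> (1 - x) ^+ n <= (1 + n%:R * x)^-1.
Proof.
move=> /andP[x0 x1]; have q : 0 < 1 + n%:R * x by rewrite ltr_wpDr// mulr_ge0.
rewrite -[leRHS]mul1r ler_pdivlMr//.
have xn : 0 <= (1 - x) ^+ n by apply: exprn_ge0; lra.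
apply: (@le_trans _ _ ((1 - x) ^+ n * (1 + x) ^+ n)).
  by apply: ler_wpM2l => //; apply: bernoulli_ge; lra.
by rewrite -exprMn; apply: exprn_ile1; have := sqr_ge0 x; nra.
Qed.

Lemma pow_natM (n : nat) (x : R) : (2 ^ n)%:R * x ^+ n = (2 * x) ^+ n.
Proof. by rewrite exprMn natrX. Qed.

(** Put [k = n.+1^3] and [b = cutoff a n y]. Bernoulli's inequality bounds [approx_ray] below by
    [1 - (2 b)^k]; dually, [approx_ray_ub] has the upper bound [1 / (1 + (2 b)^k)] from [pow_1B_le].
    The distance [e] of [2 b] from [1] then decides. *)
Lemma approx_ray_lb a n y (e : R) : 0 < e <= 1 -> cutoff a n y <= 2^-1 * (1 - e) ->
  1 - (1 + n.+1%:R ^+ 3 * e)^-1 <= approx_ray a n y.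
Proof.
move=> /andP[e1 e2] ce; have /andP[c0 c1] := cutoff_itv a n y.
have b1 : cutoff a n y ^+ (n.+1 ^ 3) <= 1 by exact: exprn_ile1.
rewrite /approx_ray.
apply: le_trans (bernoulli_ge _ _); last by rewrite lerN2.
rewrite mulrN lerD2l lerN2 pow_natM -natrX.
apply: le_trans (pow_1B_le _ _); last by rewrite ltW.
by apply: lerXn2r; rewrite ?nnegrE; lra.
Qed.

Lemma approx_ray_ub a n y (e : R) : 0 < e -> 2^-1 * (1 + e) <= cutoff a n y ->
  approx_ray a n y <= (1 + n.+1%:R ^+ 3 * e)^-1.
Proof.
move=> e1 ce; have /andP[c0 c1] := cutoff_itv a n y.
have b1 : cutoff a n y ^+ (n.+1 ^ 3) <= 1 by exact: exprn_ile1.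
have b0 : 0 <= cutoff a n y ^+ (n.+1 ^ 3) by exact: exprn_ge0.
rewrite /approx_ray; apply: (le_trans (pow_1B_le _ _)); first by rewrite b0.
have q : 0 < 1 + n.+1%:R ^+ 3 * e by rewrite ltr_wpDr// mulr_ge0// ?exprn_ge0// ltW.
have h : 1 + n.+1%:R ^+ 3 * e <= 1 + (2 ^ n.+1 ^ 3)%:R * cutoff a n y ^+ (n.+1 ^ 3).
  rewrite pow_natM; apply: (@le_trans _ _ ((1 + e) ^+ (n.+1 ^ 3))).
    by rewrite -natrX; apply: bernoulli_ge; lra.
  by apply: ler_wpDl => //; apply: lerXn2r; rewrite ?nnegrE; lra.
by rewrite lef_pV2 ?posrE//; apply: lt_le_trans h.
Qed.

Lemma cvg_invn3 (k : nat -> R) (c : R) : 0 < c -> (\forall n \near \oo, c * n.+1%:R <= k n) ->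
  (fun n => (1 + k n)^-1) @ \oo --> (0 : R).
Proof.
move=> c0 ck.
apply: (@squeeze_cvgr _ _ _ _ (cst 0) (fun n => c^-1 * n.+1%:R^-1)).
- near=> n; have h : c * n.+1%:R <= k n by near: n.
  have cn : 0 < c * n.+1%:R by rewrite mulr_gt0.
  have q : 0 < 1 + k n by lra.
  rewrite /= invr_ge0 (ltW q)/= -invfM lef_pV2 ?posrE//; lra.
- exact: cvg_cst.
- rewrite -[X in _ --> X](mulr0 c^-1); apply: cvgMr; exact: cvg_harmonic.
Unshelve. all: end_near. Qed.

(** These are the difference quotients of [s |-> sin (s x)] at [0] along [s = 1 / n.+1]. *)
Lemma cvg_sin_scaled (x : R) :
  (fun n => n.+1%:R * sin (n.+1%:R^-1 * x)) @ \oo --> x.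
Proof.
have d : is_derive (0 : R) 1 (fun s => sin (s * x)) x.
  have h1 : is_derive (0 : R) 1 (fun s : R => s * x) x.
    have := is_deriveM (is_derive_id (0 : R) (1 : R)) (is_derive_cst x (0 : R) (1 : R)).
    by rewrite /GRing.scale/= mul0r add0r mulr1.
  have h2 := is_derive_sin (0 * x).
  by have := @is_derive1_comp _ _ (fun s : R => s * x) _ _ _ h2 h1; rewrite mul0r cos0 mul1r.
have [/cvg_ex[l hl] dv] := d.
have ld : l = x by rewrite -dv; apply/esym/cvg_lim.
rewrite ld in hl.
move/cvgr_dnbhsP : hl => /(_ (fun n => n.+1%:R^-1)); rewrite mul0r sin0.
move=> H.
rewrite (_ : (fun n => _) = (fun n => (n.+1%:R^-1)^-1 *:
    (((fun s : R => sin (s * x)) \o shift 0) (n.+1%:R^-1 *: 1) - 0))); last first.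
  by apply/funext => n; rewrite /= subr0 invrK addr0 /GRing.scale/= mulr1.
apply: H; split; last exact: cvg_harmonic.
by move=> n; rewrite invr_eq0 pnatr_eq0.
Qed.

Lemma cvg_approx_ray (a y : R) : approx_ray a ^~ y @ \oo --> (\1_(`]a, +oo[) y : R).
Proof.
rewrite indicE; case: (ltP a y) => ay.
  rewrite mem_set/=; last by rewrite in_itv/= ay.
  set x := y - a; have x0 : 0 < x by rewrite subr_gt0.
  (* With [N = n.+1], eventually [sin (x / N) > x / (2 N)] and [N^-2 < x / (4 N)], so [cutoff] lies
     below [1/2 - x / (16 N)]. The minimum with [1] keeps [e n <= 1]. *)
  pose e (n : nat) : R := Num.min 1 (x / 8) / n.+1%:R.
  have m0 : 0 < Num.min 1 (x / 8) by rewrite lt_min ltr01 divr_gt0.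
  have hlim : \forall n \near \oo, 1 - (1 + n.+1%:R ^+ 3 * e n)^-1 <= approx_ray a n y.
    have cs := @cvg_sin_scaled x.
    have : \forall n \near \oo, x / 2 < n.+1%:R * sin (n.+1%:R^-1 * x).
      by apply: (cvgr_gt x) => //; lra.
    move=> H; near=> n; apply: approx_ray_lb.
      have n1 : 1 <= n.+1%:R :> R by rewrite ler1n.
      rewrite /e divr_gt0//= ler_pdivrMr// mul1r.
      by apply: le_trans n1; rewrite ge_min lexx.
    rewrite /cutoff -/x /e.
    have h1 : x / 2 < n.+1%:R * sin (n.+1%:R^-1 * x) by near: n.
    have h2 : 4 / x < n.+1%:R.
      by apply: (@lt_le_trans _ _ n%:R); [near: n; exact: nbhs_infty_gtr|rewrite ler_nat].
    have h3 : Num.min 1 (x / 8) <= x / 8 by rewrite ge_min lexx orbT.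
    set s := sin _ in h1 *; set M := Num.min _ _ in m0 h3 *.
    set N : R := n.+1%:R in h1 h2 *; have N0 : 0 < N by rewrite ltr0Sn.
    have i0 : 0 < N^-1 by rewrite invr_gt0.
    have iN : N^-1 * N = 1 by rewrite mulVf ?gt_eqF.
    have s1 : N^-1 * (x / 2) < s.
      by rewrite (_ : s = N^-1 * (N * s)) ?ltr_pM2l// mulrA iN mul1r.
    have s2 : N^-1 ^+ 2 < N^-1 * (x / 4).
      rewrite expr2 ltr_pM2l// invf_plt ?posrE ?divr_gt0//.
      by rewrite invf_div.
    have s3 : M * N^-1 <= x / 8 * N^-1 by apply: ler_wpM2r => //; exact: ltW.
    move: s1 s2 s3; rewrite /=; move: (N^-1) => V; clearbody s M; clear => s1 s2 s3; lra.
  have hc : (fun n => 1 - (1 + n.+1%:R ^+ 3 * e n)^-1) @ \oo --> (1 : R).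
    rewrite -[X in _ --> X]subr0; apply: cvgB; first exact: cvg_cst.
    apply: (cvg_invn3 m0); apply: nearW => n; rewrite /e exprS.
    have N0 : 0 < n.+1%:R :> R by rewrite ltr0Sn.
    have N1 : 1 <= n.+1%:R :> R by rewrite ler1n.
    rewrite (_ : n.+1%:R * _ * _ = Num.min 1 (x / 8) * n.+1%:R ^+ 2); last by field; rewrite gt_eqF.
    by apply: ler_wpM2l; [exact: ltW|rewrite expr2 ler_peMr// ltW].
  apply: (@squeeze_cvgr _ _ _ _ (fun n => 1 - (1 + n.+1%:R ^+ 3 * e n)^-1) (cst 1)) => //.
    near=> n; rewrite /cst (andP (approx_ray_itv a n y)).2 andbT.
    by near: n.
  exact: cvg_cst.
rewrite memNset/=; last by rewrite in_itv/= andbT ltNge ay.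
set x := a - y; have x0 : 0 <= x by rewrite subr_ge0.
(* On this side the sine in [cutoff] is eventually nonpositive, and the square term alone provides
   the gap, also for [x = 0]. *)
pose e (n : nat) : R := 2^-1 * n.+1%:R^-1 ^+ 2.
have hlim : \forall n \near \oo, approx_ray a n y <= (1 + n.+1%:R ^+ 3 * e n)^-1.
  near=> n; apply: approx_ray_ub.
    by rewrite /e mulr_gt0// exprn_gt0// invr_gt0.
  rewrite /cutoff /e.
  have -> : y - a = - x by rewrite /x opprB.
  rewrite mulrN sinN.
  have s0 : 0 <= sin (n.+1%:R^-1 * x).
    apply: sin_ge0_pi; rewrite mulr_ge0 ?invr_ge0//=.
    rewrite mulrC ler_pdivrMr// (le_trans (_ : x <= 2 * n.+1%:R))//.
      have h : x < n.+1%:R.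
        by apply: (@lt_le_trans _ _ n%:R); [near: n; exact: nbhs_infty_gtr|rewrite ler_nat].
      by have := ltr0Sn R n; lra.
    by apply: ler_wpM2r => //; exact: pi_ge2.
  by have := sqr_ge0 (n.+1%:R^-1 : R); set h := _ ^+ 2; lra.
have hc : (fun n => (1 + n.+1%:R ^+ 3 * e n)^-1) @ \oo --> (0 : R).
  apply: (@cvg_invn3 _ 2^-1) => //; apply: nearW => n; rewrite /e.
  have N0 : 0 < n.+1%:R :> R by rewrite ltr0Sn.
  by rewrite le_eqVlt; apply/orP; left; apply/eqP; field; rewrite gt_eqF.
apply: (@squeeze_cvgr _ _ _ _ (cst 0) (fun n => (1 + n.+1%:R ^+ 3 * e n)^-1)) => //.
  near=> n; rewrite /cst (andP (approx_ray_itv a n y)).1/=.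
  by near: n.
exact: cvg_cst.
Unshelve. all: end_near. Qed.

Lemma integrable_weight (K : R) : leb.-integrable setT (fun y => (K * p y)%:E).
Proof.
apply: integrableZ; apply: (integrable_domR mp pexp) => y; rewrite ger0_norm//.
by apply: ler_peMl => //; rewrite -expR0 ler_expR mulr_ge0// ltW.
Qed.

Lemma papprox_ray (a : R) : papprox (\1_(`]a, +oo[) : R -> R).
Proof.
(* Starting at [Num.bound (4 / e0)] makes the frequency [th = 1 / k.+1] satisfy [4 * th <= e0] from
   the first term on. *)
apply: (@papprox_dct (fun n => approx_ray a (n + Num.bound (4 / e0))) _ (fun y => 1 * p y)).
- move=> n; set k := (n + _)%N.
  have ek : 4 * k.+1%:R^-1 <= e0.
    rewrite ler_pdivrMr// mulrC -ler_pdivrMr//; apply: ltW.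
    have h := archi_boundP (ltW (divr_gt0 (ltr0Sn R 3) e00)).
    by apply: (lt_le_trans h); rewrite ler_nat /k leqW// leq_addl.
  have k0 : 0 <= k.+1%:R^-1 :> R by [].
  have : pmult (approx_ray a k).
    apply: pmultX; apply: pmultD; first exact: pmultC.
    rewrite (_ : (fun y => _) = (fun y => -1 * cutoff a k y ^+ (k.+1 ^ 3))); last first.
      by apply/funext => y; rewrite mulN1r.
    apply: pmultM; first exact: pmultC.
    apply: pmultX; apply: pmultD; last exact: pmultC.
    apply: pmultD; first exact: pmultC.
    rewrite (_ : (fun y => _) = (fun y => - 4^-1 * sin (k.+1%:R^-1 * (y - a)))); last first.
      by apply/funext => y; rewrite mulNr.
    apply: pmultM; first exact: pmultC.
    exact: pmult_sin_shift.
  move=> /(_ _ papprox_all1)[_ /(_ 0%N)].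
  by rewrite (_ : (fun y => _) = approx_ray a k)//; apply/funext => y; rewrite mul1r expr0 mulr1.
- move=> y; have := @cvg_approx_ray a y.
  by rewrite -(cvg_shiftn (Num.bound (4 / e0))).
- exact: integrable_weight.
- move=> n y; apply: ler_wpM2r; first exact: p0.
  have /andP[h1 h2] := approx_ray_itv a (n + Num.bound (4 / e0)) y.
  rewrite -real_normK ?num_real//; apply: exprn_ile1 => //.
  rewrite indicE; case: (_ \in _) => /=; rewrite ler_norml; apply/andP; split; lra.
Qed.

Lemma papprox_setC (A : set R) : papprox (\1_A : R -> R) -> papprox (\1_(~` A) : R -> R).
Proof.
move=> HA; rewrite (_ : (\1_(~` A) : R -> R) = (fun y => (1%:P : {poly R}).[y] + -1 * \1_A y)).
  by apply: papproxD; [exact: papprox_poly|exact: papproxZ].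
apply/funext => y; rewrite hornerC !indicE in_setC; case: (_ \in _) => /=; ring.
Qed.

(** Open rays form a pi-system generating the Borel sets, and the sets whose indicator satisfies
    [papprox] form a Dynkin system; disjoint unions pass to the limit because the weight has finite
    mass. *)
Lemma papprox_indic (A : set R) : measurable A -> papprox (\1_A : R -> R).
Proof.
move=> mA.
have : <<s (@RGenOInfty.G R) >> A by have E := @RGenOInfty.measurableE R; rewrite -[X in X A]E; exact: mA.
apply: (@dynkin_induction _ (measurableTypeR R) (@RGenOInfty.G R) (fun A => papprox (\1_A : R -> R))).
- exact: RGenOInfty.measurableE.
- move=> _ _ [x ->] [y ->]; exists (Num.max x y); rewrite predeqE => z; split => /=; rewrite !in_itv/= !andbT.
    by move=> [h1 h2]; rewrite gt_max h1.
  by rewrite gt_max => /andP.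
- rewrite (_ : (\1_setT : R -> R) = (fun y => (1%:P : {poly R}).[y])); first exact: papprox_poly.
  by apply/funext => y; rewrite hornerC indicE in_setT.
- by move=> _ [x ->]; exact: papprox_ray.
- by move=> S _; exact: papprox_setC.
- move=> F mF tF HF.
  have E n (y : R) : \sum_(0 <= i < n) (\1_(F i) y : R) = \1_(\big[setU/set0]_(i < n) F i) y.
    elim: n => [|n IH]; first by rewrite big_geq// big_ord0 indic0.
    rewrite big_nat_recr//= IH big_ord_recr/= !indicE in_setU.
    case: (boolP (y \in F n)) => yn; last by rewrite addr0 orbF.
    rewrite memNset ?add0r ?orbT//.
    rewrite -bigcup_mkord => -[k /= kn yk].
    have := tF k n I I; move/set_mem in yn.
    by move=> /(_ (ex_intro _ y (conj yk yn))) kE; rewrite kE ltnn in kn.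
  apply: (@papprox_dct (fun n y => \sum_(0 <= i < n) (\1_(F i) y : R)) _ (fun y => 1 * p y)).
  + by move=> n; apply: papprox_sum => i; exact: HF.
  + move=> y; rewrite indicE; case: (boolP (y \in _)) => hy.
      have [k _ yk] := set_mem hy.
      apply: cvg_near_cst; near=> n; rewrite E indicE mem_set//.
      by rewrite -bigcup_mkord; exists k => //=; near: n; exact: nbhs_infty_gt.
    apply: cvg_near_cst; near=> n; rewrite E indicE memNset//.
    rewrite -bigcup_mkord => -[k _ yk]; move/negP: hy; apply; apply: mem_set; by exists k.
  + exact: integrable_weight.
  + move=> n y; apply: ler_wpM2r; first exact: p0.
    rewrite E -real_normK ?num_real//; apply: exprn_ile1 => //.
    by rewrite !indicE; case: (_ \in _); case: (_ \in _) => /=; rewrite ?subrr ?subr0 ?sub0r ?normrN ?normr0 ?normr1.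
Unshelve. all: end_near. Qed.

Lemma papprox_nneg (v : R -> R) : measurable_fun setT v -> (forall y, 0 <= v y) ->
  leb.-integrable setT (fun y => (v y ^+ 2 * p y)%:E) -> papprox v.
Proof.
move=> mv v0 iv.
have mvE : measurable_fun setT (fun y : R => (v y)%:E) by apply/measurable_EFinP.
pose v_ := nnsfun_approx measurableT mvE.
have v_v n y : 0 <= v_ n y <= v y.
  rewrite fun_ge0/=.
  have cy := cvg_nnsfun_approx measurableT mvE (fun x _ => v0 x : (0 <= (v x)%:E)%E) (I : setT y).
  have {cy}[_ cy] := (fine_cvgP _ _).1 cy.
  have cy' : (fun n => v_ n y) @ \oo --> v y by exact: cy.
  have e : limn (fun n => v_ n y) = v y by exact: cvg_lim cy'.
  rewrite -e; apply: (@nondecreasing_cvgn_le _ (fun n => v_ n y)); last by apply/cvg_ex; exists (v y).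
  by move=> m k mk; exact/lefP/nd_nnsfun_approx.
apply: (@papprox_dct (fun n => v_ n) _ (fun y => v y ^+ 2 * p y)) => //.
- move=> n; rewrite [X in papprox X](funext (fimfunEord (v_ n))).
  by apply: papprox_sum => i; apply: papproxZ; apply: papprox_indic; exact: measurable_funPTI.
- move=> y; have := cvg_nnsfun_approx measurableT mvE (fun x _ => v0 x : (0 <= (v x)%:E)%E) (I : setT y).
  move=> /fine_cvgP[_]; exact.
- move=> n y; apply: ler_wpM2r; first exact: p0.
  have /andP[h1 h2] := v_v n y; apply: lerXn2r; rewrite ?nnegrE; lra.
Qed.

Lemma papprox_L2 (v : R -> R) : measurable_fun setT v ->
  leb.-integrable setT (fun y => (v y ^+ 2 * p y)%:E) -> papprox v.
Proof.
move=> mv iv.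
have mx : measurable_fun setT (fun y => Num.max (v y) 0) by exact: measurable_maxr.
have mn : measurable_fun setT (fun y => Num.max (- v y) 0) by apply: measurable_maxr => //; exact: measurableT_comp.
rewrite (_ : v = (fun y => Num.max (v y) 0 + -1 * Num.max (- v y) 0)); last first.
  apply/funext => y; rewrite mulN1r; case: (leP (v y) 0) => h; case: (leP (- v y) 0) => h2; lra.
apply: papproxD; [|apply: papproxZ]; apply: papprox_nneg => //; try by move=> y; rewrite le_max lexx orbT.
  apply: (integrable_domR _ iv); first by apply: measurable_funM => //; exact: measurable_funX.
  move=> y; rewrite ger0_norm; last by rewrite mulr_ge0 ?sqr_ge0.
  by apply: ler_wpM2r => //; case: (leP (v y) 0) => h; rewrite ?expr0n/= ?sqr_ge0.
apply: (integrable_domR _ iv); first by apply: measurable_funM => //; exact: measurable_funX.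
move=> y; rewrite ger0_norm; last by rewrite mulr_ge0 ?sqr_ge0.
by apply: ler_wpM2r => //; case: (leP (- v y) 0) => h; rewrite ?expr0n/= ?sqr_ge0// sqrrN.
Qed.

End density.

(** * Estimation by polynomials *)

Section affine.
Context {R : realType}.
Local Notation leb := (@lebesgue_measure R).

Lemma ge0_integral_affine (h : R -> R) (k c : R) : 0 < k -> continuous h ->
  (forall y, 0 <= h y) ->
  (\int[leb]_y (h y)%:E = \int[leb]_x (k * h (k * x + c))%:E)%E.
Proof.
move=> k0 ch h0.
have dF (x : R) : is_derive x 1 (fun x => k * x + c) k.
  have := is_deriveD (is_deriveZ k (is_derive_id x (1 : R))) (is_derive_cst c x 1).
  by rewrite addr0 /GRing.scale/= mulr1.
have dE : derive1 (fun x => k * x + c) = cst k.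
  by apply/funext => x; rewrite derive1E; exact: derive_val.
rewrite (@increasing_ge0_integration_by_substitutionT _ (fun x => k * x + c))//.
- by apply: eq_integral => x _; rewrite dE/= mulrC.
- by move=> x y xy; rewrite ltrD2r ltr_pM2l.
- by rewrite dE => x; exact: cvg_cst.
- by rewrite dE; exact: is_cvg_cst.
- by rewrite dE; exact: is_cvg_cst.
- apply/cvgrNyPle => A; near=> x.
  have hx : x <= (A - c) / k by near: x; apply: nbhs_ninfty_le; exact: num_real.
  by rewrite -lerBrDr mulrC -ler_pdivlMr.
- apply/cvgryPge => A; near=> x.
  have hx : (A - c) / k <= x by near: x; apply: nbhs_pinfty_ge; exact: num_real.
  by rewrite -lerBlDr mulrC -ler_pdivrMr.
Unshelve. all: end_near. Qed.

Lemma ge0_integral_shift (h : R -> R) (c : R) : continuous h -> (forall y, 0 <= h y) ->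
  (\int[leb]_y (h y)%:E = \int[leb]_x (h (x + c))%:E)%E.
Proof.
move=> ch h0; rewrite (@ge0_integral_affine h 1 c)//.
by apply: eq_integral => x _; rewrite !mul1r.
Qed.

(** The positive and negative parts are transformed separately; each scaled part is integrable
    because an infinite integral would remain infinite after multiplication by [k]. *)
Lemma Rintegral_scale (h : R -> R) (k : R) : 0 < k -> continuous h ->
  leb.-integrable setT (fun y => (h y)%:E) ->
  leb.-integrable setT (fun x => (h (k * x))%:E) /\
  \int[leb]_y h y = k * \int[leb]_x h (k * x).
Proof.
move=> k0 ch ih.
have ck : continuous (fun x => h (k * x)).
  by move=> x; apply: (cvg_comp _ h); [apply: cvgM; [exact: cvg_cst|exact: cvg_id]|exact: ch].
have mk : measurable_fun setT (fun x => h (k * x)) by exact: continuous_measurable_fun.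
have cpos (u : R -> R) : continuous u -> continuous (fun x => Num.max (u x) 0).
  by move=> cu x; apply: continuous_max; [exact: cu|exact: cvg_cst].
have E (u : R -> R) : continuous u -> (forall y, 0 <= u y) -> leb.-integrable setT (fun y => (u y)%:E) ->
  leb.-integrable setT (fun x => (u (k * x))%:E) /\ \int[leb]_y u y = k * \int[leb]_x u (k * x).
  move=> cu u0 iu.
  have cuk : continuous (fun x => u (k * x)).
    by move=> x; apply: (cvg_comp _ u); [apply: cvgM; [exact: cvg_cst|exact: cvg_id]|exact: cu].
  have muk : measurable_fun setT (fun x : R => (u (k * x))%:E).
    by apply/measurable_EFinP; exact: continuous_measurable_fun.
  have := ge0_integral_affine 0 k0 cu u0.
  under [in X in _ = X -> _]eq_integral do rewrite addr0 EFinM.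
  rewrite ge0_integralZl//=; [|by move=> x _; rewrite lee_fin|by rewrite lee_fin ltW].
  rewrite (RintE iu) => H.
  have iuk : leb.-integrable setT (fun x => (u (k * x))%:E).
    apply/integrableP; split => //.
    under eq_integral do rewrite gee0_abs ?lee_fin//.
    rewrite ltey; apply/eqP => Hy; move: H; rewrite Hy gt0_muley ?lte_fin//.
  by split => //; apply: EFin_inj; rewrite H (RintE iuk) -EFinM.
have ip : leb.-integrable setT (fun y => (Num.max (h y) 0)%:E).
  apply: (integrable_domR _ (integrable_norm ih)).
    by apply: continuous_measurable_fun; exact: cpos.
  by move=> y; rewrite ger0_norm ?le_max ?lexx ?orbT//; rewrite /= ge_max normr_ge0 ler_norm.
have iN : leb.-integrable setT (fun y => (Num.max (- h y) 0)%:E).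
  apply: (integrable_domR _ (integrable_norm ih)).
    by apply: continuous_measurable_fun; apply: cpos => x; apply: cvgN; exact: ch.
  by move=> y; rewrite ger0_norm ?le_max ?lexx ?orbT//; rewrite /= ge_max normr_ge0 andbT -normrN ler_norm.
have M0 (u : R -> R) y : 0 <= Num.max (u y) 0 by rewrite le_max lexx orbT.
have [ip2 Ep] := E _ (cpos _ ch) (M0 h) ip.
have cN : continuous (fun x => - h x) by move=> x; apply: cvgN; exact: ch.
have [iN2 EN] := E _ (cpos _ cN) (M0 (fun x => - h x)) iN.
have D x : h x = Num.max (h x) 0 - Num.max (- h x) 0.
  by case: (leP (h x) 0) => h1; case: (leP (- h x) 0) => h2; lra.
have ik : leb.-integrable setT (fun x => (h (k * x))%:E).
  by under eq_fun do rewrite D; exact: integrableBE.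
split=> //.
under eq_Rintegral do rewrite D; rewrite RintegralB// Ep EN//.
under [in RHS]eq_Rintegral do rewrite D; rewrite RintegralB// mulrBr//.
Qed.

End affine.

Section polynomial_estimation.
Context {R : realType} d (T : measurableType d) (P : probability T R) (X : T -> R).
Hypothesis mX : measurable_fun setT X.
Hypothesis hm : forall k, P.-integrable setT (fun w => (`|X w| ^+ k)%:E).
Local Notation phi := (@normal_pdf R 0 1).
Local Notation leb := (@lebesgue_measure R).
Local Notation p := (gmom P X 0 0).
Local Notation a := (gmom P X 1 0).
Local Notation c := (gmom P X 2 0).

Lemma tonelliP (K : T -> R -> R) :
  measurable_fun setT (fun x : T * measurableTypeR R => K x.1 x.2) ->
  (forall w y, 0 <= K w y) ->
  (\int[P]_w \int[leb]_y (K w y)%:E = \int[leb]_y \int[P]_w (K w y)%:E)%E.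
Proof.
move=> mK K0.
apply: (@fubini_tonelli _ _ _ _ _ P leb (fun x : T * measurableTypeR R => (K x.1 x.2)%:E)).
  exact/measurable_EFinP.
by move=> x; rewrite lee_fin.
Qed.

Lemma measurable_shift2 (g : R) :
  measurable_fun setT (fun x : T * measurableTypeR R => (x.2 : R) - g * X x.1).
Proof.
apply: measurable_funB; first exact: measurable_snd.
by apply: measurable_funM => //; apply: measurableT_comp => //; exact: measurable_fst.
Qed.

Lemma measurable_phi2 (g : R) :
  measurable_fun setT (fun x : T * measurableTypeR R => phi (x.2 - g * X x.1)).
Proof. by apply: measurableT_comp; [exact: measurable_phi|exact: measurable_shift2]. Qed.

Lemma measurable_gmomR j (g : R) : measurable_fun setT (gmom P X j 0 g).
Proof. exact: measurable_gmom. Qed.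

(** Substitute [y = g X + z], exchange the integrals and complete the square for fixed [y]: the
    error splits into the conditional variance and the squared distance of [q] from the conditional
    mean [a / p]. Minimizing the error is thus an L2 approximation problem for the weight [p g]. *)
Lemma integral_err_poly (g : R) (q : {poly R}) :
  (\int[P]_w \int[leb]_z (phi z * (X w - q.[g * X w + z]) ^+ 2)%:E =
   (mmse P X g)%:E + wsq (p g) (fun y => a g y / p g y - q.[y])%R)%E.
Proof.
have -> : (\int[P]_w \int[leb]_z (phi z * (X w - q.[g * X w + z]) ^+ 2)%:E =
    \int[P]_w \int[leb]_y (phi (y - g * X w) * (X w - q.[y]) ^+ 2)%:E)%E.
  apply: eq_integral => w _; rewrite [RHS](@ge0_integral_shift _ _ (g * X w)).
  - by apply: eq_integral => z _; rewrite addrK (addrC z).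
  - move=> y; apply: cvgM.
      apply: (cvg_comp _ phi); last exact: continuous_phi.
      by apply: cvgB; [exact: cvg_id|exact: cvg_cst].
    apply: (cvg_comp _ (fun x => x ^+ 2)); last exact: exprn_continuous.
    by apply: cvgB; [exact: cvg_cst|exact: continuous_horner].
  - by move=> y; rewrite mulr_ge0 ?sqr_ge0// ltW// phi_gt0.
rewrite tonelliP.
- have E y : (\int[P]_w (phi (y - g * X w) * (X w - q.[y]) ^+ 2)%:E =
      (mmsek P X g y)%:E + ((a g y / p g y - q.[y]) ^+ 2 * p g y)%:E)%E.
    have ik j : P.-integrable setT (fun w => (gker X j 0 g y w)%:E) by exact: integrable_gker.
    have iE : P.-integrable setT (fun w => (gker X 2 0 g y w - (2 * q.[y]) * gker X 1 0 g y w + q.[y] ^+ 2 * gker X 0 0 g y w)%:E).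
      by apply: integrableDE; [apply: integrableBE => //|]; exact: integrableZ.
    rewrite (_ : (fun w => _) = (fun w => (gker X 2 0 g y w - (2 * q.[y]) * gker X 1 0 g y w + q.[y] ^+ 2 * gker X 0 0 g y w)%:E)); last first.
      by apply/funext => w; congr EFin; rewrite /gker; ring.
    rewrite RintE// RintegralD//; [|by apply: integrableBE => //; exact: integrableZ|exact: integrableZ].
    rewrite RintegralB//; [|exact: ik|exact: integrableZ].
    rewrite RintegralZl ?ik// RintegralZl ?ik// -EFinD; congr EFin.
    rewrite -/(gmom P X 2 0 g y) -/(gmom P X 1 0 g y) -/(gmom P X 0 0 g y) /mmsek.
    by field; rewrite gt_eqF// gmom00_gt0.
  under eq_integral do rewrite E.
  rewrite ge0_integralD//=.
  + by congr (_ + _)%E; rewrite RintE//; exact: integrable_mmsek.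
  + by move=> y _; rewrite lee_fin mmsek_ge0.
  + by apply/measurable_EFinP; apply: continuous_measurable_fun; exact: continuous_mmsek_y.
  + by move=> y _; rewrite lee_fin mulr_ge0 ?sqr_ge0// ltW// gmom00_gt0.
  + apply: measurable_wsq; first exact: measurable_gmomR.
    apply: measurable_funB; last exact: measurable_horner.
    apply: continuous_measurable_fun => y; apply: cvgM; first exact: continuous_gmom.
    by apply: cvgV; [rewrite gt_eqF// gmom00_gt0|exact: continuous_gmom].
- apply: measurable_funM; first exact: measurable_phi2.
  apply: measurable_funX; apply: measurable_funB.
    by apply: measurableT_comp => //; exact: measurable_fst.
  apply: measurableT_comp; first exact: measurable_horner.
  exact: measurable_snd.
- by move=> w y; rewrite mulr_ge0 ?sqr_ge0// ltW// phi_gt0.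
Qed.

(** Half of the exponent [z^2 / 2] absorbs [expR |z|], by [|z| <= 1 + z^2 / 4]; the other half
    absorbs [1 + z^2]. *)
Lemma integrable_phi_exp : leb.-integrable setT (fun z => (expR `|z| * phi z)%:E).
Proof.
apply: (@integrable_bnd _ _ (4 * expR 1)).
  apply: measurable_funM; last exact: measurable_phi.
  by apply: measurableT_comp => //; exact: normr_measurable.
move=> z; have z2 := sqr_ge0 z; have q : 0 < 1 + z ^+ 2 by lra.
rewrite ger0_norm; last by rewrite mulr_ge0 ?expR_ge0// ltW// phi_gt0.
rewrite ler_pdivlMr// phiE.
apply: (@le_trans _ _ (expR (1 + z ^+ 2 / 4) * (1 * expR (- z ^+ 2 / 2)) * (4 * expR (z ^+ 2 / 4)))).
  apply: ler_pM.
  - by rewrite !mulr_ge0 ?expR_ge0 ?normal_peak_ge0.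
  - exact: ltW.
  - apply: ler_pM; rewrite ?expR_ge0 ?mulr_ge0 ?expR_ge0 ?normal_peak_ge0//.
      rewrite ler_expR -(real_normK (num_real z)).
      by have := sqr_ge0 (`|z| / 2 - 1); nra.
    by apply: ler_wpM2r; [exact: expR_ge0|exact: normal_peak1_le1].
  - by have := expR_ge1Dx (z ^+ 2 / 4); lra.
rewrite mul1r mulrCA -!expRD ler_pM2l// ler_expR; lra.
Qed.

Hypothesis mgf : has_mgf P X.

(** [expR (e |x|)] is at most [expR (e x) + expR (- e x)]; halving [e] stays inside the open range
    of admissible exponents. *)
Lemma mgf_abs : exists2 e : R, 0 < e & P.-integrable setT (fun w => (expR (e * `|X w|))%:E).
Proof.
have [e [e0 He]] := mgf; exists (e / 2); first by rewrite divr_gt0.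
have e2 : 0 <= e / 2 by rewrite ltW// divr_gt0.
have h1 : P.-integrable setT (fun w => (expR (e / 2 * X w))%:E).
  by apply: He; rewrite ger0_norm//; lra.
have h2 : P.-integrable setT (fun w => (expR (- (e / 2) * X w))%:E).
  by apply: He; rewrite normrN ger0_norm//; lra.
apply: (integrable_dom _ (integrableDE h1 h2)).
  apply: measurableT_comp => //; apply: measurable_funM => //.
  by apply: measurableT_comp => //; exact: normr_measurable.
move=> w; rewrite ger0_norm ?expR_ge0// mulNr.
have [x0|x0] := leP 0 (X w).
  by rewrite ger0_norm// lerDl expR_ge0.
by rewrite ltr0_norm// mulrN lerDr expR_ge0.
Qed.

(** With [y = g X + z], [e0 |y|] is at most [|z| + e |X|]: of the two caps in [e0], one lets the
    Gaussian absorb [expR |z|], the other lets the moment-generating function absorb the rest. The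
    result is the tail condition under which polynomials are dense. *)
Lemma integrable_expR_gmom (g : R) : exists2 e0 : R, 0 < e0 &
  leb.-integrable setT (fun y => (expR (e0 * `|y|) * p g y)%:E).
Proof.
have [e e00 He] := mgf_abs.
pose e0 := Num.min 1 (e / (`|g| + 1)).
have g1 : 0 < `|g| + 1 by rewrite ltr_wpDl.
have e0p : 0 < e0 by rewrite lt_min ltr01 divr_gt0.
have e01 : e0 <= 1 by rewrite ge_min lexx.
have e0g : e0 * `|g| <= e.
  apply: (@le_trans _ _ (e / (`|g| + 1) * `|g|)).
    by apply: ler_wpM2r => //; rewrite ge_min lexx orbT.
  by rewrite mulrAC ler_pdivrMr//; apply: ler_wpM2l; [exact: ltW|lra].
exists e0 => //.
have mF : measurable_fun setT (fun y : R => expR (e0 * `|y|) * p g y).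
  apply: measurable_funM; last exact: measurable_gmomR.
  apply: measurableT_comp => //; apply: measurable_funM => //; exact: normr_measurable.
apply/integrableP; split; first exact/measurable_EFinP.
have p0 y := ltW (gmom00_gt0 mX hm g y).
under eq_integral => y _ do rewrite gee0_abs ?lee_fin ?mulr_ge0 ?expR_ge0//.
have E y : ((expR (e0 * `|y|) * p g y)%:E = \int[P]_w (expR (e0 * `|y|) * phi (y - g * X w))%:E)%E.
  rewrite EFinM {1}/gmom -RintE ?integrable_gker// -ge0_integralZl//=.
  - by apply: eq_integral => w _; rewrite /gker !expr0 !mul1r -EFinM.
  - by apply/measurable_EFinP; exact: measurable_gker.
  - by move=> w _; rewrite lee_fin /gker !expr0 !mul1r ltW// phi_gt0.
under eq_integral do rewrite E.
rewrite -tonelliP; last 2 first.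
- apply: measurable_funM; last exact: measurable_phi2.
  apply: measurableT_comp => //; apply: measurable_funM => //.
  by apply: (measurableT_comp (@normr_measurable R setT)); exact: measurable_snd.
- by move=> w y; rewrite mulr_ge0 ?expR_ge0// ltW// phi_gt0.
have c1 : continuous (fun z : R => `|z|) by exact: norm_continuous.
have c2 : continuous (expR \o (fun z : R => `|z|)).
  by move=> z; apply: continuous_comp; [exact: c1|exact: continuous_expR].
have c3 : continuous (expR \o (fun z : R => e0 * `|z|)).
  move=> z; apply: continuous_comp; last exact: continuous_expR.
  by apply: cvgM; [exact: cvg_cst|exact: c1].
have cexp : continuous (fun z : R => expR `|z| * phi z).
  by move=> y; exact: (cvgM (c2 y) (@continuous_phi R y)).
have CE := RintE integrable_phi_exp.
set C := \int[leb]_z (expR `|z| * phi z) in CE.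
have C0 : 0 <= C by apply: Rintegral_ge0 => z _; rewrite mulr_ge0 ?expR_ge0// ltW// phi_gt0.
apply: (@le_lt_trans _ _ (\int[P]_w (C * expR (e * `|X w|))%:E)%E); last first.
  by rewrite (RintE (integrableZ C He)) ltry.
apply: ge0_le_integral => //.
- by move=> w _; apply: integral_ge0 => y _; rewrite lee_fin mulr_ge0 ?expR_ge0// ltW// phi_gt0.
- apply: (@measurable_fun_fubini_tonelli_F _ _ _ _ _ leb (fun x : T * measurableTypeR R => (expR (e0 * `|x.2 : R|) * phi (x.2 - g * X x.1))%:E)).
    apply/measurable_EFinP; apply: measurable_funM; last exact: measurable_phi2.
    apply: measurableT_comp => //; apply: measurable_funM => //.
    by apply: (measurableT_comp (@normr_measurable R setT)); exact: measurable_snd.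
  by move=> x; rewrite lee_fin mulr_ge0 ?expR_ge0// ltW// phi_gt0.
- by apply/measurable_EFinP; apply: measurable_funM => //; have /integrableP[/measurable_EFinP] := He.
- move=> w _; rewrite (@ge0_integral_shift _ _ (g * X w)).
  + apply: (@le_trans _ _ (\int[leb]_z ((expR (e * `|X w|))%:E * (expR `|z| * phi z)%:E))%E).
      apply: ge0_le_integral => //.
      * by move=> z _; rewrite lee_fin mulr_ge0 ?expR_ge0// ltW// phi_gt0.
      * apply/measurable_EFinP; apply: measurable_funM.
          apply: measurableT_comp => //; apply: measurable_funM => //.
          by apply: (measurableT_comp (@normr_measurable R setT)); exact: measurable_funD.
        by apply: measurableT_comp; [exact: measurable_phi|apply: measurable_funB => //; exact: measurable_funD].
      * by apply: measurable_funeM; apply/measurable_EFinP; exact: continuous_measurable_fun.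
      * move=> z _; rewrite -EFinM lee_fin addrK mulrA -expRD; apply: ler_wpM2r; first by rewrite ltW// phi_gt0.
        rewrite ler_expR; apply: (@le_trans _ _ (e0 * (`|z| + `|g| * `|X w|))).
          by apply: ler_wpM2l; [exact: ltW|rewrite -normrM; exact: ler_normD].
        have := ler_wpM2r (normr_ge0 z) e01; have := ler_wpM2r (normr_ge0 (X w)) e0g; lra.
    rewrite ge0_integralZl//=.
    * by rewrite CE -EFinM mulrC.
    * by apply/measurable_EFinP; exact: continuous_measurable_fun.
    * by move=> z _; rewrite lee_fin mulr_ge0 ?expR_ge0// ltW// phi_gt0.
  + move=> y; apply: (cvgM (c3 y)).
    apply: (cvg_comp _ phi); last exact: continuous_phi.
    by apply: cvgB; [exact: cvg_id|exact: cvg_cst].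
  + by move=> y; rewrite mulr_ge0 ?expR_ge0// ltW// phi_gt0.
Qed.

(** The conditional mean is square integrable for the weight [p], since
    [(a / p)^2 * p = c - mmsek <= c]; the density of polynomials is applied to it. *)
Lemma err_poly_inf (g e : R) : 0 < e -> exists q : {poly R},
  (\int[P]_w \int[leb]_z (phi z * (X w - q.[g * X w + z]) ^+ 2)%:E < (mmse P X g + e)%:E)%E.
Proof.
move=> e0; have [e1 e10 H] := integrable_expR_gmom g.
have mk : measurable_fun setT (fun y => a g y / p g y).
  apply: continuous_measurable_fun => y; apply: cvgM; first exact: continuous_gmom.
  by apply: cvgV; [rewrite gt_eqF// gmom00_gt0|exact: continuous_gmom].
have i2 : leb.-integrable setT (fun y => ((a g y / p g y) ^+ 2 * p g y)%:E).
  apply: (@integrable_bnd _ _ (gbnd P X 2 `|g|)).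
    by apply: measurable_funM; [exact: measurable_funX|exact: measurable_gmomR].
  move=> y; have p0 := gmom00_gt0 mX hm g y; have y2 := sqr_ge0 y.
  have -> : (a g y / p g y) ^+ 2 * p g y = c g y - mmsek P X g y.
    by rewrite /mmsek; field; rewrite gt_eqF.
  have m0 := mmsek_ge0 mX hm g y.
  have h0 : 0 <= c g y - mmsek P X g y.
    have -> : c g y - mmsek P X g y = a g y ^+ 2 / p g y by rewrite /mmsek; ring.
    by rewrite divr_ge0 ?sqr_ge0// ltW.
  rewrite ger0_norm//; apply: (@le_trans _ _ (c g y)); first by lra.
  apply: (le_trans (ler_norm _)); apply: (le_trans (gmom_le mX hm 2 y (isT : (0 <= 1)%N) (lexx `|g|))).
  apply: ler_wpM2l; first exact: gbnd_ge0.
  by rewrite lef_pV2 ?posrE ?exprn_gt0//; nra.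
have [_ /(_ _ e0)[q hq]] := papprox_L2 (measurable_gmomR 0 g) (fun y => ltW (gmom00_gt0 mX hm g y)) e10 H mk i2.
by exists q; rewrite integral_err_poly EFinD lteD2lE.
Qed.

End polynomial_estimation.

(** * Entropy of a density under small Gaussian noise *)

Section sum_with_nonneg.
Context d (T : measurableType d) (R : realType) (mu : {measure set T -> \bar R}).

(** Meant for relative entropies, which may be infinite. In that case the negative part of [r + h]
    is still bounded by [|h|], while the positive part inherits the infinity of [r]. *)
Lemma integralD_ge0_integrable (r h : T -> R) :
  measurable_fun setT r -> (forall x, 0 <= r x) -> mu.-integrable setT (fun x => (h x)%:E) ->
  (\int[mu]_x (r x + h x)%:E = \int[mu]_x (r x)%:E + (\int[mu]_x h x)%:E)%E.
Proof.
move=> mr r0 ih.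
have mh : measurable_fun setT h by apply/measurable_EFinP; exact: measurable_int ih.
have mrE := measurable_funT_EFin mr.
have [ir|] := pselect (mu.-integrable setT (fun x => (r x)%:E)).
  rewrite -(RintE ih) -integralD//.
move=> nir.
have ry : (\int[mu]_x (r x)%:E = +oo)%E.
  apply/eqP; rewrite -leye_eq leNgt; apply/negP => h1; apply: nir; apply/integrableP; split => //.
  by under eq_integral do rewrite gee0_abs ?lee_fin//.
rewrite ry addye//.
have ins : (\int[mu]_x `|(h x)%:E| < +oo)%E by have /integrableP[] := ih.
rewrite integralE.
have neg : (\int[mu]_x (fun x => (r x + h x)%:E)^\- x < +oo)%E.
  apply: le_lt_trans ins; apply: ge0_le_integral => //.
  - by apply: measurable_funeneg; apply/measurable_EFinP; exact: measurable_funD.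
  - by apply: measurableT_comp => //; apply/measurable_EFinP.
  - move=> x _; rewrite funenegE -EFinN -EFin_max lee_fin ge_max normr_ge0 andbT.
    by have := r0 x; have := ler_norm (- h x); rewrite normrN; lra.
have pos : (\int[mu]_x (fun x => (r x + h x)%:E)^\+ x = +oo)%E.
  apply/eqP; rewrite -leye_eq leNgt; apply/negP => h1.
  suff : (\int[mu]_x (r x)%:E < +oo)%E by rewrite ry.
  apply: (@le_lt_trans _ _ (\int[mu]_x ((fun x => (r x + h x)%:E)^\+ x + `|(h x)%:E|))%E).
    apply: ge0_le_integral => //.
    - by move=> x _; rewrite lee_fin.
    - apply: emeasurable_funD; last by apply: measurableT_comp => //; apply/measurable_EFinP.
      by apply: measurable_funepos; apply/measurable_EFinP; exact: measurable_funD.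
    - move=> x _; rewrite funeposE -EFin_max -EFinD lee_fin.
      have := ler_norm (- h x); rewrite normrN => h2.
      by have : r x + h x <= Num.max (r x + h x) 0; [rewrite le_max lexx|lra].
  rewrite ge0_integralD//.
  - exact: lte_add_pinfty.
  - by apply: measurable_funepos; apply/measurable_EFinP; exact: measurable_funD.
  - by apply: measurableT_comp => //; apply/measurable_EFinP.
rewrite pos addye// eqe_oppLR/=; by rewrite lt_eqF.
Qed.

End sum_with_nonneg.

(** * Integration against the law of [X] *)

Section density_law.
Context {R : realType} d (T : measurableType d) (P : probability T R) (X : T -> R) (f : R -> R).
Hypothesis mX : measurable_fun setT X.
Hypothesis dens : is_density P X f.
Local Notation leb := (@lebesgue_measure R).

Let mf : measurable_fun setT f. Proof. by case: dens. Qed.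
Let f0 x : 0 <= f x. Proof. by case: dens => _ []. Qed.
Let Pf (A : set R) : measurable A -> P (X @^-1` A) = (\int[leb]_(x in A) (f x)%:E)%E.
Proof. by case: dens => _ [_]; apply. Qed.

Lemma integrable_density : leb.-integrable setT (fun x => (f x)%:E).
Proof.
apply/integrableP; split; first exact/measurable_EFinP.
under eq_integral do rewrite gee0_abs ?lee_fin//.
by rewrite -Pf// preimage_setT probability_setT ltry.
Qed.

(** Simple functions reduce to the defining property of the density; monotone convergence on both
    sides does the rest. *)
Lemma ge0_expect_density (h : R -> R) : measurable_fun setT h -> (forall x, 0 <= h x) ->
  (\int[P]_w (h (X w))%:E = \int[leb]_x (h x * f x)%:E)%E.
Proof.
move=> mh h0; have mhE := measurable_funT_EFin mh.
pose h_ := nnsfun_approx measurableT mhE.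
have cv (x : R) : (fun n => (h_ n x)%:E) @ \oo --> (h x)%:E.
  exact: (cvg_nnsfun_approx measurableT mhE (fun x _ => h0 x : (0 <= (h x)%:E)%E) (I : setT x)).
have nd (x : R) m n : (m <= n)%N -> h_ m x <= h_ n x by move=> mn; exact/lefP/nd_nnsfun_approx.
have E n : (\int[P]_w (h_ n (X w))%:E = \int[leb]_x (h_ n x * f x)%:E)%E.
  set F := h_ n.
  have [N [c [A [mA FE]]]] : exists N (c : nat -> R) (A : nat -> set R),
      (forall i, measurable (A i)) /\ forall x, F x = \sum_(i < N) c i * \1_(A i) x.
    exists (size (finmap.enum_fset (fset_set (range F)))), (fun i => (finmap.enum_fset (fset_set (range F)))`_i),
      (fun i => F @^-1` [set (finmap.enum_fset (fset_set (range F)))`_i]).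
    by split => [i|x]; [exact: measurable_funPTI|exact: fimfunEord].
  have mXA i : measurable (X @^-1` A i) by rewrite -[X in measurable X]setTI; exact: mX.
  under eq_integral do rewrite FE -sumEFin.
  under [RHS]eq_integral do rewrite FE big_distrl/= -sumEFin.
  have iP i : P.-integrable setT (fun w => (\1_(A i) (X w))%:E).
    rewrite (_ : (fun w => _) = (fun w => (\1_(X @^-1` A i) w)%:E))//.
    apply: integrable_indic => //.
  have iL i : leb.-integrable setT (fun x => (\1_(A i) x * f x)%:E).
    apply: (@integrable_domR _ _ f) integrable_density _; first exact: measurable_funM.
    move=> x; rewrite indicE; case: (_ \in _); rewrite ?mul1r ?mul0r ?normr0//.
    by rewrite ger0_norm.
  rewrite integral_sum//; last by move=> i; exact: integrableZ.
  rewrite (@integral_sum _ (measurableTypeR R) R leb)//; last first.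
    move=> i; under eq_fun do rewrite -mulrA.
    exact: (@integrableZ _ (measurableTypeR R) R leb).
  apply: eq_bigr => i _.
  under eq_integral do rewrite EFinM.
  under [RHS]eq_integral do rewrite -mulrA EFinM.
  rewrite integralZl// (@integralZl _ (measurableTypeR R) R leb)//; congr (_ * _)%E.
  rewrite (_ : (fun w => _) = (fun w => (\1_(X @^-1` A i) w)%:E))//.
  transitivity (P (X @^-1` A i)); first by rewrite (integral_indic P measurableT (mXA i)) setIT.
  rewrite Pf// [LHS]integral_mkcond; apply: eq_integral => x _.
  by rewrite patchE indicE; case: ifP => _; rewrite ?mul1r ?mul0r.
have mh_ n : measurable_fun setT (fun x : R => (h_ n x)%:E) by exact: measurable_funT_EFin.
have cP : (\int[P]_w (h_ n (X w))%:E)%E @[n --> \oo] --> (\int[P]_w (h (X w))%:E)%E.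
  rewrite (_ : (\int[P]_w _)%E = (\int[P]_w (limn (fun n => (h_ n (X w))%:E)))%E).
    apply: cvg_monotone_convergence => //.
    - by move=> n; apply: (measurableT_comp (mh_ n)).
    - by move=> n w _; rewrite lee_fin.
    - by move=> w _ m n mn; rewrite lee_fin; exact: nd.
  by apply: eq_integral => w _; rewrite (cvg_lim _ (cv (X w))).
have mhf n : measurable_fun setT (fun x : R => (h_ n x * f x)%:E).
  by apply: measurable_funT_EFin; exact: measurable_funM.
have cL : (\int[leb]_x (h_ n x * f x)%:E)%E @[n --> \oo] --> (\int[leb]_x (h x * f x)%:E)%E.
  rewrite (_ : (\int[leb]_x (h x * f x)%:E)%E = (\int[leb]_x (limn (fun n => (h_ n x * f x)%:E)))%E).
    apply: cvg_monotone_convergence => //.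
    - by move=> n x _; rewrite lee_fin mulr_ge0.
    - by move=> x _ m n mn; rewrite lee_fin ler_wpM2r// nd.
  apply: eq_integral => x _; apply/esym/cvg_lim => //.
  by apply: cvg_EFin; [exact: nearW|apply: cvgM; [exact: (fine_cvg (cv x))|exact: cvg_cst]].
suff cL' : (\int[P]_w (h_ n (X w))%:E)%E @[n --> \oo] --> (\int[leb]_x (h x * f x)%:E)%E.
  exact: (cvg_unique _ cP cL').
by under eq_fun do rewrite E; exact: cL.
Qed.

End density_law.

(** * Gaussian smoothing kernels *)

Section smoothing_kernel.
Context {R : realType}.
Local Notation phi := (@normal_pdf R 0 1).
Local Notation leb := (@lebesgue_measure R).

Lemma tonelliR (K : R -> R -> R) :
  measurable_fun setT (fun x : measurableTypeR R * measurableTypeR R => K x.1 x.2) ->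
  (forall u y, 0 <= K u y) ->
  (\int[leb]_u \int[leb]_y (K u y)%:E = \int[leb]_y \int[leb]_u (K u y)%:E)%E.
Proof.
move=> mK K0.
apply: (@fubini_tonelli _ _ _ _ _ leb leb (fun x : measurableTypeR R * measurableTypeR R => (K x.1 x.2)%:E)).
  exact/measurable_EFinP.
by move=> x; rewrite lee_fin.
Qed.

(** The density at [x] of [u + N / k], a Gaussian of standard deviation [1 / k]; by [gkernC] either
    argument can act as the mean. *)
Definition gkern (k x u : R) : R := k * phi (k * x - k * u).

Lemma phiN (w : R) : phi (- w) = phi w.
Proof. by rewrite !phiE sqrrN. Qed.

Lemma gkernC k x u : gkern k x u = gkern k u x.
Proof. by rewrite /gkern -(phiN (k * x - k * u)) opprB. Qed.

Lemma gkern_gt0 k x u : 0 < k -> 0 < gkern k x u.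
Proof. by move=> k0; rewrite mulr_gt0// phi_gt0. Qed.

Lemma measurable_gkern2 k :
  measurable_fun setT (fun x : measurableTypeR R * measurableTypeR R => gkern k x.1 x.2).
Proof.
apply: measurable_funM; first exact: measurable_cst.
apply: measurableT_comp; first exact: measurable_phi.
by apply: measurable_funB; (apply: measurable_funM; first exact: measurable_cst);
  [exact: measurable_fst|exact: measurable_snd].
Qed.

Lemma measurable_gkern k x : measurable_fun setT (gkern k x).
Proof.
apply: measurable_funM; first exact: measurable_cst.
apply: measurableT_comp; first exact: measurable_phi.
by apply: measurable_funB => //; apply: measurable_funM.
Qed.

Lemma gkern_le k x u : 0 <= k -> `|gkern k x u| <= k.
Proof.
move=> k0; rewrite ger0_norm; last by rewrite mulr_ge0// ltW// phi_gt0.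
by rewrite ler_piMr// phi_le1.
Qed.

Lemma ge0_integral_gkern (h : R -> R) (k u : R) : 0 < k -> continuous h -> (forall y, 0 <= h y) ->
  (\int[leb]_x (gkern k x u * h x)%:E = \int[leb]_y (phi y * h (y / k + u))%:E)%E.
Proof.
move=> k0 ch h0; rewrite [RHS](@ge0_integral_affine _ _ k (- (k * u)))//.
- apply: eq_integral => x _; rewrite /gkern mulrA; congr (_ * h _)%:E.
  by field; rewrite gt_eqF.
- move=> y; apply: cvgM; first exact: continuous_phi.
  apply: (cvg_comp _ h); last exact: ch.
  by apply: cvgD; [apply: cvgM; [exact: cvg_id|exact: cvg_cst]|exact: cvg_cst].
- by move=> y; rewrite mulr_ge0// ltW// phi_gt0.
Qed.

Lemma integral_gkern (k u : R) : 0 < k -> (\int[leb]_x (gkern k x u)%:E = 1)%E.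
Proof.
move=> k0; under eq_integral do rewrite -[gkern _ _ _]mulr1.
rewrite (@ge0_integral_gkern (fun=> 1))//; last by move=> ?; exact: cvg_cst.
by under eq_integral do rewrite mulr1; exact: integral_normal_pdf.
Qed.

Lemma integrable_phiXs (n : nat) : leb.-integrable setT (fun z => (z ^+ n * phi z)%:E).
Proof.
apply: (@integrable_domR _ _ (fun z => `|z| ^+ n * phi z)); last first.
- by move=> z; rewrite normrM normrX (ger0_norm (ltW (phi_gt0 _))).
- exact: integrable_phiX.
- by apply: measurable_funM; [exact: measurable_funX|exact: measurable_phi].
Qed.

Lemma integral_phi_id : \int[leb]_y (y * phi y) = 0.
Proof.
have := @Rintegral_derivative0 R phi (fun y => - y * phi y) 2%:R.
have c : continuous (fun y : R => - y * phi y).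
  by move=> y; apply: cvgM; [apply: cvgN; exact: cvg_id|exact: continuous_phi].
have i : leb.-integrable setT (fun y : R => (- y * phi y)%:E).
  under eq_fun do rewrite mulNr -mulN1r.
  apply: (@integrableZ _ (measurableTypeR R) R leb).
  by under eq_fun do rewrite -[X in X * _]expr1; exact: integrable_phiXs.
move=> /(_ is_derive_phi c i) H.
have /H : forall y, `|phi y| <= 2 / (1 + y ^+ 2).
  move=> y; rewrite (ger0_norm (ltW (phi_gt0 _))) ler_pdivlMr ?ltr_wpDr ?sqr_ge0//.
  by have := phi_bound 1 y; rewrite !expr1 mulr1 mulrC.
under eq_Rintegral do rewrite mulNr -mulN1r.
rewrite RintegralZl//; last first.
  by under eq_fun do rewrite -[X in X * _]expr1; exact: integrable_phiXs.
by move/eqP; rewrite mulN1r oppr_eq0 => /eqP.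
Qed.

Lemma integral_gkern_sqr (k u : R) : 0 < k ->
  (\int[leb]_x (gkern k x u * x ^+ 2)%:E = ((k ^+ 2)^-1 + u ^+ 2)%:E)%E.
Proof.
move=> k0; rewrite (@ge0_integral_gkern (fun x => x ^+ 2)) ?sqr_ge0//; last first.
- by move=> y; exact: sqr_ge0.
- by move=> y; exact: exprn_continuous.
have i0 := integrable_phiXs 0; have i1 := integrable_phiXs 1; have i2 := integrable_phiXs 2.
transitivity (\int[leb]_y ((k ^+ 2)^-1 * (y ^+ 2 * phi y) + ((2 * u / k) * (y ^+ 1 * phi y)
   + u ^+ 2 * (y ^+ 0 * phi y)))%:E)%E.
  apply: eq_integral => y _; congr _%:E; move: (phi y) => p.
  by field; rewrite gt_eqF.
have j0 := @integrableZ _ (measurableTypeR R) R leb (u ^+ 2) _ i0.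
have j1 := @integrableZ _ (measurableTypeR R) R leb (2 * u / k) _ i1.
have j2 := @integrableZ _ (measurableTypeR R) R leb (k ^+ 2)^-1 _ i2.
have j01 := @integrableDE _ (measurableTypeR R) R leb _ _ j1 j0.
rewrite RintE; last exact: (@integrableDE _ (measurableTypeR R) R leb).
rewrite RintegralD// RintegralD// !RintegralZl//.
- rewrite integral_phi_sqr (_ : \int[leb]_x (x ^+ 1 * phi x) = 0); last exact: integral_phi_id.
  by rewrite mul1r /Rintegral integral_normal_pdf// mulr0 add0r !mulr1.
- by move: i0; under eq_fun do rewrite mul1r.
Qed.

Lemma measurable_restrictR (D : set R) (g : R -> R) : measurable D -> measurable_fun setT g ->
  measurable_fun setT ((fun v => (g v)%:E) \_ D).
Proof.
move=> mD mg.
apply: (iffLR (@measurable_restrictT _ _ (measurableTypeR R) _ _ _ mD)).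
by apply: measurable_funTS; exact: measurable_funT_EFin.
Qed.

(* Layer cake: [phi w] is the integral of [v * phi v] over [v >= |w|]. *)
Lemma phi_layer (a : R) : 0 <= a ->
  (\int[leb]_(v in `[a, +oo[) (v * phi v)%:E = (phi a)%:E)%E.
Proof.
move=> a0; rewrite (@ge0_continuous_FTC2y R (fun v => v * phi v) (fun v => - phi v) a 0).
- by rewrite sub0e -EFinN opprK.
- by move=> x ax; rewrite mulr_ge0//; [exact: le_trans ax|exact: ltW (phi_gt0 _)].
- apply: continuous_subspaceT => y; apply: cvgM; [exact: cvg_id|exact: continuous_phi].
- rewrite -[X in _ --> X]oppr0; apply: cvgN.
  have b (y : R) : 1 <= y -> 0 <= phi y <= 2 * y^-1.
    move=> y1; rewrite (ltW (phi_gt0 _))/= -[_ * _]/(2 / y) ler_pdivlMr ?(lt_le_trans ltr01)//.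
    have := phi_bound 1 y; rewrite !expr1 mulr1; apply: le_trans.
    by rewrite mulrC ler_wpM2r ?(ltW (phi_gt0 _))//; nra.
  apply: (@squeeze_cvgr _ _ _ _ (fun=> 0) (fun y => 2 * y^-1)).
  + by near=> y; apply: b; near: y; exact: nbhs_pinfty_ge.
  + exact: cvg_cst.
  + rewrite -(mulr0 2); apply: cvgM; first exact: cvg_cst.
    by apply/gtr0_cvgV0; [near=> y; near: y; exact: nbhs_pinfty_gt|].
- move=> x _; have d := is_derive_phi x.
  exact: derivableN.
- by apply: cvg_at_right_filter; apply: cvgN; exact: continuous_phi.
- move=> x _; have d := is_derive_phi x.
  by rewrite derive1E deriveN// derive_val mulNr opprK.
Unshelve. all: by end_near. Qed.

(** By the layer cake formula the kernel is a mixture of indicators of [|x - u| <= v / k], so bounds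
    on averages over balls bound the convolution. The factors 4 and 16 come from [2 r (e + C r^2)]
    at [r = 2 v / k]; the first meets the second moment of [phi], which is 1. *)
Lemma integral_gkern_ball (psi : R -> R) (k x e C : R) : 0 < k -> 0 <= e -> 0 <= C ->
  measurable_fun setT psi -> (forall u, 0 <= psi u) ->
  (forall r : R, 0 < r -> (\int[leb]_(u in ball x r) (psi u)%:E <= (2 * r * (e + C * r ^+ 2))%:E)%E) ->
  (\int[leb]_u (gkern k x u * psi u)%:E <=
    (4 * e + 16 * C * \int[leb]_v (v ^+ 4 * phi v) / k ^+ 2)%:E)%E.
Proof.
move=> k0 e0 C0 mpsi psi0 H.
pose K (u v : R) : R := if `|k * x - k * u| <= v then k * (v * phi v) * psi u else 0.
have K0 u v : 0 <= K u v.
  rewrite /K; case: ifPn => // h; rewrite mulr_ge0// mulr_ge0 ?(ltW k0)//.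
  by rewrite mulr_ge0//; [exact: le_trans h|exact: ltW (phi_gt0 _)].
have mK : measurable_fun setT (fun x : measurableTypeR R * measurableTypeR R => K x.1 x.2).
  apply: measurable_fun_ifT.
  - apply: measurable_fun_ler; last exact: measurable_snd.
    apply: measurableT_comp => //; apply: measurable_funB; first exact: measurable_cst.
    by apply: measurable_funM; [exact: measurable_cst|exact: measurable_fst].
  - apply: measurable_funM; last by apply: measurableT_comp => //; exact: measurable_fst.
    apply: measurable_funM; first exact: measurable_cst.
    apply: measurable_funM; first exact: measurable_snd.
    by apply: measurableT_comp; [exact: measurable_phi|exact: measurable_snd].
  - exact: measurable_cst.
have mv0 : measurable_fun setT (fun v : R => v * phi v).
  by apply: measurable_funM => //; exact: measurable_phi.
have -> : (\int[leb]_u (gkern k x u * psi u)%:E = \int[leb]_u \int[leb]_v (K u v)%:E)%E.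
  apply: eq_integral => u _.
  pose a : R := `|k * x - k * u|.
  transitivity ((k * psi u)%:E * \int[leb]_(v in `[a, +oo[) (v * phi v)%:E)%E.
    rewrite /a phi_layer// -EFinM /gkern; congr _%:E.
    by case: (ler0P (k * x - k * u)) => _; rewrite ?phiN mulrAC.
  rewrite integral_mkcond -ge0_integralZl//.
  - apply: eq_integral => v _; rewrite patchE /K mem_setE in_itv/= andbT.
    by case: ifP => _; rewrite ?mule0// -EFinM mulrAC mulrA.
  - exact: measurable_restrictR mv0.
  - move=> v _; rewrite patchE mem_setE in_itv/= andbT; case: ifPn => // h.
    rewrite lee_fin; apply: mulr_ge0; last exact: ltW (phi_gt0 _).
    by apply: le_trans h; exact: normr_ge0.
  - by rewrite lee_fin mulr_ge0// ltW.
rewrite tonelliR//.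
have i2 := integrable_phiXs 2; have i4 := integrable_phiXs 4.
have j2 := @integrableZ _ (measurableTypeR R) R leb (4 * e) _ i2.
have j4 := @integrableZ _ (measurableTypeR R) R leb (16 * C / k ^+ 2) _ i4.
apply: (@le_trans _ _ (\int[leb]_v (4 * e * (v ^+ 2 * phi v) + 16 * C / k ^+ 2 * (v ^+ 4 * phi v))%:E)%E); last first.
  rewrite RintE; last exact: (@integrableDE _ (measurableTypeR R) R leb).
  rewrite RintegralD// !RintegralZl// integral_phi_sqr mulr1 lee_fin.
  by rewrite -!mulrA [_ / k ^+ 2]mulrC.
apply: ge0_le_integral => //.
- by move=> v _; apply: integral_ge0 => u _; rewrite lee_fin.
- apply: (@measurable_fun_fubini_tonelli_G _ _ _ _ _ leb
    (fun x : measurableTypeR R * measurableTypeR R => (K x.1 x.2)%:E)) => //.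
  + exact/measurable_EFinP.
  + by move=> z; rewrite lee_fin.
- by apply/measurable_EFinP; apply: measurable_funD; apply: measurable_funM => //;
    (apply: measurable_funM; [exact: measurable_funX|exact: measurable_phi]).
move=> v _; have [v0|v0] := leP v 0.
  rewrite integral0_eq.
    have p0 : 0 <= phi v by exact: ltW (phi_gt0 _).
    have v2 : 0 <= v ^+ 2 by exact: sqr_ge0.
    have v4 : 0 <= v ^+ 4 by rewrite -[4%N]/(2 * 2)%N exprM sqr_ge0.
    have e4 : 0 <= 4 * e by lra.
    have C16 : 0 <= 16 * C / k ^+ 2 by rewrite divr_ge0 ?sqr_ge0//; lra.
    by rewrite lee_fin; apply: addr_ge0; apply: mulr_ge0 => //; apply: mulr_ge0.
  move=> u _; rewrite /K; case: ifPn => // h.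
  have -> : v = 0 by apply/eqP; rewrite eq_le v0 (le_trans _ h).
  by rewrite mul0r mulr0 mul0r.
have kp : 0 <= k * (v * phi v) by rewrite !mulr_ge0 ?(ltW k0) ?(ltW v0)// ltW// phi_gt0.
(* Balls are open, so the radius [v / k] is doubled in order to include the points with
   [|k x - k u| = v]. *)
have vk : 0 < 2 * v / k by rewrite divr_gt0// mulr_gt0.
apply: (@le_trans _ _ ((k * (v * phi v))%:E * \int[leb]_(u in ball x (2 * v / k)) (psi u)%:E)%E).
  rewrite [X in (_ <= _ * X)%E]integral_mkcond -ge0_integralZl//; last first.
  - move=> u _; rewrite patchE; case: ifP => _ //; by rewrite lee_fin.
  - by apply: measurable_restrictR => //; exact: measurable_ball.
  apply: ge0_le_integral => //.
  - by move=> u _; rewrite lee_fin.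
  - by apply/measurable_EFinP; exact: (measurableT_comp mK (pair2_measurable (v : measurableTypeR R))).
  - apply: measurable_funeM.
    by apply: measurable_restrictR => //; exact: measurable_ball.
  move=> u _; rewrite /K; case: ifPn => [h|_]; last first.
    by rewrite patchE; case: ifP => _; rewrite ?mule0// -EFinM lee_fin mulr_ge0.
  rewrite patchE mem_set ?EFinM//= /ball/= ltr_pdivlMr//.
  apply: (@le_lt_trans _ _ v); last by lra.
  by rewrite -(ger0_norm (ltW k0)) -normrM mulrBl !(mulrC _ k).
apply: (@le_trans _ _ ((k * (v * phi v))%:E * (2 * (2 * v / k) * (e + C * (2 * v / k) ^+ 2))%:E)%E).
  by apply: lee_wpmul2l; [rewrite lee_fin|exact: H].
rewrite -EFinM lee_fin le_eqVlt; apply/orP; left; apply/eqP.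
by move: (phi v) => p; field; rewrite gt_eqF.
Qed.

End smoothing_kernel.

(** * Relative entropy to the standard Gaussian *)

Section relative_entropy.
Context {R : realType}.
Local Notation phi := (@normal_pdf R 0 1).
Local Notation leb := (@lebesgue_measure R).

(* The integrand of the relative entropy plus [b - a]: it is nonnegative, unlike
   [a * ln (a / b)], so that Fatou's lemma and Tonelli's theorem apply without any
   assumption on the entropy. *)
Definition rho (a b : R) : R := a * (ln a - ln b) - a + b.

Lemma rho_ge0 (a b : R) : 0 <= a -> 0 < b -> 0 <= rho a b.
Proof.
rewrite /rho le_eqVlt => /orP[/eqP<- b0|a0 b0].
  by rewrite mul0r subr0 add0r ltW.
have := @le_ln1Dx R (b / a - 1).
rewrite subrKC lnM ?posrE ?invr_gt0// lnV ?posrE// => /(_ _) h.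
have {}h : ln b - ln a <= b / a - 1 by apply: h; rewrite ltrBrDl subrr divr_gt0.
have : a * (ln b - ln a) <= a * (b / a - 1) by rewrite ler_pM2l.
have -> : a * (b / a - 1) = b - a by field; rewrite gt_eqF.
by lra.
Qed.

Lemma ln_phi (x : R) : ln (phi x) = ln (normal_peak 1) - x ^+ 2 / 2.
Proof.
by rewrite phiE lnM ?posrE ?normal_peak1_gt0 ?expR_gt0// expRK mulNr.
Qed.

Lemma measurable_rho d (T : measurableType d) (f g : T -> R) : measurable_fun setT f -> measurable_fun setT g ->
  measurable_fun setT (fun x => rho (f x) (g x)).
Proof.
move=> mf mg.
have mln (h : T -> R) : measurable_fun setT h -> measurable_fun setT (fun x => ln (h x)).
  by move=> mh; exact: (measurableT_comp (@measurable_ln R)).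
apply: measurable_funD => //; apply: measurable_funB => //; apply: measurable_funM => //.
by apply: measurable_funB; exact: mln.
Qed.

(** The bracket is the tangent line of [rho _ b] at [c], evaluated at [a]. So [rho a c] measures the
    excess over the tangent, which yields Jensen's inequality; the identity also serves to change
    the reference density. *)
Lemma rho_change (a b c : R) : rho a b = rho a c + (a * (ln c - ln b) + (b - c)).
Proof. by rewrite /rho; ring. Qed.

Definition relent (w : R -> R) : \bar R := (\int[leb]_x (rho (w x) (phi x))%:E)%E.

(** Since [ln phi] is quadratic, [w ln w] and [rho w phi] differ by an integrable function with
    explicit integral. With a finite second moment the differential entropy is therefore never
    [+oo]. *)
Lemma integral_xlnx (w : R -> R) (M : R) : measurable_fun setT w -> (forall x, 0 <= w x) ->
  (\int[leb]_x (w x)%:E = 1)%E -> (\int[leb]_x (w x * x ^+ 2)%:E = M%:E)%E ->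
  (\int[leb]_x (w x * ln (w x))%:E = relent w + (ln (normal_peak 1) - M / 2)%:E)%E.
Proof.
move=> mw w0 w1 wM; have mphi := @measurable_phi R.
have iw : leb.-integrable setT (fun x => (w x)%:E).
  apply/integrableP; split; first exact: measurable_funT_EFin.
  by under eq_integral do rewrite gee0_abs ?lee_fin//; rewrite w1 ltry.
have iM : leb.-integrable setT (fun x => (w x * x ^+ 2)%:E).
  apply/integrableP; split.
    by apply: measurable_funT_EFin; apply: measurable_funM => //; exact: measurable_funX.
  have w2 x : 0 <= w x * x ^+ 2 by rewrite mulr_ge0// sqr_ge0.
  by under eq_integral do rewrite gee0_abs ?lee_fin//; rewrite wM ltry.
have iphi : leb.-integrable setT (fun x => (phi x)%:E).
  by have := @integrable_phiXs R 0; under eq_fun do rewrite mul1r.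
pose h x := (ln (normal_peak 1) + 1) * w x + ((- 2^-1) * (w x * x ^+ 2) + - 1 * phi x).
have i1 := @integrableZ _ (measurableTypeR R) R leb (ln (normal_peak 1) + 1) _ iw.
have i2 := @integrableZ _ (measurableTypeR R) R leb (- 2^-1) _ iM.
have i3 := @integrableZ _ (measurableTypeR R) R leb (- 1) _ iphi.
have i23 := @integrableDE _ (measurableTypeR R) R leb _ _ i2 i3.
have ih : leb.-integrable setT (fun x => (h x)%:E).
  exact: (@integrableDE _ (measurableTypeR R) R leb _ _ i1 i23).
transitivity (\int[leb]_x (rho (w x) (phi x) + h x)%:E)%E.
  apply: eq_integral => x _; congr _%:E; rewrite /rho /h ln_phi.
  by move: (ln _) (ln _) (phi x) => l m p; field.
rewrite (@integralD_ge0_integrable _ (measurableTypeR R) R leb)//.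
- congr (_ + _%:E)%E; rewrite RintegralD// RintegralD// !RintegralZl//.
  rewrite /Rintegral w1 wM integral_normal_pdf//=; lra.
- exact: measurable_rho.
- by move=> x; apply: rho_ge0; rewrite ?w0 ?phi_gt0.
Qed.

(** From [ln x <= x - 1] at [a] and at [1 / sqrt a]. The bound yields continuity of [a ln a] at [0],
    where [ln] itself is discontinuous. *)
Lemma norm_xlnx_le (a : R) : 0 <= a -> `|a * ln a| <= 2 * Num.sqrt a + a ^+ 2.
Proof.
rewrite le_eqVlt => /orP[/eqP<-|a0].
  by rewrite mul0r normr0 sqrtr0 mulr0 expr0n addr0.
have s0 : 0 < Num.sqrt a by rewrite sqrtr_gt0.
have lnle (x : R) : 0 < x -> ln x <= x - 1.
  move=> x0; have := @le_ln1Dx R (x - 1); rewrite subrKC; apply.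
  by rewrite ltrBrDl subrr.
have sa : Num.sqrt a ^+ 2 = a by rewrite sqr_sqrtr// ltW.
have h1 := lnle _ a0.
have h2 : - ln a <= 2 * (Num.sqrt a)^-1.
  have := lnle (Num.sqrt a)^-1; rewrite invr_gt0 => /(_ s0); rewrite lnV ?posrE//.
  have -> : ln a = 2 * ln (Num.sqrt a) by rewrite -[in LHS]sa lnXn// mulr_natl.
  lra.
have h3 : a * (- ln a) <= 2 * Num.sqrt a.
  have : a * (- ln a) <= a * (2 * (Num.sqrt a)^-1) by rewrite ler_pM2l.
  by rewrite -{3}sa -[X in _ <= X -> _]/(_ * (2 * _)) (_ : Num.sqrt a ^+ 2 * (2 * (Num.sqrt a)^-1) = 2 * Num.sqrt a)//; field; rewrite gt_eqF.
have h4 : a * ln a <= a * (a - 1) by rewrite ler_pM2l.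
have a2 := sqr_ge0 a.
by rewrite ler_norml; apply/andP; split; nra.
Qed.

Lemma continuous_xlnx (a : R) : 0 <= a -> forall u : nat -> R, (forall n, 0 <= u n) ->
  u @ \oo --> a -> (fun n => u n * ln (u n)) @ \oo --> a * ln a.
Proof.
rewrite le_eqVlt => /orP[/eqP<-|a0] u u0 ua; last first.
  by apply: cvgM => //; apply: continuous_cvg => //; exact: continuous_ln.
rewrite mul0r; apply/norm_cvg0P.
apply: (@squeeze_cvgr _ _ _ _ (fun=> 0) (fun n => 2 * Num.sqrt (u n) + u n ^+ 2)).
- by near=> n; rewrite normr_ge0 norm_xlnx_le.
- exact: cvg_cst.
- rewrite (_ : 0 = 2 * Num.sqrt 0 + 0 * 0 :> R); last by rewrite sqrtr0 !mulr0 addr0.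
  apply: cvgD; last exact: cvgM.
  apply: cvgM; first exact: cvg_cst.
  by apply: continuous_cvg => //; exact: sqrt_continuous.
Unshelve. all: by end_near. Qed.

End relative_entropy.

(** * Smoothed densities and their entropy *)

Section smoothing.
Context {R : realType} d (T : measurableType d) (P : probability T R) (X : T -> R) (f : R -> R).
Hypothesis mX : measurable_fun setT X.
Hypothesis hm : forall k, P.-integrable setT (fun w => (`|X w| ^+ k)%:E).
Hypothesis dens : is_density P X f.
Local Notation phi := (@normal_pdf R 0 1).
Local Notation leb := (@lebesgue_measure R).
Local Notation p := (gmom P X 0 0).

Let mf : measurable_fun setT f. Proof. by case: dens. Qed.
Let f0 x : 0 <= f x. Proof. by case: dens => _ []. Qed.
Let mfE := measurable_funT_EFin mf.
Let if_ : leb.-integrable setT (fun x => (f x)%:E). Proof. exact: (integrable_density dens). Qed.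

Lemma integral_density : (\int[leb]_x (f x)%:E = 1)%E.
Proof.
have := ge0_expect_density mX dens (@measurable_cst _ _ (measurableTypeR R) (measurableTypeR R) setT 1%R) (fun=> ler01).
move=> h; transitivity (\int[P]_w (1%R)%:E)%E.
  by rewrite h; apply: eq_integral => x _; rewrite mul1r.
by rewrite integral_cst//= mul1e; exact: probability_setT.
Qed.

(** The density of [X + N / k], obtained by rescaling that of [k X + N]. *)
Definition sdens (k x : R) : R := k * p k (k * x).

Lemma sdensE k x : 0 < k -> (sdens k x)%:E = (\int[leb]_u (gkern k x u * f u)%:E)%E.
Proof.
move=> k0; rewrite -(ge0_expect_density mX dens (@measurable_gkern R k x)); last first.
  by move=> u; exact: ltW (gkern_gt0 _ _ _).
rewrite /sdens EFinM /gmom -RintE; last exact: integrable_gker.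
rewrite -ge0_integralZl//.
- by apply: eq_integral => w _; rewrite -EFinM /gkern /gker expr0 mul1r expr0 mul1r.
- by apply: measurable_funT_EFin; exact: measurable_gker.
- by move=> w _; rewrite lee_fin /gker !expr0 !mul1r ltW// phi_gt0.
- by rewrite lee_fin ltW.
Qed.

Lemma integrable_gkernM k x (g : R -> R) : 0 <= k -> leb.-integrable setT (fun u => (g u)%:E) ->
  leb.-integrable setT (fun u => (gkern k x u * g u)%:E).
Proof.
move=> k0 ig; apply: (@integrable_domR _ _ (fun u => k * `|g u|)).
- apply: measurable_funM; first exact: measurable_gkern.
  by apply/measurable_EFinP; exact: measurable_int ig.
- apply: (@integrableZ _ (measurableTypeR R) R leb).
  exact: (integrable_norm ig).
- by move=> u; rewrite normrM ler_wpM2r// gkern_le.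
Qed.

Lemma sdens_gt0 k x : 0 < k -> 0 < sdens k x.
Proof. by move=> k0; rewrite mulr_gt0// (gmom00_gt0 mX hm). Qed.

Lemma measurable_sdens k : measurable_fun setT (sdens k).
Proof.
apply: measurable_funM => //.
by apply: measurableT_comp; [exact: measurable_gmomR|exact: measurable_funM].
Qed.

Lemma ge0_integral_sdens (k : R) (h : R -> R) : 0 < k -> measurable_fun setT h ->
  (forall x, 0 <= h x) ->
  (\int[leb]_x (sdens k x * h x)%:E =
   \int[leb]_u ((f u)%:E * \int[leb]_x (gkern k x u * h x)%:E))%E.
Proof.
move=> k0 mh h0; have mhE := measurable_funT_EFin mh.
have gf0 x u : 0 <= gkern k x u * f u by rewrite mulr_ge0// ltW// gkern_gt0.
under eq_integral => x _.
  rewrite EFinM sdensE// muleC -ge0_integralZl//; last first.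
  - by rewrite lee_fin.
  - by move=> u _; rewrite lee_fin.
  - by apply: measurable_funT_EFin; apply: measurable_funM => //; exact: measurable_gkern.
  under eq_integral do rewrite -EFinM.
  over.
rewrite (@tonelliR _ (fun x u => h x * (gkern k x u * f u))).
- apply: eq_integral => u _; rewrite -ge0_integralZl ?lee_fin//.
  + by apply: eq_integral => x _; rewrite -EFinM; congr _%:E; ring.
  + apply: measurable_funT_EFin; apply: measurable_funM => //.
    by under eq_fun do rewrite gkernC; exact: measurable_gkern.
  + by move=> x _; rewrite lee_fin mulr_ge0// ltW// gkern_gt0.
- apply: measurable_funM; first by apply: measurableT_comp => //; exact: measurable_fst.
  apply: measurable_funM; first exact: measurable_gkern2.
  by apply: measurableT_comp => //; exact: measurable_snd.
- by move=> x u; exact: mulr_ge0.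
Qed.

Lemma integral_sdens k : 0 < k -> (\int[leb]_x (sdens k x)%:E = 1)%E.
Proof.
move=> k0; under eq_integral do rewrite -[sdens _ _]mulr1.
rewrite (@ge0_integral_sdens k (fun=> 1))//.
under eq_integral => u _.
  under eq_integral do rewrite mulr1.
  rewrite integral_gkern// mule1; over.
exact: integral_density.
Qed.

Lemma integral_density_sqr : (\int[leb]_x (f x * x ^+ 2)%:E = (\int[P]_w (X w ^+ 2))%:E)%E.
Proof.
under eq_integral do rewrite mulrC.
rewrite -(ge0_expect_density mX dens); [|exact: measurable_funX|by move=> ?; exact: sqr_ge0].
by apply: RintE; have := hm 2; under eq_fun do rewrite -normrX ger0_norm ?sqr_ge0//.
Qed.

Lemma integral_sdens_sqr k : 0 < k ->
  (\int[leb]_x (sdens k x * x ^+ 2)%:E = (\int[P]_w (X w ^+ 2) + (k ^+ 2)^-1)%:E)%E.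
Proof.
move=> k0; rewrite (@ge0_integral_sdens k (fun x => x ^+ 2))//; last by move=> ?; exact: sqr_ge0.
have e1 : (\int[leb]_u ((f u)%:E * \int[leb]_x (gkern k x u * x ^+ 2)%:E) =
    \int[leb]_u ((f u * u ^+ 2)%:E + (f u)%:E * (k ^+ 2)^-1%:E))%E.
  apply: eq_integral => u _; rewrite integral_gkern_sqr// -EFinM -EFinD; congr _%:E; ring.
rewrite e1 ge0_integralD//.
- rewrite integral_density_sqr ge0_integralZr//.
  + by rewrite integral_density mul1e.
  + by move=> x _; rewrite lee_fin.
  + by rewrite lee_fin invr_ge0 sqr_ge0.
- by move=> u _; rewrite lee_fin mulr_ge0// sqr_ge0.
- by apply: measurable_funT_EFin; apply: measurable_funM => //; exact: measurable_funX.
- by move=> u _; rewrite mule_ge0// lee_fin// invr_ge0 sqr_ge0.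
- by apply: emeasurable_funM => //; exact: measurable_cst.
Qed.

(** Scaling gives [h (k X + N) = h (X + N / k) + ln k]; the second moment of [X + N / k] enters
    through [integral_xlnx]. *)
Lemma Ent_sdens k : 0 < k -> ((Ent P X k)%:E =
  - (relent (sdens k) + (ln (normal_peak 1) - (\int[P]_w (X w ^+ 2) + (k ^+ 2)^-1) / 2)%:E)
  + (ln k)%:E)%E.
Proof.
move=> k0.
have ms := measurable_sdens k.
have s0 x := ltW (sdens_gt0 x k0).
rewrite -(integral_xlnx ms s0 (integral_sdens k0) (integral_sdens_sqr k0)).
have cE : continuous (entk P X k).
  move=> y; apply: cvgN; apply: cvgM; first exact: (continuous_gmom mX hm).
  exact: (continuous_log_y mX hm).
have iE : leb.-integrable setT (fun y => (entk P X k y)%:E).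
  apply: (@integrable_bnd _ _ (gbnd P X 0 `|k| * lbnd P X `|k|)); first exact: (measurable_entk mX hm).
  by move=> y; apply: (entk_le mX hm).
rewrite /Ent; have [iEk ->] := Rintegral_scale k0 cE iE.
have is_ : leb.-integrable setT (fun y => (sdens k y)%:E).
  apply/integrableP; split; first exact: measurable_funT_EFin.
  by under eq_integral do rewrite gee0_abs ?lee_fin//; rewrite integral_sdens// ltry.
have ik := @integrableZ _ (measurableTypeR R) R leb (- k) _ iEk.
have il := @integrableZ _ (measurableTypeR R) R leb (ln k) _ is_.
have -> : (\int[leb]_x (sdens k x * ln (sdens k x))%:E =
  \int[leb]_x (- k * entk P X k (k * x) + ln k * sdens k x)%:E)%E.
  apply: eq_integral => x _; congr _%:E.
  rewrite /entk [in ln (sdens _ _)]/sdens lnM ?posrE// ?(gmom00_gt0 mX hm)// /sdens.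
  by move: (ln (p _ _)) (ln k) => l m; ring.
rewrite RintE; last exact: (@integrableDE _ (measurableTypeR R) R leb).
have R1 : \int[leb]_x sdens k x = 1 by rewrite /Rintegral integral_sdens.
rewrite RintegralD// [\int[_]_x (- k * _)]RintegralZl// [\int[_]_x (ln k * _)]RintegralZl// R1 -EFinN -EFinD; congr _%:E.
by rewrite mulr1 mulNr opprD opprK subrK.
Qed.

Lemma integrable_gkern k x : 0 < k -> leb.-integrable setT (fun u => (gkern k x u)%:E).
Proof.
move=> k0; apply/integrableP; split.
  by apply: measurable_funT_EFin; exact: measurable_gkern.
under eq_integral do rewrite gkernC gee0_abs ?lee_fin ?(ltW (gkern_gt0 _ _ _))//.
by rewrite integral_gkern// ltry.
Qed.

(* Jensen's inequality for the convex function [rho (_) (phi x)] under the kernel. *)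
Lemma rho_sdens_le k x : 0 < k -> ((rho (sdens k x) (phi x))%:E <=
  \int[leb]_u (gkern k x u * rho (f u) (phi x))%:E)%E.
Proof.
move=> k0; set s := sdens k x; have s0 : 0 < s by exact: sdens_gt0.
(* [l] is the slope of [rho _ (phi x)] at [s]; by [rho_change] the excess over the tangent line is
   [rho (f u) s], which is nonnegative. *)
pose l := ln s - ln (phi x).
have i1 := @integrableZ _ (measurableTypeR R) R leb l _ (integrable_gkernM x (ltW k0) if_).
have i2 := @integrableZ _ (measurableTypeR R) R leb (phi x - s) _ (integrable_gkern x k0).
have i12 := @integrableDE _ (measurableTypeR R) R leb _ _ i1 i2.
have -> : (\int[leb]_u (gkern k x u * rho (f u) (phi x))%:E = \int[leb]_u (gkern k x u * rho (f u) s
    + (l * (gkern k x u * f u) + (phi x - s) * gkern k x u))%:E)%E.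
  by apply: eq_integral => u _; congr _%:E; rewrite (rho_change _ _ s) -/l; ring.
have g0 u : 0 <= gkern k x u * rho (f u) s.
  by rewrite mulr_ge0 ?(ltW (gkern_gt0 _ _ _))// rho_ge0.
rewrite (@integralD_ge0_integrable _ (measurableTypeR R) R leb)//; last first.
  by apply: measurable_funM; [exact: measurable_gkern|apply: measurable_rho => //].
have -> : \int[leb]_u (l * (gkern k x u * f u) + (phi x - s) * gkern k x u) = rho s (phi x).
  have j1 := integrable_gkernM x (ltW k0) if_.
  have j2 := integrable_gkern x k0.
  have R1 : \int[leb]_u (gkern k x u * f u) = s by rewrite /Rintegral -sdensE.
  have R2 : \int[leb]_u gkern k x u = 1.
    by rewrite /Rintegral; under eq_integral do rewrite gkernC; rewrite integral_gkern.
  by rewrite RintegralD// [X in X + _]RintegralZl// [X in _ + X]RintegralZl// R1 R2 /rho /l; ring.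
by rewrite leeDr// integral_ge0// => u _; rewrite lee_fin.
Qed.

(** Replaces the reference [phi x] by [phi u]: the logarithms differ by [(x^2 - u^2) / 2], whose
    average under the kernel is [k^-2 / 2]. The terms added on both sides keep every integrand
    nonnegative. *)
Lemma integral_gkern_rho k u : 0 < k ->
  (\int[leb]_x (gkern k x u * rho (f u) (phi x))%:E + (phi u + f u * u ^+ 2 / 2)%:E =
   (rho (f u) (phi u) + f u * ((k ^+ 2)^-1 + u ^+ 2) / 2)%:E
   + \int[leb]_x (gkern k x u * phi x)%:E)%E.
Proof.
move=> k0.
have mg : measurable_fun setT (fun x => gkern k x u).
  by under eq_fun do rewrite gkernC; exact: measurable_gkern.
have g0 x : 0 <= gkern k x u by exact: ltW (gkern_gt0 _ _ _).
have r0 x : 0 <= rho (f u) (phi x) by rewrite rho_ge0// phi_gt0.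
have p0 x : 0 <= phi x by exact: ltW (phi_gt0 _).
have c0 : 0 <= phi u + f u * u ^+ 2 / 2.
  by rewrite addr_ge0// mulr_ge0// mulr_ge0// sqr_ge0.
have fh : 0 <= f u / 2 by rewrite mulr_ge0.
have mphi := @measurable_phi R.
have mx2 : measurable_fun setT (fun x : R => x ^+ 2) by exact: measurable_funX.
transitivity (\int[leb]_x ((gkern k x u * rho (f u) (phi x))%:E
    + (phi u + f u * u ^+ 2 / 2)%:E * (gkern k x u)%:E))%E.
  rewrite ge0_integralD//.
  - by rewrite ge0_integralZl// ?integral_gkern ?mule1//; [exact: measurable_funT_EFin|move=> x _; rewrite lee_fin].
  - by move=> x _; rewrite lee_fin mulr_ge0.
  - by apply: measurable_funT_EFin; apply: measurable_funM => //; exact: measurable_rho.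
  - by move=> x _; rewrite mule_ge0// lee_fin.
  - by apply: measurable_funeM; exact: measurable_funT_EFin.
transitivity (\int[leb]_x ((rho (f u) (phi u))%:E * (gkern k x u)%:E
    + ((f u / 2)%:E * (gkern k x u * x ^+ 2)%:E + (gkern k x u * phi x)%:E)))%E.
  apply: eq_integral => x _; rewrite -!EFinM -!EFinD; congr _%:E.
  have -> : rho (f u) (phi x) = rho (f u) (phi u) + f u * ((x ^+ 2 - u ^+ 2) / 2) + (phi x - phi u).
    by rewrite (rho_change _ (phi x) (phi u)) !ln_phi; ring.
  by field.
have m1 : measurable_fun setT (fun x : R => ((rho (f u) (phi u))%:E * (gkern k x u)%:E)%E).
  by apply: measurable_funeM; exact: measurable_funT_EFin.
have m2 : measurable_fun setT (fun x : R => (gkern k x u * x ^+ 2)%:E).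
  by apply: measurable_funT_EFin; exact: measurable_funM.
have m3 : measurable_fun setT (fun x : R => (gkern k x u * phi x)%:E).
  by apply: measurable_funT_EFin; exact: measurable_funM.
have m2' := measurable_funeM (f u / 2)%:E m2.
have x20 (x : R) : 0 <= gkern k x u * x ^+ 2 by rewrite mulr_ge0// sqr_ge0.
rewrite ge0_integralD//; last 3 first.
- by move=> x _; rewrite mule_ge0// lee_fin.
- by move=> x _; rewrite adde_ge0// ?mule_ge0// lee_fin// mulr_ge0.
- exact: emeasurable_funD.
rewrite [X in (_ + X)%E]ge0_integralD//; last 2 first.
- by move=> x _; rewrite mule_ge0// lee_fin.
- by move=> x _; rewrite lee_fin mulr_ge0.
have mgE := measurable_funT_EFin mg.
rewrite ge0_integralZl//; last 2 first.
- by move=> x _; rewrite lee_fin.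
- by rewrite lee_fin.
rewrite ge0_integralZl//; last by move=> x _; rewrite lee_fin.
rewrite integral_gkern// integral_gkern_sqr// mule1 addeA -EFinM -EFinD; congr (_%:E + _)%E.
by ring.
Qed.

Lemma relent_sdens_le k : 0 < k -> (relent (sdens k) <= relent f + ((k ^+ 2)^-1 / 2)%:E)%E.
Proof.
move=> k0; have mphi := @measurable_phi R.
have g0 x u : 0 <= gkern k x u by exact: ltW (gkern_gt0 _ _ _).
have r0 u x : 0 <= rho (f u) (phi x) by rewrite rho_ge0// phi_gt0.
have p0 x : 0 <= phi x by exact: ltW (phi_gt0 _).
have x20 u : 0 <= f u * u ^+ 2 / 2 by rewrite mulr_ge0// mulr_ge0// sqr_ge0.
have mx2 : measurable_fun setT (fun u => f u * u ^+ 2 / 2).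
  by apply: measurable_funM => //; apply: measurable_funM => //; exact: measurable_funX.
have mK : measurable_fun setT (fun z : measurableTypeR R * measurableTypeR R =>
    gkern k z.1 z.2 * rho (f z.2) (phi z.1)).
  apply: measurable_funM; first exact: measurable_gkern2.
  apply: measurable_rho; first by apply: measurableT_comp => //; exact: measurable_snd.
  by apply: measurableT_comp => //; exact: measurable_fst.
have mJ : measurable_fun setT (fun z : measurableTypeR R * measurableTypeR R =>
    gkern k z.1 z.2 * phi z.1).
  apply: measurable_funM; first exact: measurable_gkern2.
  by apply: measurableT_comp => //; exact: measurable_fst.
have mI : measurable_fun setT (fun u => (\int[leb]_x (gkern k x u * rho (f u) (phi x))%:E)%E).
  apply: (@measurable_fun_fubini_tonelli_G _ _ _ _ _ leb (fun z : measurableTypeR R * measurableTypeR R =>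
    (gkern k z.1 z.2 * rho (f z.2) (phi z.1))%:E)); first exact/measurable_EFinP.
  by move=> z; rewrite lee_fin mulr_ge0.
have mJJ : measurable_fun setT (fun u => (\int[leb]_x (gkern k x u * phi x)%:E)%E).
  apply: (@measurable_fun_fubini_tonelli_G _ _ _ _ _ leb (fun z : measurableTypeR R * measurableTypeR R =>
    (gkern k z.1 z.2 * phi z.1)%:E)); first exact/measurable_EFinP.
  by move=> z; rewrite lee_fin mulr_ge0.
have mFI : measurable_fun setT (fun x => (\int[leb]_u (gkern k x u * rho (f u) (phi x))%:E)%E).
  apply: (@measurable_fun_fubini_tonelli_F _ _ _ _ _ leb (fun z : measurableTypeR R * measurableTypeR R =>
    (gkern k z.1 z.2 * rho (f z.2) (phi z.1))%:E)); first exact/measurable_EFinP.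
  by move=> z; rewrite lee_fin mulr_ge0.
apply: (@le_trans _ _ (\int[leb]_x \int[leb]_u (gkern k x u * rho (f u) (phi x))%:E)%E).
  apply: ge0_le_integral => //.
  - by move=> x _; rewrite lee_fin rho_ge0 ?phi_gt0// ltW// sdens_gt0.
  - apply: measurable_funT_EFin; apply: measurable_rho => //; exact: measurable_sdens.
  - by move=> x _; exact: rho_sdens_le.
rewrite (@tonelliR _ (fun x u => gkern k x u * rho (f u) (phi x)))//; last by move=> x u; rewrite mulr_ge0.
set I := (fun u => \int[leb]_x (gkern k x u * rho (f u) (phi x))%:E)%E in mI *.
have iphi1 : (\int[leb]_x (phi x)%:E = 1)%E by exact: integral_normal_pdf.
pose m : R := \int[P]_w (X w ^+ 2).
have im : (\int[leb]_x (f x * x ^+ 2 / 2)%:E = (m / 2)%:E)%E.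
  under eq_integral do rewrite mulrC EFinM.
  rewrite ge0_integralZl//.
  - by rewrite integral_density_sqr -EFinM mulrC.
  - by apply: measurable_funT_EFin; apply: measurable_funM => //; exact: measurable_funX.
  - by move=> u _; rewrite lee_fin mulr_ge0// sqr_ge0.
(* The constant [1 + m / 2] is the integral of the terms added in [integral_gkern_rho]; being
   finite, it can be cancelled at the end. *)
have e1 : (\int[leb]_u (I u + (phi u + f u * u ^+ 2 / 2)%:E) = \int[leb]_u I u + (1 + m / 2)%:E)%E.
  rewrite ge0_integralD//.
  - congr (_ + _)%E; under eq_integral do rewrite EFinD.
    rewrite ge0_integralD//.
    + by rewrite iphi1 im.
    + by move=> u _; rewrite lee_fin.
    + exact: measurable_funT_EFin.
    + by move=> u _; rewrite lee_fin.
    + exact: measurable_funT_EFin.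
  - by move=> u _; apply: integral_ge0 => x _; rewrite lee_fin mulr_ge0.
  - by move=> u _; rewrite lee_fin addr_ge0.
  - by apply: measurable_funT_EFin; exact: measurable_funD.
have e2 : (\int[leb]_u ((rho (f u) (phi u) + f u * ((k ^+ 2)^-1 + u ^+ 2) / 2)%:E
    + \int[leb]_x (gkern k x u * phi x)%:E) = relent f + ((k ^+ 2)^-1 / 2)%:E + (1 + m / 2)%:E)%E.
  have k2 : 0 <= (k ^+ 2)^-1 / 2 by rewrite mulr_ge0// invr_ge0 sqr_ge0.
  have mrf : measurable_fun setT (fun u => rho (f u) (phi u)) by exact: measurable_rho.
  transitivity (\int[leb]_u ((rho (f u) (phi u))%:E + (((k ^+ 2)^-1 / 2)%:E * (f u)%:E
     + ((f u * u ^+ 2 / 2)%:E + \int[leb]_x (gkern k x u * phi x)%:E))))%E.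
    apply: eq_integral => u _; move: (\int[_]_x _)%E => j; rewrite -EFinM !addeA -!EFinD.
    suff -> : rho (f u) (phi u) + f u * ((k ^+ 2)^-1 + u ^+ 2) / 2 =
      rho (f u) (phi u) + (k ^+ 2)^-1 / 2 * f u + f u * u ^+ 2 / 2 by [].
    by ring.
  have J0 u : (0 <= \int[leb]_x (gkern k x u * phi x)%:E)%E.
    by apply: integral_ge0 => x _; rewrite lee_fin mulr_ge0.
  have mx2E := measurable_funT_EFin mx2.
  have mkf := measurable_funeM ((k ^+ 2)^-1 / 2)%:E mfE.
  have m34 := emeasurable_funD mx2E mJJ.
  rewrite ge0_integralD//; last 4 first.
  - by move=> u _; rewrite lee_fin.
  - exact: measurable_funT_EFin.
  - move=> u _; rewrite adde_ge0//; first by rewrite mule_ge0// lee_fin.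
    by rewrite adde_ge0// lee_fin.
  - exact: emeasurable_funD.
  suff -> : (\int[leb]_u (((k ^+ 2)^-1 / 2)%:E * (f u)%:E
      + ((f u * u ^+ 2 / 2)%:E + \int[leb]_x (gkern k x u * phi x)%:E)) =
      ((k ^+ 2)^-1 / 2)%:E + (1 + m / 2)%:E)%E by rewrite addeA.
  rewrite ge0_integralD//; last 2 first.
  - by move=> u _; rewrite mule_ge0// lee_fin.
  - by move=> u _; rewrite adde_ge0// lee_fin.
  rewrite ge0_integralZl// ?lee_fin//; last by move=> u _; rewrite lee_fin.
  rewrite integral_density mule1.
  suff -> : (\int[leb]_u ((f u * u ^+ 2 / 2)%:E + \int[leb]_x (gkern k x u * phi x)%:E) =
      (1 + m / 2)%:E)%E by [].
  rewrite ge0_integralD// ?im; last by move=> u _; rewrite lee_fin.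
  suff -> : (\int[leb]_u \int[leb]_x (gkern k x u * phi x)%:E = 1)%E by rewrite addrC.
  rewrite -(@tonelliR _ (fun x u => gkern k x u * phi x))//; last by move=> x u; rewrite mulr_ge0.
  rewrite -iphi1; apply: eq_integral => x _.
  under eq_integral do rewrite mulrC EFinM gkernC.
  rewrite ge0_integralZl// ?lee_fin//.
  - by rewrite integral_gkern// mule1.
  - by apply: measurable_funT_EFin; under eq_fun do rewrite gkernC; exact: measurable_gkern.
  - by move=> u _; rewrite lee_fin.
have : (\int[leb]_u I u + (1 + m / 2)%:E = relent f + ((k ^+ 2)^-1 / 2)%:E + (1 + m / 2)%:E)%E.
  by rewrite -e1 -e2; apply: eq_integral => u _; exact: integral_gkern_rho.
by move=> /(congr1 (fun z => z - (1 + m / 2)%:E)%E); rewrite !addeK// => ->.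
Qed.

End smoothing.

(** * The limit of vanishing noise *)

Section noise_limit.
Context {R : realType} d (T : measurableType d) (P : probability T R) (X : T -> R) (f : R -> R).
Hypothesis mX : measurable_fun setT X.
Hypothesis hm : forall k, P.-integrable setT (fun w => (`|X w| ^+ k)%:E).
Hypothesis dens : is_density P X f.
Local Notation phi := (@normal_pdf R 0 1).
Local Notation leb := (@lebesgue_measure R).
Local Notation s_ := (sdens P X).

Let mf : measurable_fun setT f. Proof. by case: dens. Qed.
Let f0 x : 0 <= f x. Proof. by case: dens => _ []. Qed.
Let mfE := measurable_funT_EFin mf.
Let if_ : leb.-integrable setT (fun x => (f x)%:E). Proof. exact: (integrable_density dens). Qed.
Let if1 : (\int[leb]_x (f x)%:E = 1)%E. Proof. exact: (integral_density mX dens). Qed.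

Lemma measurable_absB x : measurable_fun setT (fun u => `|f u - f x|).
Proof. by apply: measurableT_comp => //; exact: measurable_funB. Qed.

(* The crude bound for large radii makes the estimate valid for all [r], which the layer
   cake formula needs. *)
Lemma lebesgue_pt_ball x e : lebesgue_pt f x -> 0 < e -> exists2 C : R, 0 <= C & forall r : R, 0 < r ->
  (\int[leb]_(u in ball x r) (`|f u - f x|)%:E <= (2 * r * (e + C * r ^+ 2))%:E)%E.
Proof.
move=> lx e0.
have ne : nbhs (0%E : \bar R) [set y | y < e%:E]%E.
  by apply: open_nbhs_nbhs; split; [exact: open_ereal_lt_ereal|rewrite /= lte_fin].
have [/= D D0 DH] := lx _ ne.
(* For [r >= D] the integral is at most [1 + 2 r f x], which is at most [2 r (1 / (2 D) + f x)]; the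
   division by [D^2] is then compensated by [r^2]. *)
pose C : R := ((2 * D)^-1 + f x) / D ^+ 2.
have C0 : 0 <= C by rewrite divr_ge0 ?sqr_ge0// addr_ge0// invr_ge0 mulr_ge0// ltW.
exists C => // r r0; have mB : measurable (ball x r : set R) by exact: measurable_ball.
have muB : leb (ball x r) = (r *+ 2)%:E by apply: lebesgue_measure_ball; exact: ltW.
have r20 : 0 < r *+ 2 by rewrite mulrn_wgt0.
have [rD|Dr] := ltP r D.
  have := DH r; rewrite /= sub0r normrN gtr0_norm// => /(_ rD r0).
  rewrite /davg /iavg muB inver gt_eqF//= => h.
  apply: (@le_trans _ _ ((r *+ 2)%:E * e%:E)%E).
    by rewrite -lee_pdivrMl//; exact: ltW h.
  rewrite -EFinM lee_fin -[r *+ 2]mulr_natl; apply: ler_wpM2l; first by rewrite mulr_ge0// ltW.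
  rewrite lerDl.
  by rewrite mulr_ge0// sqr_ge0.
apply: (@le_trans _ _ (\int[leb]_(u in ball x r) ((f u)%:E + (f x)%:E))%E).
  apply: ge0_le_integral => //.
  - by apply: measurable_funTS; apply: measurable_funT_EFin; exact: measurable_absB.
  - by apply: measurable_funTS; apply: emeasurable_funD => //; exact: measurable_cst.
  - by move=> u _; rewrite -EFinD lee_fin (le_trans (ler_normB _ _))// !ger0_norm.
rewrite ge0_integralD//; last 3 first.
- by move=> u _; rewrite lee_fin.
- exact: measurable_funTS.
- by move=> u _; rewrite lee_fin.
rewrite integral_cst// [X in (_ + _ * X)%E]muB.
apply: (@le_trans _ _ (1%:E + (f x)%:E * (r *+ 2)%:E)%E).
  apply: leeD => //; rewrite -if1; apply: ge0_subset_integral => //.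
  by move=> u _; rewrite lee_fin.
rewrite -EFinM -EFinD lee_fin.
have h1 : (2 * D)^-1 + f x <= C * r ^+ 2.
  rewrite /C mulrAC ler_pdivlMr ?exprn_gt0// ler_pM2l.
    by rewrite ler_pXn2r// ?nnegrE// ltW.
  by rewrite ltr_wpDr// invr_gt0 mulr_gt0.
have h2 : 1 <= 2 * r * (2 * D)^-1.
  by rewrite ler_pdivlMr ?mulr_gt0// mul1r ler_pM2l.
have h3 : 2 * r * ((2 * D)^-1 + f x) <= 2 * r * (C * r ^+ 2) by rewrite ler_pM2l// mulr_gt0.
have h4 : 0 <= 2 * r * e by rewrite !mulr_ge0 ?ltW.
by rewrite -mulr_natl; move: h2 h3 h4; rewrite !mulrDr; set q := _ * _^-1; lra.
Qed.

Lemma sdens_sub_le k x e C : 0 < k -> 0 <= e -> 0 <= C ->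
  (forall r : R, 0 < r ->
    (\int[leb]_(u in ball x r) (`|f u - f x|)%:E <= (2 * r * (e + C * r ^+ 2))%:E)%E) ->
  `|s_ k x - f x| <= 4 * e + 16 * C * \int[leb]_v (v ^+ 4 * phi v) / k ^+ 2.
Proof.
move=> k0 e0 C0 H; rewrite -lee_fin.
apply: le_trans (integral_gkern_ball k0 e0 C0 (measurable_absB x) (fun u => normr_ge0 _) H).
have i1 := integrable_gkernM x (ltW k0) if_.
have ig := integrable_gkern x k0.
have i2 := @integrableZ _ (measurableTypeR R) R leb (f x) _ ig.
have i12 := @integrableBE _ (measurableTypeR R) R leb _ _ i1 i2.
have -> : s_ k x - f x = \int[leb]_u (gkern k x u * f u - f x * gkern k x u).
  have R1 : \int[leb]_u (gkern k x u * f u) = s_ k x by rewrite /Rintegral -(sdensE mX hm dens).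
  have R2 : \int[leb]_u gkern k x u = 1.
    by rewrite /Rintegral; under eq_integral do rewrite gkernC; rewrite integral_gkern.
  by rewrite RintegralB// [\int[_]_u (f x * _)]RintegralZl// R1 R2 mulr1.
apply: (@le_trans _ _ (\int[leb]_u `|gkern k x u * f u - f x * gkern k x u|)%:E).
  by rewrite lee_fin; exact: le_normr_Rintegral.
rewrite -RintE; last exact: (integrable_norm i12).
rewrite le_eqVlt; apply/orP; left; apply/eqP; apply: eq_integral => u _; congr _%:E.
by rewrite [f x * _]mulrC -mulrBr normrM (gtr0_norm (gkern_gt0 _ _ k0)).
Qed.

(** A density may have no point of continuity, so the limit is taken at Lebesgue points. The
    tolerance [e / 8] becomes [e / 2] through the factor 4 of the ball estimate. *)
Lemma cvg_sdens x : lebesgue_pt f x -> (fun n => s_ n.+1%:R x) @ \oo --> f x.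
Proof.
move=> lx; apply/cvgrPdist_le => e e0.
have e8 : 0 < e / 8 by rewrite divr_gt0.
have [C C0 H] := lebesgue_pt_ball lx e8.
set K := 16 * C * \int[leb]_v (v ^+ 4 * phi v).
have K0 : 0 <= K.
  apply: mulr_ge0; first by rewrite mulr_ge0.
  apply: Rintegral_ge0 => v _; rewrite mulr_ge0//; last exact: ltW (phi_gt0 _).
  by rewrite -[4%N]/(2 * 2)%N exprM sqr_ge0.
near=> n; rewrite distrC.
apply: le_trans (sdens_sub_le _ (ltW e8) C0 H) _; first by rewrite ltr0n.
rewrite -/K.
have n1 : 1 <= n.+1%:R :> R by rewrite ler1n.
have hn : 2 * K / e <= n.+1%:R.
  apply: (@le_trans _ _ n%:R); last by rewrite ler_nat.
  by near: n; exact: nbhs_infty_ger.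
suff : K / n.+1%:R ^+ 2 <= e / 2 by set z := K / _; lra.
rewrite ler_pdivrMr ?exprn_gt0//.
have h1 : K <= e / 2 * n.+1%:R.
  by move: hn; rewrite ler_pdivrMr//; lra.
apply: (le_trans h1); rewrite ler_pM2l ?divr_gt0// expr2.
by rewrite ler_peMl// ltW// (lt_le_trans ltr01).
Unshelve. all: by end_near. Qed.

(** Fatou's lemma is applied to the pointwise lower limit, which the Lebesgue differentiation
    theorem identifies almost everywhere. *)
Lemma relent_le_liminf : (relent f <= limn_einf (fun n => relent (s_ n.+1%:R)))%E.
Proof.
pose h n x : \bar R := (rho (s_ n.+1%:R x) (phi x))%:E.
have mh n : measurable_fun setT (h n).
  apply: measurable_funT_EFin; apply: measurable_rho; last exact: measurable_phi.
  exact: measurable_sdens.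
have h0 n x : setT x -> (0 <= h n x)%E.
  by move=> _; rewrite lee_fin rho_ge0 ?phi_gt0// ltW// (sdens_gt0 mX hm).
have := @fatou _ (measurableTypeR R) R leb setT measurableT h mh h0.
apply: le_trans; rewrite le_eqVlt; apply/orP; left; apply/eqP.
apply: ae_eq_integral => //.
- apply: measurable_funT_EFin; apply: measurable_rho => //; exact: measurable_phi.
- rewrite /limn_einf; apply: measurableT_comp => //.
  apply: (@measurable_fun_limn_esup _ (measurableTypeR R) R setT (fun n x => - h n x)%E) => n.
  by apply: measurableT_comp => //; exact: mh.
have lf : locally_integrable setT f by apply: open_integrable_locally => //; exact: openT.
apply: (@filterS _ _ (ae_filter_ringOfSetsType leb) _ _ _ (lebesgue_differentiation lf)) => x lx _.
suff cx : h ^~ x @ \oo --> (rho (f x) (phi x))%:E by rewrite (cvg_limn_einf_sup cx).1.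
apply: cvg_EFin; first exact: nearW.
have cs := cvg_sdens lx.
have s0 n : 0 <= s_ n.+1%:R x by rewrite ltW// (sdens_gt0 mX hm).
have cx := continuous_xlnx (f0 x) s0 cs.
rewrite /rho; apply: cvgD; last exact: cvg_cst.
apply: cvgB => //.
rewrite [X in _ --> X]mulrBr; under eq_fun do rewrite mulrBr.
by apply: cvgB => //; apply: cvgM => //; exact: cvg_cst.
Qed.

Lemma cvg_invSn2 : (fun n => (n.+1%:R ^+ 2)^-1 : R) @ \oo --> (0 : R).
Proof.
apply: (@squeeze_cvgr _ _ _ _ (fun=> 0) (@harmonic R)).
- near=> n; rewrite invr_ge0 sqr_ge0/= lef_pV2 ?posrE ?exprn_gt0//.
  by rewrite expr2 ler_peMl// ler1n.
- exact: cvg_cst.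
- exact: cvg_harmonic.
Unshelve. all: by end_near. Qed.

(** The sequence is squeezed between [einfs u], which tends to the lower limit, and the upper bound
    from smoothing. This remains valid when [relent f] is [+oo], the case of entropy [-oo]. *)
Lemma cvg_relent : (fun n => relent (s_ n.+1%:R)) @ \oo --> relent f.
Proof.
set u := (fun n => _); have low := relent_le_liminf; rewrite -/u limn_einf_lim in low.
have cl := @is_cvg_einfs R u.
pose v n := (relent f + ((n.+1%:R ^+ 2)^-1 / 2)%:E)%E.
have uv n : (u n <= v n)%E by apply: (relent_sdens_le mX hm dens).
have rf0 : (0 <= relent f)%E.
  by apply: integral_ge0 => x _; rewrite lee_fin rho_ge0// phi_gt0.
have cv : v @ \oo --> relent f.
  rewrite -[X in _ --> X]adde0; apply: cvgeD.
  - by rewrite ge0_adde_def// inE.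
  - exact: cvg_cst.
  - apply: cvg_EFin; first exact: nearW.
    rewrite -(mul0r (2^-1 : R)); apply: cvgM; [exact: cvg_invSn2|exact: cvg_cst].
have eu n : (einfs u n <= u n)%E by apply: ereal_inf_lbound; exists n => /=.
have lu : limn (einfs u) = relent f.
  apply/eqP; rewrite eq_le low andbT -(cvg_lim _ cv)//.
  apply: lee_lim => //; first by apply/cvg_ex; exists (relent f).
  by apply: nearW => n; exact: le_trans (uv n).
apply: (@squeeze_cvge _ _ _ _ (einfs u) u v).
- by near=> n; rewrite eu uv.
- by rewrite -lu; exact: cl.
- exact: cv.
Unshelve. all: by end_near. Qed.

Lemma cvg_Ent : (fun n => (Ent P X n.+1%:R - ln n.+1%:R)%:E) @ \oo --> diff_entropy f.
Proof.
pose L := ln (normal_peak 1) : R; pose m := \int[P]_w (X w ^+ 2).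
rewrite /diff_entropy (integral_xlnx mf f0 if1 (integral_density_sqr mX hm dens)) -/L -/m.
have -> : (fun n => (Ent P X n.+1%:R - ln n.+1%:R)%:E) =
   (fun n => - (relent (s_ n.+1%:R) + (L - (m + (n.+1%:R ^+ 2)^-1) / 2)%:E))%E.
  apply/funext => n; rewrite EFinD (Ent_sdens mX hm dens) ?ltr0n// EFinN.
  by rewrite addeK.
apply: cvgeN; apply: cvgeD.
- by rewrite fin_num_adde_defl.
- exact: cvg_relent.
- apply: cvg_EFin; first exact: nearW.
  apply: cvgB; first exact: cvg_cst.
  apply: cvgM; last exact: cvg_cst.
  rewrite -[X in _ --> X]addr0; apply: cvgD; [exact: cvg_cst|exact: cvg_invSn2].
Qed.

End noise_limit.

(** * The strong law of large numbers *)

Section independence.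
Context {R : realType} d (T : measurableType d) (P : probability T R).

(** Independence identifies the joint law with the product of the laws, by uniqueness on rectangles;
    Tonelli's theorem then factors the integral. *)
Lemma ge0_expectM_mfun d1 d2 (T1 : measurableType d1) (T2 : measurableType d2)
    (Y : {mfun T >-> T1}) (Z : {mfun T >-> T2}) (g : T1 -> R) (h : T2 -> R) :
  (forall A B, measurable A -> measurable B ->
    P (Y @^-1` A `&` Z @^-1` B) = (P (Y @^-1` A) * P (Z @^-1` B))%E) ->
  measurable_fun setT g -> measurable_fun setT h -> (forall x, 0 <= g x) -> (forall x, 0 <= h x) ->
  (\int[P]_w (g (Y w) * h (Z w))%:E = \int[P]_w (g (Y w))%:E * \int[P]_w (h (Z w))%:E)%E.
Proof.
move=> iYZ mg mh g0 h0.
have mYZ : measurable_fun setT (fun w => (Y w, Z w)) by exact: measurable_fun_pair.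
pose W : {mfun T >-> (T1 * T2)%type} := mfun_Sub (mem_set mYZ : _ \in mfun).
pose k (z : (T1 * T2)%type) : \bar R := (g z.1 * h z.2)%:E.
have mk : measurable_fun setT k.
  apply/measurable_EFinP; apply: measurable_funM.
    by apply: measurableT_comp; [exact: mg|exact: measurable_fst].
  by apply: measurableT_comp; [exact: mh|exact: measurable_snd].
have k0 z : (0 <= k z)%E by rewrite lee_fin mulr_ge0.
have mgE := measurable_funT_EFin mg; have mhE := measurable_funT_EFin mh.
have -> : (\int[P]_w (g (Y w) * h (Z w))%:E = \int[distribution P W]_z k z)%E.
  by rewrite ge0_integral_distribution.
have -> : (\int[P]_w (g (Y w))%:E = \int[distribution P Y]_z (g z)%:E)%E.
  by rewrite ge0_integral_distribution// => y; rewrite lee_fin.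
have -> : (\int[P]_w (h (Z w))%:E = \int[distribution P Z]_z (h z)%:E)%E.
  by rewrite ge0_integral_distribution// => y; rewrite lee_fin.
have -> : (\int[distribution P W]_z k z =
    \int[((distribution P Y) \x (distribution P Z))%E]_z k z)%E.
  apply: eq_measure_integral => A mA _; apply/esym.
  apply: (@product_measure_unique _ _ _ _ _ (distribution P Y) (distribution P Z) (distribution P W)) => //.
rewrite fubini_tonelli1//.
transitivity (\int[distribution P Y]_x ((g x)%:E * \int[distribution P Z]_z (h z)%:E))%E.
  apply: eq_integral => y _; rewrite -ge0_integralZl//.
  - by move=> z _; rewrite lee_fin.
  - by rewrite lee_fin.
rewrite ge0_integralZr//.
- by move=> y _; rewrite lee_fin.
- by apply: integral_ge0 => z _; rewrite lee_fin.
Qed.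

Definition indep2 (Y Z : T -> R) : Prop := forall A B : set R, measurable A -> measurable B ->
  P (Y @^-1` A `&` Z @^-1` B) = (P (Y @^-1` A) * P (Z @^-1` B))%E.

Lemma ge0_expectM (Y Z : T -> R) (g h : R -> R) :
  measurable_fun setT Y -> measurable_fun setT Z -> indep2 Y Z ->
  measurable_fun setT g -> measurable_fun setT h -> (forall x, 0 <= g x) -> (forall x, 0 <= h x) ->
  (\int[P]_w (g (Y w) * h (Z w))%:E = \int[P]_w (g (Y w))%:E * \int[P]_w (h (Z w))%:E)%E.
Proof.
move=> mY mZ; exact: (@ge0_expectM_mfun _ _ _ _ (mfun_Sub (mem_set mY : Y \in mfun))
  (mfun_Sub (mem_set mZ : Z \in mfun))).
Qed.

Lemma ge0_expect_idist_mfun d1 (T1 : measurableType d1) (Y Z : {mfun T >-> T1}) (g : T1 -> R) :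
  (forall A, measurable A -> P (Y @^-1` A) = P (Z @^-1` A)) ->
  measurable_fun setT g -> (forall x, 0 <= g x) ->
  (\int[P]_w (g (Y w))%:E = \int[P]_w (g (Z w))%:E)%E.
Proof.
move=> iYZ mg g0; have mgE := measurable_funT_EFin mg.
have -> : (\int[P]_w (g (Y w))%:E = \int[distribution P Y]_z (g z)%:E)%E.
  by rewrite ge0_integral_distribution// => y; rewrite lee_fin.
have -> : (\int[P]_w (g (Z w))%:E = \int[distribution P Z]_z (g z)%:E)%E.
  by rewrite ge0_integral_distribution// => y; rewrite lee_fin.
by apply: eq_measure_integral => A mA _; exact: iYZ.
Qed.

Lemma ge0_expect_idist (Y Z : T -> R) (g : R -> R) :
  measurable_fun setT Y -> measurable_fun setT Z ->
  (forall A : set R, measurable A -> P (Y @^-1` A) = P (Z @^-1` A)) ->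
  measurable_fun setT g -> (forall x, 0 <= g x) ->
  (\int[P]_w (g (Y w))%:E = \int[P]_w (g (Z w))%:E)%E.
Proof.
move=> mY mZ; exact: (@ge0_expect_idist_mfun _ _ (mfun_Sub (mem_set mY : Y \in mfun))
  (mfun_Sub (mem_set mZ : Z \in mfun))).
Qed.

End independence.

(** * Averages along a subsequence *)

Section interpolation.
Context {R : realType}.

Local Notation msub k := (k.+1 * k.+2)%N.

Lemma cvg_ratio_msub : (fun k : nat => k.+1%:R / k.+3%:R : R) @ \oo --> (1 : R).
Proof.
have -> : (fun k : nat => k.+1%:R / k.+3%:R : R) = (fun k => 1 - 2 * (k.+3%:R)^-1).
  apply/funext => k; rewrite (_ : k.+1%:R = k.+3%:R - 2 :> R); last first.
    by rewrite -[k.+3]addn2 natrD addrK.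
  by rewrite mulrBl divff ?pnatr_eq0.
rewrite -[X in _ --> X]subr0; apply: cvgB; first exact: cvg_cst.
rewrite -(mulr0 2); apply: cvgM; first exact: cvg_cst.
have := @cvg_harmonic R; rewrite -(cvg_shiftn 2) /=; apply: cvg_trans.
by apply: near_eq_cvg; near=> n; rewrite addn2.
Unshelve. all: by end_near. Qed.

(* Along [k.+1 * k.+2] the variances are summable and consecutive indices have ratio
   tending to [1]; monotonicity of [S] fills the gaps. *)
Lemma cvg_average_interp (S : nat -> R) (mu : R) :
  (forall n, 0 <= S n) -> (forall m n, (m <= n)%N -> S m <= S n) ->
  (fun k => S (msub k) / (msub k)%:R) @ \oo --> mu ->
  (fun m => S m / m%:R) @ \oo --> mu.
Proof.
move=> S0 Sle cS.
(* The factor [k.+1 / k.+3] is the ratio [msub k / msub k.+1]; multiplying or dividing by it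
   exchanges the two denominators. *)
have cL : (fun k => S (msub k) / (msub k)%:R * (k.+1%:R / k.+3%:R)) @ \oo --> mu.
  by rewrite -[X in _ --> X]mulr1; apply: cvgM => //; exact: cvg_ratio_msub.
have cU : (fun k => S (msub k.+1) / (msub k.+1)%:R * (k.+1%:R / k.+3%:R)^-1) @ \oo --> mu.
  rewrite -[X in _ --> X]mulr1; apply: cvgM.
    by have := cS; rewrite -(cvg_shiftn 1) /=; apply: cvg_trans; apply: near_eq_cvg; near=> n; rewrite addn1.
  by rewrite -[X in _ --> X]invr1; apply: cvgV => //; exact: cvg_ratio_msub.
apply/cvgrPdist_le => e e0.
move/cvgrPdist_le : cL => /(_ _ e0) [K1 _ HL].
move/cvgrPdist_le : cU => /(_ _ e0) [K2 _ HU].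
pose K := maxn K1 K2.
have ex m : (msub K <= m)%N -> exists2 k, (K <= k)%N & (msub k <= m < msub k.+1)%N.
  elim: m => [|m IH]; first by rewrite leqn0.
  rewrite leq_eqVlt => /orP[/eqP <-|].
    by exists K => //; rewrite leqnn/= ltn_mul.
  rewrite ltnS => /IH [k Kk /andP[k1]]; rewrite leq_eqVlt => /orP[/eqP k2|k2].
    by exists k.+1; [exact: leqW|rewrite k2 leqnn/= ltn_mul].
  by exists k => //; rewrite k2 (leq_trans k1).
exists (msub K) => // m /= /ex[k Kk /andP[km mk]].
have k1 : (K1 <= k)%N by rewrite (leq_trans _ Kk)// leq_maxl.
have k2 : (K2 <= k)%N by rewrite (leq_trans _ Kk)// leq_maxr.
have := HL _ k1; have := HU _ k2 => /=.
have m0 : (0 < m)%N by rewrite (leq_trans _ km).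
have mR : 0 < m%:R :> R by rewrite ltr0n.
have p1 : 0 < k.+1%:R :> R by rewrite ltr0n.
have p2 : 0 < k.+2%:R :> R by rewrite ltr0n.
have p3 : 0 < k.+3%:R :> R by rewrite ltr0n.
have -> : S (msub k.+1) / (msub k.+1)%:R * (k.+1%:R / k.+3%:R)^-1 = S (msub k.+1) / (msub k)%:R.
  by rewrite !natrM; field; rewrite !gt_eqF.
have -> : S (msub k) / (msub k)%:R * (k.+1%:R / k.+3%:R) = S (msub k) / (msub k.+1)%:R.
  by rewrite !natrM; field; rewrite !gt_eqF.
have lo : S (msub k) / (msub k.+1)%:R <= S m / m%:R.
  by rewrite ler_pM ?invr_ge0// ?Sle// lef_pV2 ?posrE// ?ltr0n// ler_nat ltnW.
have up : S m / m%:R <= S (msub k.+1) / (msub k)%:R.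
  by rewrite ler_pM ?invr_ge0// ?Sle ?(ltnW mk)// lef_pV2 ?posrE// ?ltr0n// ler_nat.
move: (S m / m%:R) (S (msub k.+1) / (msub k)%:R) (S (msub k) / (msub k.+1)%:R) lo up => a b c lo up.
rewrite !ler_distl => /andP[h1 _] /andP[_ h2]; apply/andP; split; lra.
Unshelve. all: by end_near. Qed.

Lemma sum_inv_msub (N : nat) : \sum_(k < N) ((msub k)%:R)^-1 = 1 - (N.+1%:R)^-1 :> R.
Proof.
elim: N => [|N IH]; first by rewrite big_ord0 invr1 subrr.
rewrite big_ord_recr/= IH natrM -[N.+2]addn1 natrD.
have : 0 < N.+1%:R :> R by rewrite ltr0n.
by move: N.+1%:R => x x0; field; rewrite !gt_eqF ?addr_gt0.
Qed.

End interpolation.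

(** * The strong law for nonnegative functions and for powers *)

Section slln.
Context {R : realType} d (T : measurableType d) (P : probability T R).
Context (X : T -> R) (Xs : nat -> T -> R).
Hypothesis mX : measurable_fun setT X.
Hypothesis mXs : forall i, measurable_fun setT (Xs i).
Hypothesis indep : mutually_independent P Xs.
Hypothesis idist : identically_distributed_as P Xs X.

Lemma mutually_independent2 i j : i != j -> indep2 P (Xs i) (Xs j).
Proof.
move=> ij A B mA mB.
pose F l := if l == i then A else B.
have Fi : F i = A by rewrite /F eqxx.
have Fj : F j = B by rewrite /F eq_sym (negbTE ij).
have := @indep [:: i; j] F; rewrite /= inE ij => /(_ isT).
have mF l : l \in [:: i; j] -> measurable (F l) by move=> _; rewrite /F; case: ifP.
move=> /(_ mF); rewrite !big_cons big_nil mule1 Fi Fj => <-; congr (P _).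
apply/seteqP; split => w /=.
  by move=> [wi wj] l /=; rewrite !inE => /orP[/eqP->|/eqP->]; rewrite ?Fi ?Fj.
move=> H; split.
  by have := H i; rewrite /= inE eqxx Fi; apply.
by have := H j; rewrite /= !inE eqxx orbT Fj; apply.
Qed.

Section nonneg.
Variable g : R -> R.
Hypothesis mg : measurable_fun setT g.
Hypothesis g0 : forall x, 0 <= g x.
Hypothesis ig : P.-integrable setT (fun w => (g (X w) ^+ 2)%:E).
Let mu := \int[P]_w g (X w).
Let s2 := \int[P]_w (g (X w) ^+ 2).
Let Y i w := g (Xs i w).

Let mY i : measurable_fun setT (Y i). Proof. exact: measurableT_comp. Qed.
Let mgX : measurable_fun setT (fun w => g (X w)). Proof. exact: measurableT_comp. Qed.
Let mg2 : measurable_fun setT (fun x => g x ^+ 2). Proof. exact: measurable_funX. Qed.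
Let Y0 i w : 0 <= Y i w. Proof. exact: g0. Qed.

Let igX : P.-integrable setT (fun w => (g (X w))%:E).
Proof.
have i1 : P.-integrable setT (fun w : T => (1 : R)%:E) by exact: finite_measure_integrable_cst.
apply: (integrable_dom mgX (integrableDE i1 ig)) => w.
by rewrite ger0_norm//; have := sqr_ge0 (g (X w) - 1); nra.
Qed.

Lemma integral_sample i : (\int[P]_w (Y i w)%:E = mu%:E)%E.
Proof.
by rewrite (ge0_expect_idist (mXs i) mX (idist i) mg g0) RintE.
Qed.

Lemma integral_sample_sqr i : (\int[P]_w (Y i w * Y i w)%:E = s2%:E)%E.
Proof.
rewrite -(RintE ig) -(ge0_expect_idist (mXs i) mX (idist i) mg2) //.
by move=> x; exact: sqr_ge0.
Qed.

Lemma integral_sample2 i j : i != j -> (\int[P]_w (Y i w * Y j w)%:E = (mu * mu)%:E)%E.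
Proof.
move=> ij; rewrite (ge0_expectM (mXs i) (mXs j) (mutually_independent2 ij))//.
by rewrite !integral_sample.
Qed.

Lemma integrable_sample2 i j : P.-integrable setT (fun w => (Y i w * Y j w)%:E).
Proof.
apply/integrableP; split; first by apply: measurable_funT_EFin; exact: measurable_funM.
under eq_integral do rewrite gee0_abs ?lee_fin ?mulr_ge0//.
by have [->|ij] := eqVneq i j; rewrite ?integral_sample_sqr ?integral_sample2// ltry.
Qed.

Lemma integrable_sample i : P.-integrable setT (fun w => (Y i w)%:E).
Proof.
apply/integrableP; split; first exact: measurable_funT_EFin.
under eq_integral do rewrite gee0_abs ?lee_fin//.
by rewrite integral_sample ltry.
Qed.

Lemma integral_centered i j :
  P.-integrable setT (fun w => ((Y i w - mu) * (Y j w - mu))%:E) /\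
  (\int[P]_w ((Y i w - mu) * (Y j w - mu))%:E = (if i == j then s2 - mu ^+ 2 else 0)%:E)%E.
Proof.
have iij := integrable_sample2 i j.
have ii := integrableZ (- mu) (integrable_sample i).
have ij := integrableZ (- mu) (integrable_sample j).
have i1 : P.-integrable setT (fun w : T => (mu ^+ 2)%:E) by exact: finite_measure_integrable_cst.
have j1 := integrableDE ij i1; have j2 := integrableDE ii j1; have j3 := integrableDE iij j2.
have e : (fun w => ((Y i w - mu) * (Y j w - mu))%:E) =
  (fun w => (Y i w * Y j w + (- mu * Y i w + (- mu * Y j w + mu ^+ 2)))%:E).
  by apply/funext => w; congr EFin; ring.
rewrite e; split => //; rewrite RintE//.
have Ri k : \int[P]_w Y k w = mu by rewrite /Rintegral integral_sample.
rewrite RintegralD// RintegralD// RintegralD//.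
rewrite [\int[P]_w (- mu * Y i w)]RintegralZl//; last exact: integrable_sample.
rewrite [\int[P]_w (- mu * Y j w)]RintegralZl//; last exact: integrable_sample.
rewrite !Ri Rintegral_cstP; congr EFin; case: eqVneq => [->|nij].
  have -> : \int[P]_w (Y j w * Y j w) = s2 by rewrite /Rintegral integral_sample_sqr.
  by ring.
have -> : \int[P]_w (Y i w * Y j w) = mu * mu by rewrite /Rintegral integral_sample2.
by ring.
Qed.

Lemma variance_sample_ge0 : 0 <= s2 - mu ^+ 2.
Proof.
have [_] := integral_centered 0 0; rewrite eqxx => h; rewrite -lee_fin -h.
by apply: integral_ge0 => w _; rewrite lee_fin -expr2 sqr_ge0.
Qed.

Lemma integral_sum_sqr n :
  (\int[P]_w ((\sum_(i < n) Y i w - n%:R * mu) ^+ 2)%:E = (n%:R * (s2 - mu ^+ 2))%:E)%E.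
Proof.
have -> : (fun w => ((\sum_(i < n) Y i w - n%:R * mu) ^+ 2)%:E) =
  (fun w => \sum_(i < n) \sum_(j < n) ((Y i w - mu) * (Y j w - mu))%:E)%E.
  apply/funext => w.
  under [RHS]eq_bigr do rewrite sumEFin.
  rewrite sumEFin; congr EFin.
  have -> : \sum_(i < n) Y i w - n%:R * mu = \sum_(i < n) (Y i w - mu).
    by rewrite sumrB sumr_const card_ord mulr_natl.
  by rewrite expr2 big_distrlr.
rewrite integral_sum//; last first.
  by move=> i; apply: integrable_sum => // j _; exact: (integral_centered i j).1.
under eq_bigr => i _.
  rewrite integral_sum//; last by move=> j; exact: (integral_centered i j).1.
  under eq_bigr do rewrite (integral_centered _ _).2.
  rewrite sumEFin (bigD1 i)//= eqxx big1 ?addr0; last first.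
    by move=> j; rewrite eq_sym -val_eqE => /negbTE /= ->.
  over.
by rewrite sumEFin sumr_const card_ord mulr_natl.
Qed.

(** Along the subsequence the squared deviations have summable expectations, so their series is
    integrable, hence finite almost surely, and its terms tend to 0. Nonnegative summands make the
    partial sums monotone, as the interpolation requires. *)
Lemma slln_ge0 : {ae P, forall w, (fun m : nat => (\sum_(i < m) Y i w) / m%:R) @ \oo --> mu}.
Proof.
pose N k := (k.+1 * k.+2)%N.
have N0 k : 0 < (N k)%:R :> R by rewrite ltr0n.
pose v := s2 - mu ^+ 2; have v0 : 0 <= v by exact: variance_sample_ge0.
pose h k w : R := ((\sum_(i < N k) Y i w) / (N k)%:R - mu) ^+ 2.
have mS n : measurable_fun setT (fun w => \sum_(i < n) Y i w) by exact: measurable_sum.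
have mh k : measurable_fun setT (fun w => (h k w)%:E).
  apply: measurable_funT_EFin; apply: measurable_funX; apply: measurable_funB => //.
  exact: measurable_funM.
have h0 k w : (0 <= (h k w)%:E)%E by rewrite lee_fin sqr_ge0.
have ih k : (\int[P]_w (h k w)%:E = (v * ((N k)%:R)^-1)%:E)%E.
  transitivity (\int[P]_w (((N k)%:R ^- 2)%:E * ((\sum_(i < N k) Y i w - (N k)%:R * mu) ^+ 2)%:E))%E.
    apply: eq_integral => w _; rewrite -EFinM /h; congr EFin.
    by move: (\sum_(_ < _) _) (N k)%:R (N0 k) => S n n0; field; rewrite gt_eqF.
  rewrite ge0_integralZl//.
  - rewrite integral_sum_sqr -EFinM -/v; congr EFin.
    by move: (N k)%:R (N0 k) => n n0; field; rewrite gt_eqF.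
  - apply: measurable_funT_EFin; apply: measurable_funX; exact: measurable_funB.
  - by move=> w _; rewrite lee_fin sqr_ge0.
have sumh : (\int[P]_w (\sum_(k <oo) (h k w)%:E) < +oo)%E.
  rewrite integral_nneseries//.
  apply: (@le_lt_trans _ _ v%:E); last exact: ltry.
  apply: lime_le; first by apply: is_cvg_nneseries => k _ _; rewrite integral_ge0.
  near=> n; under eq_bigr do rewrite ih.
  rewrite sumEFin lee_fin -mulr_sumr big_mkord sum_inv_msub.
  by rewrite ler_piMr// gerBl invr_ge0.
have mser : measurable_fun setT (fun w => \sum_(k <oo) (h k w)%:E)%E.
  by apply: ge0_emeasurable_sum.
have iser : P.-integrable setT (fun w => \sum_(k <oo) (h k w)%:E)%E.
  apply/integrableP; split => //.
  by under eq_integral do rewrite gee0_abs ?nneseries_ge0//.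
have := integrable_ae measurableT iser.
apply: filterS => w /(_ I) fin.
apply: cvg_average_interp.
- by move=> n; apply: sumr_ge0.
- move=> m n mn; rewrite -(big_mkord xpredT (fun i => Y i w)) -(big_mkord xpredT (fun i => Y i w)).
  by rewrite [leRHS](@big_cat_nat _ _ _ m)//= lerDl sumr_ge0.
have cs : cvgn (series (fun k => h k w)).
  apply: nondecreasing_is_cvgn.
    apply/nondecreasing_seqP => n; rewrite /series/= big_nat_recr//= lerDl.
    by rewrite -lee_fin.
  exists (fine (\sum_(k <oo) (h k w)%:E)%E) => _ [n _ <-].
  rewrite -lee_fin fineK// /series/= -sumEFin.
  by apply: nneseries_lim_ge => k _ _.
have c0 := cvg_series_cvg_0 cs.
suff : (fun k => (\sum_(i < N k) Y i w) / (N k)%:R - mu) @ \oo --> 0.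
  move=> c; rewrite -[X in _ --> X]add0r.
  rewrite (_ : (fun k => _) = (fun k => (\sum_(i < N k) Y i w) / (N k)%:R - mu + mu)).
    by apply: cvgD => //; exact: cvg_cst.
  by apply/funext => k; rewrite subrK.
apply/norm_cvg0P; rewrite -[X in _ --> X](sqrtr0 R).
rewrite (_ : (fun k => `|_|) = (fun k => Num.sqrt (h k w))).
  by apply: continuous_cvg => //; exact: sqrt_continuous.
by apply/funext => k; rewrite /h sqrtr_sqr.
Unshelve. all: by end_near. Qed.

End nonneg.

Hypothesis hm : forall k, P.-integrable setT (fun w => (`|X w| ^+ k)%:E).

(** The positive and negative parts of [x^k] are treated separately to meet the sign condition of
    [slln_ge0]; their squares are integrable by the moment of order [2 k]. *)
Lemma slln_moment k : {ae P, forall w,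
  (fun m : nat => (\sum_(i < m) Xs i w ^+ k) / m%:R) @ \oo --> \int[P]_w (X w ^+ k)}.
Proof.
pose g1 (x : R) := Num.max (x ^+ k) 0; pose g2 (x : R) := Num.max (- x ^+ k) 0.
have gE x : x ^+ k = g1 x - g2 x.
  rewrite /g1 /g2; have [h|h] := leP (x ^+ k) 0.
    by rewrite max_l ?oppr_ge0// sub0r opprK.
  by rewrite max_r ?subr0// oppr_le0 ltW.
have mk : measurable_fun setT (fun x : R => x ^+ k) by exact: measurable_funX.
have m1 : measurable_fun setT g1 by apply: measurable_maxr.
have m2 : measurable_fun setT g2 by apply: measurable_maxr => //; exact: measurableT_comp.
have g10 x : 0 <= g1 x by rewrite le_max lexx orbT.
have g20 x : 0 <= g2 x by rewrite le_max lexx orbT.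
have g1le x : g1 x <= `|x ^+ k| by rewrite ge_max ler_norm normr_ge0.
have g2le x : g2 x <= `|x ^+ k| by rewrite ge_max -normrN ler_norm normr_ge0.
have i2 (g : R -> R) : measurable_fun setT g -> (forall x, 0 <= g x) ->
    (forall x, g x <= `|x ^+ k|) -> P.-integrable setT (fun w => (g (X w) ^+ 2)%:E).
  move=> mg g0 gle; apply: (integrable_dom _ (hm (k * 2))).
    by apply: measurable_funX; exact: measurableT_comp.
  by move=> w; rewrite normrX (ger0_norm (g0 _)) exprM -normrX ler_sqr ?nnegrE.
have i1 (g : R -> R) : measurable_fun setT g -> (forall x, 0 <= g x) ->
    (forall x, g x <= `|x ^+ k|) -> P.-integrable setT (fun w => (g (X w))%:E).
  move=> mg g0 gle; apply: (integrable_dom _ (hm k)); first exact: measurableT_comp.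
  by move=> w; rewrite (ger0_norm (g0 _)) -normrX.
have s1 := slln_ge0 m1 g10 (i2 _ m1 g10 g1le).
have s2 := slln_ge0 m2 g20 (i2 _ m2 g20 g2le).
apply: filterS2 s1 s2 => w c1 c2.
have -> : \int[P]_w (X w ^+ k) = \int[P]_w g1 (X w) - \int[P]_w g2 (X w).
  rewrite -RintegralB//; [|exact: i1|exact: i1].
  by apply: eq_Rintegral => x _; rewrite gE.
rewrite (_ : (fun m : nat => _) = (fun m : nat => (\sum_(i < m) g1 (Xs i w)) / m%:R - (\sum_(i < m) g2 (Xs i w)) / m%:R)).
  exact: cvgB.
by apply/funext => m; rewrite -mulrBl -sumrB; congr (_ / _); apply: eq_bigr => i _; rewrite gE.
Qed.

Lemma slln_moments : {ae P, forall w, forall k,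
  (fun m : nat => (\sum_(i < m) Xs i w ^+ k) / m%:R) @ \oo --> \int[P]_w (X w ^+ k)}.
Proof. by apply/ae_foralln => k; exact: slln_moment. Qed.

End slln.

(** * The estimation error as a quadratic form in the moments *)

Section quadratic.
Context {R : realType}.

Lemma cvg_sumr (T : Type) (F : set_system T) {FF : Filter F} (I : Type) (s : seq I)
    (f : I -> T -> R) (l : I -> R) : (forall i, f i x @[x --> F] --> l i) ->
  (\sum_(i <- s) f i x) @[x --> F] --> \sum_(i <- s) l i.
Proof. by move=> fl; apply: cvg_big => // x; exact: add_continuous. Qed.

Definition qform n (G : 'I_n -> 'I_n -> R) (v : 'rV[R]_n) : R :=
  \sum_i \sum_j v 0 i * v 0 j * G i j.

Lemma continuous_qform n (G : 'I_n -> 'I_n -> R) : continuous (qform G).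
Proof.
apply: continuous_big => [|i _]; first exact: add_continuous.
apply: continuous_big => [|j _ v]; first exact: add_continuous.
exact: (cvgM (cvgM (@coord_continuous _ _ _ 0 i v) (@coord_continuous _ _ _ 0 j v)) (cvg_cst (G i j))).
Qed.

Lemma qformZ n (G : 'I_n -> 'I_n -> R) (k : R) v : qform G (k *: v) = k ^+ 2 * qform G v.
Proof.
rewrite /qform big_distrr/=; apply: eq_bigr => i _; rewrite big_distrr/=; apply: eq_bigr => j _.
by rewrite !mxE; ring.
Qed.

Lemma qform0 n (G : 'I_n -> 'I_n -> R) : qform G 0 = 0.
Proof. by rewrite /qform big1// => i _; rewrite big1// => j _; rewrite mxE !mul0r. Qed.

Lemma sum_sqr0 n : \sum_i (0 : 'rV[R]_n) 0 i ^+ 2 = 0.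
Proof. by rewrite big1// => i _; rewrite mxE expr0n. Qed.

(** By compactness the form attains a positive minimum on the unit sphere of the sup norm, and
    homogeneity extends the bound to all vectors. *)
Lemma posdef_lb n (G : 'I_n -> 'I_n -> R) : (forall v, v != 0 -> 0 < qform G v) ->
  exists2 c : R, 0 < c & forall v : 'rV[R]_n, c * \sum_i v 0 i ^+ 2 <= qform G v.
Proof.
move=> pd; pose A : set 'rV[R]_n := [set v | `|v| = 1].
have sumle (v : 'rV[R]_n) : \sum_i v 0 i ^+ 2 <= n%:R * `|v| ^+ 2.
  apply: (@le_trans _ _ (\sum_(i < n) `|v| ^+ 2)); last first.
    by rewrite sumr_const card_ord mulr_natl.
  apply: ler_sum => i _; rewrite -[v 0 i ^+ 2]ger0_norm ?sqr_ge0// normrX.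
  rewrite ler_sqr ?nnegrE// /Num.Def.normr/= mx_normrE.
  exact: (le_bigmax _ (fun ij => `|v ij.1 ij.2|) (0, i)).
have scale (v : 'rV[R]_n) : v != 0 -> A (`|v|^-1 *: v).
  move=> v0; rewrite /A/= normrZ normfV normr_id mulVf// normr_eq0//.
(* An empty sphere leaves only [v = 0]. *)
have [[v0 Av0]|A0] := pselect (A !=set0); last first.
  exists 1 => // v; have [->|v0] := eqVneq v 0; last by exfalso; apply: A0; exists (`|v|^-1 *: v); exact: scale.
  by rewrite qform0 sum_sqr0 mulr0.
have cA : compact A.
  apply: bounded_closed_compact.
    by exists 1; split => // M M1 v Av; apply: le_trans (ltW M1); rewrite le_eqVlt; apply/orP; left; apply/eqP; exact: Av.
  rewrite (_ : A = (fun v : 'rV[R]_n => `|v|) @^-1` [set 1])//.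
  by apply: closed_comp; [move=> v _; exact: norm_continuous|exact: closed_eq].
have [] := @EVT_min_rV R n (qform G) A _ cA; first by exists v0.
  by apply: continuous_subspaceT; exact: continuous_qform.
move=> w /set_mem Aw wmin; have w0 : w != 0 by rewrite -normr_eq0 Aw oner_neq0.
have m0 := pd _ w0; exists (qform G w / (n%:R + 1)).
  by rewrite divr_gt0// ltr_wpDl.
move=> v; have [->|vn0] := eqVneq v 0.
  by rewrite qform0 sum_sqr0 mulr0.
have := wmin _ (mem_set (scale _ vn0)); rewrite qformZ => h.
have nv : 0 < `|v| by rewrite normr_gt0.
apply: (@le_trans _ _ (qform G w * `|v| ^+ 2)).
  rewrite -mulrA ler_pM2l// mulrC ler_pdivrMr ?ltr_wpDl//.
  apply: (le_trans (sumle v)); rewrite mulrC ler_wpM2l ?sqr_ge0//; lra.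
move: h; rewrite exprVn ler_pdivlMl ?exprn_gt0//; by rewrite mulrC.
Qed.

End quadratic.

(** * Hankel forms of the moments of a density *)

Section hankel.
Context {R : realType}.
Local Notation leb := (@lebesgue_measure R).
Variable p : R -> R.
Hypothesis mp : measurable_fun setT p.
Hypothesis p0 : forall y, 0 <= p y.
Hypothesis ip : forall k, leb.-integrable setT (fun y => (y ^+ k * p y)%:E).
Hypothesis p1 : (0 < \int[leb]_y (p y)%:E)%E.

Definition wmom (k : nat) : R := \int[leb]_y (y ^+ k * p y).

Lemma wmom_form n (a b : 'I_n -> R) :
  \sum_i \sum_j a i * b j * wmom (i + j) =
    \int[leb]_y ((\sum_i a i * y ^+ i) * (\sum_i b i * y ^+ i) * p y) /\
  leb.-integrable setT (fun y => ((\sum_i a i * y ^+ i) * (\sum_i b i * y ^+ i) * p y)%:E).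
Proof.
have e : (fun y : R => ((\sum_i a i * y ^+ i) * (\sum_i b i * y ^+ i) * p y)%:E) =
  (fun y => \sum_i \sum_j (a i * b j * (y ^+ (i + j) * p y))%:E)%E.
  apply/funext => y; under [RHS]eq_bigr do rewrite sumEFin.
  rewrite sumEFin; congr EFin.
  rewrite big_distrlr/= big_distrl/=; apply: eq_bigr => i _.
  by rewrite big_distrl/=; apply: eq_bigr => j _; rewrite exprD; ring.
have ij i j : leb.-integrable setT (fun y => (a i * b j * (y ^+ (i + j) * p y))%:E).
  exact: (@integrableZ _ (measurableTypeR R) R leb).
have is_ : leb.-integrable setT (fun y : R => (\sum_i \sum_j (a i * b j * (y ^+ (i + j) * p y))%:E)%E).
  by apply: integrable_sum => // i _; apply: integrable_sum.
split; last by rewrite e.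
apply: EFin_inj; rewrite -RintE; last by rewrite e.
rewrite e integral_sum//; last by move=> i; apply: integrable_sum.
rewrite -sumEFin; apply: eq_bigr => i _; rewrite integral_sum// -sumEFin; apply: eq_bigr => j _.
by rewrite RintE// [in RHS]RintegralZl//; exact: ip.
Qed.

(** The form is the integral of [q^2 * p] for the polynomial [q] with coefficients [v]. If it
    vanished, [p] would vanish almost everywhere outside the finitely many roots of [q], against its
    positive mass. *)
Lemma hankel_posdef n (v : 'rV[R]_n) : v != 0 -> 0 < qform (fun i j => wmom (i + j)) v.
Proof.
move=> v0; have [e iv] := wmom_form (v 0) (v 0); rewrite /qform e.
rewrite lt_neqAle Rintegral_ge0 ?andbT; last by move=> y _; rewrite mulr_ge0// -expr2 sqr_ge0.
apply/negP => /eqP/esym h.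
pose q := rVpoly v.
have qE y : \sum_i v 0 i * y ^+ i = q.[y].
  by rewrite horner_poly; apply: eq_bigr => i _; rewrite valK.
have q0 : q != 0 by apply: contraNneq v0 => q0; rewrite -(rVpolyK v) -/q q0 linear0.
have mq : measurable_fun setT (fun y : R => (q.[y] ^+ 2 * p y)%:E).
  apply: measurable_funT_EFin; apply: measurable_funM => //.
  by apply: measurable_funX; exact: measurable_horner.
have pos y : 0 <= q.[y] ^+ 2 * p y by rewrite mulr_ge0// sqr_ge0.
have z : (\int[leb]_(y in setT) `|(q.[y] ^+ 2 * p y)%:E| = 0)%E.
  transitivity (\int[leb]_y ((\sum_i v 0 i * y ^+ i) * (\sum_i v 0 i * y ^+ i) * p y)%:E)%E.
    by apply: eq_integral => y _; rewrite qE gee0_abs ?lee_fin.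
  by rewrite RintE// h.
have := (ae_eq_integral_abs leb measurableT mq).1 z.
move=> ae1.
have fin : finite_set [set y : R | root q y].
  apply: contrapT => /(infinite_set_fset (size q)) [B BA sB].
  have := max_poly_roots q0 (rs := finmap.enum_fset B).
  rewrite finmap.fset_uniq => H; have : (size (finmap.enum_fset B) < size q)%N.
    by apply: H => //; apply/allP => y yB; exact: (BA y).
  by rewrite ltnNge sB.
have ae2 : {ae leb, forall y, ~ root q y}.
  exists [set y : R | root q y]; split.
  - by apply: countable_measurable => //; exact: finite_set_countable.
  - by apply: countable_lebesgue_measure0; exact: finite_set_countable.
  - by move=> y /= /contrapT.
have ae3 : ae_eq leb setT (fun y => (p y)%:E) (cst 0%E).
  apply: (@filterS2 _ _ (ae_filter_ringOfSetsType leb) _ _ _ _ ae1 ae2) => y /(_ I) + ry _ /=.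
  move=> [/eqP]; rewrite mulf_eq0 sqrf_eq0 => /orP[/eqP qy|/eqP -> //].
  by exfalso; apply: ry; apply/rootP.
have : (\int[leb]_y (p y)%:E = 0)%E.
  have := @ae_eq_integral _ _ R leb setT (cst 0%E) _ measurableT (measurable_funT_EFin mp) (measurable_cst _) ae3.
  by rewrite integral0.
by move=> p_0; move: p1; rewrite p_0 ltxx.
Qed.

Lemma hankel_lb n : exists2 c : R, 0 < c & forall v : 'I_n -> R,
  c * \sum_i v i ^+ 2 <= \sum_i \sum_j v i * v j * wmom (i + j).
Proof.
have [c c0 H] := posdef_lb (@hankel_posdef n).
exists c => // v; have := H (\row_i v i); rewrite /qform.
under eq_bigr do rewrite mxE; under [X in _ <= X]eq_bigr do under eq_bigr do rewrite !mxE.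
exact.
Qed.

End hankel.

(** * Quadratic forms of polynomials in the signal and the noise *)

Section bivariate.
Context {R : realType}.
Local Notation phi := (@normal_pdf R 0 1).
Local Notation leb := (@lebesgue_measure R).

Definition gam (k : nat) : R := wmom phi k.

Lemma gam1 : gam 1 = 0.
Proof. exact: integral_phi_id. Qed.

Lemma gam2 : gam 2 = 1.
Proof. exact: integral_phi_sqr. Qed.

Lemma gauss_form n (a : 'I_n -> R) :
  (\int[leb]_z (phi z * (\sum_i a i * z ^+ i) ^+ 2)%:E = (\sum_i \sum_j a i * a j * gam (i + j))%:E)%E.
Proof.
have [e ie] := wmom_form (@integrable_phiXs R) a a.
rewrite e -RintE//; apply: eq_integral => z _; congr EFin; rewrite -expr2 mulrC//.
Qed.

(** An expectation enters the moment argument through its values on polynomials; this treats the law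
    of [X] and the uniform law on a sample alike. *)
Definition has_moments (E : (R -> \bar R) -> \bar R) (M : nat -> R) : Prop :=
  forall (J : finType) (c : J -> R) (e : J -> nat),
    E (fun r => (\sum_j c j * r ^+ e j)%:E) = (\sum_j c j * M (e j))%:E.

Section forms.
Variable N : nat.
Local Notation I := ('I_N.+1 * 'I_N.+1)%type.

Definition bpoly (u : I -> R) (r z : R) : R := \sum_k u k * (r ^+ k.1 * z ^+ k.2).

(** The bilinear form [E [U V]] for the polynomials [U] and [V] in [(X, N)] with coefficients [u]
    and [v], where [X] has moments [M] and [N] is an independent standard Gaussian. *)
Definition qf (M : nat -> R) (u v : I -> R) : R :=
  \sum_(k : I * I) u k.1 * v k.2 * (M (k.1.1 + k.2.1)%N * gam (k.1.2 + k.2.2)).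

Lemma bpolyE u r z : bpoly u r z = \sum_j (\sum_i u (i, j) * r ^+ i) * z ^+ j.
Proof.
rewrite /bpoly (eq_bigr (fun k => u (k.1, k.2) * (r ^+ k.1 * z ^+ k.2))); last by case.
rewrite -(pair_bigA _ (fun i j => u (i, j) * (r ^+ i * z ^+ j)))/= exchange_big/=.
by apply: eq_bigr => j _; rewrite big_distrl/=; apply: eq_bigr => i _; rewrite mulrA.
Qed.

Lemma bpoly_inner u r :
  (\int[leb]_z (phi z * bpoly u r z ^+ 2)%:E =
   (\sum_(k : I * I) (u k.1 * u k.2 * gam (k.1.2 + k.2.2)) * r ^+ (k.1.1 + k.2.1))%:E)%E.
Proof.
have e : (fun z : R => (phi z * bpoly u r z ^+ 2)%:E) = (fun z => \sum_(k : I * I)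
    (u k.1 * u k.2 * r ^+ (k.1.1 + k.2.1) * (z ^+ (k.1.2 + k.2.2) * phi z))%:E)%E.
  apply/funext => z; rewrite sumEFin; congr EFin.
  rewrite /bpoly expr2 big_distrlr/= pair_bigA big_distrr/=; apply: eq_bigr => k _.
  by rewrite !exprD; ring.
have ik (k : I * I) : leb.-integrable setT (fun z : R =>
    (u k.1 * u k.2 * r ^+ (k.1.1 + k.2.1) * (z ^+ (k.1.2 + k.2.2) * phi z))%:E).
  by apply: (@integrableZ _ (measurableTypeR R) R leb); exact: integrable_phiXs.
rewrite e (@integral_sum _ (measurableTypeR R) R leb)// -sumEFin; apply: eq_bigr => k _.
rewrite RintE// RintegralZl//; last exact: integrable_phiXs.
by congr EFin; rewrite /gam /wmom; ring.
Qed.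

Lemma expect_bpoly E M u : has_moments E M ->
  E (fun r => \int[leb]_z (phi z * bpoly u r z ^+ 2)%:E)%E = (qf M u u)%:E.
Proof.
move=> hM; rewrite (_ : (fun r => _) = (fun r => (\sum_(k : I * I)
    (u k.1 * u k.2 * gam (k.1.2 + k.2.2)) * r ^+ (k.1.1 + k.2.1))%:E)); last first.
  by apply/funext => r; exact: bpoly_inner.
by rewrite hM; congr EFin; apply: eq_bigr => k _; ring.
Qed.

Lemma qfE2 M (u v : I -> R) : qf M (fun k => u k + v k) (fun k => u k + v k) =
  qf M u u + 2 * qf M u v + qf M v v.
Proof.
have sym : qf M u v = qf M v u.
  rewrite /qf (reindex (fun k : I * I => (k.2, k.1))); last first.
    by exists (fun k : I * I => (k.2, k.1)) => -[? ?].
  by apply: eq_bigr => -[k l] _ /=; rewrite addnC [(l.2 + _)%N]addnC; ring.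
rewrite mulr_natl mulr2n {2}sym /qf -!big_split/=; apply: eq_bigr => k _; ring.
Qed.

End forms.
End bivariate.

(** * Coefficients of the estimation error *)

Section coefficients.
Context {R : realType}.
Local Notation phi := (@normal_pdf R 0 1).
Local Notation leb := (@lebesgue_measure R).
Variable N : nat.
Local Notation I := ('I_N.+1 * 'I_N.+1)%type.

Definition sq2 (u : I -> R) : R := \sum_k u k ^+ 2.

Definition delta (i j : nat) (k : I) : R := ((k.1 == i :> nat) && (k.2 == j :> nat))%:R.

(* Coefficients of [q (g r + s z)] for [q y = \sum_(m <= n) d m * y ^+ m]. *)
Definition pcf (n : nat) (g s : R) (d : nat -> R) (k : I) : R :=
  if (k.1 + k.2 <= n)%N then d (k.1 + k.2)%N * 'C(k.1 + k.2, k.2)%:R * g ^+ k.1 * s ^+ k.2 else 0.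

Lemma bpolyD (u v : I -> R) r z : bpoly (fun k => u k + v k) r z = bpoly u r z + bpoly v r z.
Proof. by rewrite /bpoly -big_split; apply: eq_bigr => k _; rewrite mulrDl. Qed.

Lemma bpolyN (u : I -> R) r z : bpoly (fun k => - u k) r z = - bpoly u r z.
Proof. by rewrite /bpoly -sumrN; apply: eq_bigr => k _; rewrite mulNr. Qed.

Lemma sum_delta (i j : nat) (F : I -> R) : (i <= N)%N -> (j <= N)%N ->
  \sum_k delta i j k * F k = F (inord i, inord j).
Proof.
move=> iN jN; rewrite (bigD1 (inord i, inord j))//= big1 ?addr0.
  by rewrite /delta/= !inordK ?ltnS// !eqxx mul1r.
move=> [a b]; rewrite /delta/= => h.
case: eqP => [ai|_]; last by rewrite mul0r.
case: eqP => [bj|_]; last by rewrite mul0r.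
by move: h; rewrite -ai -bj !inord_val eqxx.
Qed.

Lemma bpoly_delta (i j : nat) r z : (i <= N)%N -> (j <= N)%N ->
  bpoly (delta i j) r z = r ^+ i * z ^+ j.
Proof. by move=> iN jN; rewrite /bpoly sum_delta//= !inordK. Qed.

Lemma bpoly_pcf n g s d r z : (n <= N)%N ->
  bpoly (pcf n g s d) r z = \sum_(m < n.+1) d m * (g * r + s * z) ^+ m.
Proof.
move=> nN; rewrite bpolyE.
pose F (m j : nat) := d m * 'C(m, j)%:R * (g * r) ^+ (m - j) * (s * z) ^+ j.
transitivity (\sum_(j < N.+1) \sum_(m < n.+1 | (j <= m)%N) F m j).
  apply: eq_bigr => j _; rewrite big_distrl/=.
  transitivity (\sum_(i < N.+1 | (i + j <= n)%N) F (i + j)%N j).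
    rewrite [RHS]big_mkcond/=; apply: eq_bigr => i _; rewrite /pcf/=; case: ifP => // _; last by rewrite !mul0r.
    by rewrite /F addnK !exprMn; ring.
  rewrite -(big_mkord (fun i => (i + j <= n)%N) (fun i => F (i + j)%N j)).
  rewrite -(big_mkord (fun m => (j <= m)%N) (fun m => F m j)).
  have -> : \sum_(0 <= i < N.+1 | (i + j <= n)%N) F (i + j)%N j = \sum_(0 <= i < n.+1 - j) F (i + j)%N j.
    rewrite [RHS](big_nat_widen _ _ N.+1) ?leq_subLR ?addnS ?ltnS ?(leq_trans nN) ?leq_addl//.
    by apply: eq_bigl => i; rewrite ltn_subRL addnC ltnS.
  rewrite -(big_nat_widenl _ _ _ xpredT)//.
  by rewrite -[in RHS](add0n (j : nat)) big_addn.
rewrite (exchange_big_dep xpredT)//=; apply: eq_bigr => m _.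
rewrite exprDn big_distrr/= -(big_mkord (fun j => (j <= m)%N) (fun j => F m j)).
rewrite -(big_mkord xpredT (fun j => d m * ((g * r) ^+ (m - j) * (s * z) ^+ j *+ 'C(m, j)))).
rewrite [RHS](big_nat_widen _ _ N.+1)/=; last by rewrite ltnS (leq_trans _ nN)// -ltnS.
by apply: eq_bigr => j _; rewrite /F -mulr_natr; ring.
Qed.

Lemma bpoly_err n g d r z : (n <= N)%N -> (0 < N)%N ->
  bpoly (fun k => delta 1 0 k - pcf n g 1 d k) r z = r - \sum_(m < n.+1) d m * (g * r + z) ^+ m.
Proof.
move=> nN N0; rewrite bpolyD bpolyN bpoly_delta// bpoly_pcf// expr1 expr0 mulr1.
by under eq_bigr do rewrite mul1r.
Qed.

Lemma pmmse_errE n E M (t : R) (c : 'I_n.+1 -> R) : has_moments E M -> (n <= N)%N -> (0 < N)%N ->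
  pmmse_err E t c = (qf M (fun k => delta 1 0 k - pcf n (Num.sqrt t) 1 (fun m => c (inord m)) k)
    (fun k => delta 1 0 k - pcf n (Num.sqrt t) 1 (fun m => c (inord m)) k))%:E.
Proof.
move=> hM nN N0; rewrite -(expect_bpoly _ hM) /pmmse_err; congr E; apply/funext => r.
apply: eq_integral => z _; rewrite bpoly_err//.
by do 5 f_equal; apply: eq_bigr => i _; rewrite inord_val.
Qed.

Lemma qfZ M (k : R) (u v : I -> R) : (forall i, u i = k * v i) -> qf M u u = k ^+ 2 * qf M v v.
Proof.
move=> uv; rewrite /qf big_distrr/=; apply: eq_bigr => i _; rewrite !uv; ring.
Qed.

(* [X - q (g X + N) = - g^-1 * (N - q' (X + g^-1 N))] for a polynomial [q'] of the same
   degree: estimating [X] amounts to estimating the noise. *)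
Lemma err_rescale n (g : R) d k : g != 0 -> (0 < n)%N ->
  delta 1 0 k - pcf n g 1 d k =
  - g^-1 * (delta 0 1 k + - pcf n 1 g^-1 (fun m => g * (m == 1)%:R - g * d m * g ^+ m) k).
Proof.
move=> g0 n0; rewrite /delta /pcf; case: k => [[i hi] [j hj]] /=.
case: leqP => [ijn|nij]; last first.
  move: i j {hi hj} nij => [|[|i]] [|[|j]]//=; rewrite ?(mulr0, subr0, addr0, oppr0)//.
  - by rewrite ltnNge n0.
  - by rewrite ltnNge n0.
have [ij1|ij1] := eqVneq (i + j)%N 1%N; last first.
  have -> : ((i == 1) && (j == 0))%N = false by move: i j ij1 {hi hj ijn} => [|[|i]] [|[|j]].
  have -> : ((i == 0) && (j == 1))%N = false by move: i j ij1 {hi hj ijn} => [|[|i]] [|[|j]].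
  rewrite !mulr0 !expr1n !mulr1 sub0r add0r exprD exprVn.
  have gj : g ^+ j != 0 by rewrite expf_neq0.
  by field; rewrite g0 gj.
move: i j ij1 {hi hj ijn} => [|[|i]] [|[|j]]//= _; rewrite ?bin0 ?binn ?expr0 ?expr1n !expr1; by field.
Qed.

Lemma qf_delta M (i j : nat) v : (i <= N)%N -> (j <= N)%N ->
  qf M (delta i j) v = \sum_l v l * (M (i + l.1)%N * gam (j + l.2)).
Proof.
move=> iN jN; rewrite /qf.
rewrite -(pair_bigA _ (fun k l => delta i j k * v l * (M (k.1 + l.1)%N * gam (k.2 + l.2))))/=.
under eq_bigr => k _ do (under eq_bigr do rewrite -mulrA; rewrite -big_distrr/=).
by rewrite sum_delta//=; apply: eq_bigr => l _; rewrite !inordK.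
Qed.

Lemma le_sq2 (u : I -> R) k : u k ^+ 2 <= sq2 u.
Proof. by rewrite /sq2 (bigD1 k)//= lerDl sumr_ge0// => l _; exact: sqr_ge0. Qed.

Lemma sq2_ge0 (u : I -> R) : 0 <= sq2 u.
Proof. by apply: sumr_ge0 => k _; exact: sqr_ge0. Qed.

Definition crossK (B : R) : R := \sum_(l : I) 'C(l.1 + l.2, l.2)%:R * B * `|gam (l.2).+1|.

(* The terms of [E (N * q' (X + s N))] without a factor [s] vanish because [E N = 0]. *)
Lemma qf_cross n M (s B : R) d : (n <= N)%N -> (0 < N)%N -> 0 <= s <= 1 ->
  (forall i, (i <= N)%N -> `|M i| <= B) ->
  `|qf M (delta 0 1) (pcf n 1 s d)| <= s * Num.sqrt (sq2 (pcf n 1 s d)) * crossK B.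
Proof.
move=> nN N0 /andP[s0 s1] MB; rewrite qf_delta//.
have B0 : 0 <= B by apply: le_trans (MB 0%N _).
set U := Num.sqrt _; have U0 : 0 <= U by exact: sqrtr_ge0.
(* With first scale [1] in [pcf], the coefficient at [(m, 0)] is [d m] itself. *)
have dU m : (m <= n)%N -> `|d m| <= U.
  move=> mn; rewrite -sqrtr_sqr ler_sqrt ?sq2_ge0//.
  have := le_sq2 (pcf n 1 s d) (inord m, ord0).
  by rewrite /pcf/= inordK ?ltnS ?(leq_trans mn)// addn0 mn bin0 expr1n expr0 !mulr1.
apply: le_trans (ler_norm_sum _ _ _) _; rewrite /crossK big_distrr/=.
apply: ler_sum => -[i j] _ /=; rewrite add0n add1n !normrM.
have [j0|j0] := posnP j.
  by rewrite j0 gam1 normr0 !mulr0.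
have -> : s * U * ('C(i + j, j)%:R * B * `|gam j.+1|) = (s * U * 'C(i + j, j)%:R) * (B * `|gam j.+1|).
  by ring.
apply: ler_pM => //; last by rewrite ler_wpM2r// MB// -ltnS ltn_ord.
rewrite /pcf/=; case: ifPn => ijn; last by rewrite normr0 !mulr_ge0.
rewrite expr1n mulr1 !normrM normr_nat normrX (ger0_norm s0).
rewrite mulrAC [s * _]mulrC; apply: ler_wpM2r => //; apply: ler_pM => //; [exact: exprn_ge0|exact: dU|].
by rewrite -(prednK j0) exprS ler_piMr// exprn_ile1.
Qed.

End coefficients.

(** * Moment functionals and perturbation of the forms *)

Section moments.
Context {R : realType}.
Local Notation phi := (@normal_pdf R 0 1).
Local Notation leb := (@lebesgue_measure R).

Lemma has_moments_unif (m : nat) (x : nat -> R) :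
  has_moments (unif_expect m x) (fun k => (\sum_(j < m) x j ^+ k) / m%:R).
Proof.
move=> J c e; rewrite /unif_expect sumEFin -EFinM; congr EFin.
rewrite exchange_big/= big_distrr/=; apply: eq_bigr => j _.
by rewrite -big_distrr/=; ring.
Qed.

Section rv.
Context d (T : measurableType d) (P : probability T R) (X : T -> R) (f : R -> R).
Hypothesis mX : measurable_fun setT X.
Hypothesis hm : forall k, P.-integrable setT (fun w => (`|X w| ^+ k)%:E).
Local Notation M := (fun k => \int[P]_w (X w ^+ k)).

Lemma integrable_pow k : P.-integrable setT (fun w => (X w ^+ k)%:E).
Proof.
apply: (integrable_dom _ (hm k)); first exact: measurable_funX.
by move=> w; rewrite normrX.
Qed.

Lemma has_moments_rv : has_moments (rv_expect P X) M.
Proof.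
move=> J c e; rewrite /rv_expect.
under eq_integral do rewrite -sumEFin.
have ij j : P.-integrable setT (fun w => (c j * X w ^+ e j)%:E).
  by apply: integrableZ; exact: integrable_pow.
rewrite integral_sum// -sumEFin; apply: eq_bigr => j _.
by rewrite RintE// RintegralZl//; exact: integrable_pow.
Qed.

Hypothesis dens : is_density P X f.

Lemma hankel_rv_lb n : exists2 c : R, 0 < c & forall v : 'I_n -> R,
  c * \sum_i v i ^+ 2 <= \sum_i \sum_j v i * v j * M (i + j)%N.
Proof.
have mf : measurable_fun setT f by case: dens.
have f0 x : 0 <= f x by case: dens => _ [].
have ifk k : leb.-integrable setT (fun y => (y ^+ k * f y)%:E).
  apply/integrableP; split.
    by apply: measurable_funT_EFin; apply: measurable_funM => //; exact: measurable_funX.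
  under eq_integral do rewrite abse_EFin normrM normrX (ger0_norm (f0 _)).
  have mh : measurable_fun setT (fun x : R => `|x| ^+ k).
    by apply: measurable_funX; exact: normr_measurable.
  rewrite -(ge0_expect_density mX dens mh); last by move=> x; exact: exprn_ge0.
  by rewrite RintE// ltry.
have f1 : (0 < \int[leb]_y (f y)%:E)%E by rewrite (integral_density mX dens).
have [c c0 H] := hankel_lb mf f0 ifk f1 n.
exists c => // v; apply: le_trans (H v) _.
have [-> iv] := wmom_form ifk v v.
pose h x := (\sum_i v i * x ^+ i) ^+ 2.
have mh : measurable_fun setT h.
  by apply: measurable_funX; apply: measurable_sum => i; apply: measurable_funM => //; exact: measurable_funX.
rewrite -lee_fin -RintE// (_ : (\int[leb]_x _)%E = (\int[leb]_x (h x * f x)%:E)%E); last first.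
  by apply: eq_integral => x _; rewrite /h expr2.
rewrite -(ge0_expect_density mX dens mh); last by move=> x; exact: sqr_ge0.
have -> : \sum_i \sum_j v i * v j * M (i + j)%N = \sum_(k : 'I_n * 'I_n) v k.1 * v k.2 * M (k.1 + k.2)%N.
  by rewrite pair_bigA.
rewrite -has_moments_rv /rv_expect le_eqVlt; apply/orP; left; apply/eqP.
apply: eq_integral => w _; congr EFin; rewrite /h expr2 big_distrlr/= pair_bigA.
by apply: eq_bigr => k _; rewrite exprD; ring.
Qed.

(* Two applications of the one-variable bound: first in [z] for fixed [r], then in [r]. *)
Lemma qf_rv_lb N : exists2 c : R, 0 < c & forall u : 'I_N.+1 * 'I_N.+1 -> R,
  c * sq2 u <= qf M u u.
Proof.
have p1 : (0 < \int[leb]_y (phi y)%:E)%E by rewrite integral_normal_pdf.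
have [c0 c00 H0] := hankel_lb (@measurable_phi R) (fun y => ltW (phi_gt0 y)) (@integrable_phiXs R) p1 N.+1.
have [c1 c10 H1] := hankel_rv_lb N.+1.
exists (c0 * c1); first exact: mulr_gt0.
move=> u.
pose G (r : R) := \sum_j (\sum_i u (i, j) * r ^+ i) ^+ 2.
have inner r : ((c0 * G r)%:E <= \int[leb]_z (phi z * bpoly u r z ^+ 2)%:E)%E.
  under eq_integral do rewrite bpolyE.
  by rewrite (gauss_form (fun j => \sum_i u (i, j) * r ^+ i)) lee_fin H0.
have GE : (\int[P]_w (G (X w))%:E =
    (\sum_j \sum_i \sum_k u (i, j) * u (k, j) * M (i + k)%N)%:E)%E.
  transitivity (rv_expect P X (fun r => (\sum_(l : 'I_N.+1 * ('I_N.+1 * 'I_N.+1))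
      (u (l.2.1, l.1) * u (l.2.2, l.1)) * r ^+ (l.2.1 + l.2.2))%:E)).
    apply: eq_integral => w _; congr EFin; rewrite /G.
    rewrite -(pair_bigA _ (fun j l => u (l.1, j) * u (l.2, j) * X w ^+ (l.1 + l.2)))/=.
    apply: eq_bigr => j _; rewrite expr2 big_distrlr/= pair_bigA; apply: eq_bigr => l _.
    by rewrite exprD; ring.
  rewrite has_moments_rv; congr EFin.
  rewrite -(pair_bigA _ (fun j l => u (l.1, j) * u (l.2, j) * M (l.1 + l.2)%N))/=.
  by apply: eq_bigr => j _; rewrite pair_bigA.
have mG : measurable_fun setT (fun w => (G (X w))%:E).
  apply: measurable_funT_EFin; apply: measurable_sum => j; apply: measurable_funX.
  by apply: measurable_sum => i; apply: measurable_funM => //; exact: measurable_funX.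
have G0 r : 0 <= G r by apply: sumr_ge0 => j _; exact: sqr_ge0.
rewrite -lee_fin -(expect_bpoly u has_moments_rv).
apply: (@le_trans _ _ (\int[P]_w (c0 * G (X w))%:E)%E).
  under eq_integral do rewrite EFinM.
  rewrite ge0_integralZl// ?lee_fin ?(ltW c00)//; last by move=> w _; rewrite lee_fin.
  rewrite GE -EFinM lee_fin -mulrA ler_pM2l//.
  rewrite /sq2 (eq_bigr (fun k => u (k.1, k.2) ^+ 2)); last by case.
  rewrite -(pair_bigA _ (fun i j => u (i, j) ^+ 2))/= exchange_big/= big_distrr/=.
  by apply: ler_sum => j _; exact: (H1 (fun i => u (i, j))).
apply: ge0_le_integral => //.
- by move=> w _; rewrite lee_fin mulr_ge0// ltW.
- by under eq_fun do rewrite EFinM; apply: measurable_funeM.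
- under eq_fun do rewrite bpoly_inner.
  apply: measurable_funT_EFin; apply: measurable_sum => k; apply: measurable_funM => //.
  exact: measurable_funX.
Qed.

End rv.

(** The product [|u k * u l|] is at most the mean of the two squares, hence at most [sq2 u]. *)
Lemma qf_perturb N (M M' : nat -> R) (u : 'I_N.+1 * 'I_N.+1 -> R) :
  `|qf M' u u - qf M u u| <= sq2 u * \sum_(k : ('I_N.+1 * 'I_N.+1) * ('I_N.+1 * 'I_N.+1))
     `|M' (k.1.1 + k.2.1)%N - M (k.1.1 + k.2.1)%N| * `|gam (k.1.2 + k.2.2)|.
Proof.
rewrite /qf -sumrB; apply: le_trans (ler_norm_sum _ _ _) _.
rewrite big_distrr/=; apply: ler_sum => k _.
rewrite -mulrBr -mulrBl !normrM; apply: ler_wpM2r; first exact: mulr_ge0.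
have h1 := le_sq2 u k.1; have h2 := le_sq2 u k.2.
have h3 := sqr_ge0 (`|u k.1| - `|u k.2|).
have e1 : `|u k.1| ^+ 2 = u k.1 ^+ 2 by rewrite real_normK ?num_real.
have e2 : `|u k.2| ^+ 2 = u k.2 ^+ 2 by rewrite real_normK ?num_real.
by move: h3; rewrite sqrrB e1 e2; lra.
Qed.

(** Positive definiteness turns an absolute perturbation, bounded by a small multiple of [sq2 u],
    into a relative one, uniformly in [u]. *)
Lemma qf_near N (M_ : nat -> nat -> R) (M : nat -> R) (c e : R) :
  (forall k, M_ ^~ k @ \oo --> M k) -> 0 < c ->
  (forall u : 'I_N.+1 * 'I_N.+1 -> R, c * sq2 u <= qf M u u) -> 0 < e ->
  \forall m \near \oo, forall u : 'I_N.+1 * 'I_N.+1 -> R,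
    `|qf (M_ m) u u - qf M u u| <= e * qf M u u.
Proof.
move=> cM c0 Hc e0.
have : (fun m => \sum_(k : ('I_N.+1 * 'I_N.+1) * ('I_N.+1 * 'I_N.+1))
     `|M_ m (k.1.1 + k.2.1)%N - M (k.1.1 + k.2.1)%N| * `|gam (k.1.2 + k.2.2)|) @ \oo -->
     \sum_(k : ('I_N.+1 * 'I_N.+1) * ('I_N.+1 * 'I_N.+1)) 0 * `|gam (k.1.2 + k.2.2) : R|.
  apply: cvg_sumr => k; apply: cvgM; last exact: cvg_cst.
  rewrite -[X in _ --> X](@normr0 _ R) -(subrr (M (k.1.1 + k.2.1)%N)).
  by apply: cvg_norm; apply: cvgB; [exact: cM|exact: cvg_cst].
rewrite [X in _ --> X]big1; last by move=> k _; rewrite mul0r.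
move/cvgrPdist_le => /(_ (e * c)); rewrite mulr_gt0// => /(_ isT).
apply: filterS => m h u; apply: le_trans (qf_perturb _ _ _) _.
apply: (@le_trans _ _ (sq2 u * (e * c))).
  apply: ler_wpM2l; first exact: sq2_ge0.
  by move: h; rewrite sub0r normrN; apply: le_trans; exact: ler_norm.
rewrite mulrCA [sq2 u * c]mulrC; apply: ler_wpM2l; [exact: ltW|exact: Hc].
Qed.

End moments.

(** * Bounds on the polynomial estimation error *)

Section pmmse_bounds.
Context {R : realType}.
Local Notation phi := (@normal_pdf R 0 1).
Local Notation leb := (@lebesgue_measure R).
Variables (E : (R -> \bar R) -> \bar R) (M : nat -> R).
Hypothesis hM : has_moments E M.
Hypothesis M0 : M 0%N = 1.

Lemma pmmse_le_var n (t : R) : (pmmse n E t <= (M 2%N)%:E)%E.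
Proof.
apply: ereal_inf_le; exists (pmmse_err E t (fun _ : 'I_n.+1 => 0)); first by exists (fun=> 0).
rewrite /pmmse_err (_ : (fun r => _) = (fun r => (\sum_(j : 'I_1) 1 * r ^+ 2)%:E)).
  by rewrite hM big_ord1 mul1r.
apply/funext => r; rewrite big_ord1 mul1r.
transitivity (\int[leb]_z ((r ^+ 2)%:E * (phi z)%:E))%E.
  apply: eq_integral => z _; rewrite big1; last by move=> i _; exact: mul0r.
  by rewrite subr0 mulrC EFinM.
rewrite ge0_integralZl//.
- by rewrite integral_normal_pdf mule1.
- by apply: measurable_funT_EFin; exact: measurable_phi.
- by move=> z _; rewrite lee_fin ltW// phi_gt0.
- by rewrite lee_fin sqr_ge0.
Qed.

(** The estimator [Z / sqrt t] has error [N / sqrt t]; it is of degree 1, hence [n >= 1]. *)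
Lemma pmmse_le_inv n (t : R) : (0 < n)%N -> 0 < t -> (pmmse n E t <= (t^-1)%:E)%E.
Proof.
move=> n0 t0; pose c (i : 'I_n.+1) : R := if i == 1%N :> nat then (Num.sqrt t)^-1 else 0.
apply: ereal_inf_le; exists (pmmse_err E t c); first by exists c.
rewrite /pmmse_err (_ : (fun r => _) = (fun r => (\sum_(j : 'I_1) t^-1 * r ^+ 0)%:E)).
  by rewrite hM big_ord1 M0 mulr1.
have s0 : 0 < Num.sqrt t by rewrite sqrtr_gt0.
have st : Num.sqrt t ^+ 2 = t by rewrite sqr_sqrtr// ltW.
apply/funext => r; rewrite big_ord1 mulr1.
transitivity (\int[leb]_z ((t^-1)%:E * (z ^+ 2 * phi z)%:E))%E.
  apply: eq_integral => z _; rewrite -EFinM; congr EFin.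
  rewrite (bigD1 (inord 1))//= big1 ?addr0; last first.
    move=> i /eqP i1; rewrite /c; case: eqP => [e|_]; last exact: mul0r.
    by exfalso; apply: i1; rewrite -e inord_val.
  rewrite /c inordK ?ltnS// eqxx expr1 -{3}st.
  by move: (phi z) => p; field; rewrite gt_eqF.
rewrite ge0_integralZl//.
- by rewrite RintE ?(@integrable_phiXs R 2)// integral_phi_sqr mule1.
- apply: measurable_funT_EFin; apply: measurable_funM; [exact: measurable_funX|exact: measurable_phi].
- by move=> z _; rewrite lee_fin mulr_ge0 ?sqr_ge0// ltW// phi_gt0.
- by rewrite lee_fin invr_ge0 ltW.
Qed.

(* Minimize over [U = sqrt (sq2 v)] the lower bound [1 - 2 s K U + c' U^2]. *)
Lemma pmmse_ge_inv n N (c' B t : R) : (0 < n)%N -> (n <= N)%N -> 0 < c' ->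
  (forall u : 'I_N.+1 * 'I_N.+1 -> R, c' * sq2 u <= qf M u u) ->
  (forall i, (i <= N)%N -> `|M i| <= B) -> 1 <= t ->
  ((t^-1 * (1 - t^-1 * (crossK N B ^+ 2 / c')))%:E <= pmmse n E t)%E.
Proof.
move=> n0 nN c0 Hc MB t1; apply: le_ereal_inf_tmp => _ [c _ <-].
have N0 : (0 < N)%N by exact: leq_trans nN.
have t0 : 0 < t by exact: lt_le_trans t1.
have s0 : 0 < Num.sqrt t by rewrite sqrtr_gt0.
have st : Num.sqrt t ^+ 2 = t by rewrite sqr_sqrtr// ltW.
rewrite (pmmse_errE _ _ hM nN N0) lee_fin.
set d := fun m => c (inord m).
rewrite (qfZ M (fun k => err_rescale d k (lt0r_neq0 s0) n0)) sqrrN exprVn st.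
rewrite ler_pM2l ?invr_gt0//.
set v := pcf _ _ _ _; set s := (Num.sqrt t)^-1.
have sle : 0 <= s <= 1.
  rewrite invr_ge0 (ltW s0)/= invf_le1//.
  by rewrite -[leLHS]sqrtr1; apply: ler_wsqrtr.
have -> : qf M (fun k => delta 0 1 k + - v k) (fun k => delta 0 1 k + - v k) =
    1 - 2 * qf M (delta 0 1) v + qf M v v.
  have e01 : qf M (@delta R N 0 1) (delta 0 1) = 1.
    by rewrite qf_delta// sum_delta//= !inordK ?ltnS// M0 gam2 mulr1.
  rewrite qfE2 e01 (_ : qf M (delta 0 1) _ = - qf M (delta 0 1) v); last first.
    by rewrite !qf_delta// -sumrN; apply: eq_bigr => l _; rewrite mulNr.
  rewrite (qfZ M (k := -1) (v := v)); last by move=> i; rewrite mulN1r.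
  by ring.
have h1 := qf_cross (fun m => Num.sqrt t * (m == 1)%:R - Num.sqrt t * d m * Num.sqrt t ^+ m) nN N0 sle MB.
rewrite -/v in h1.
have h2 := Hc v; have h3 := le_trans (ler_norm _) h1.
have := sq2_ge0 v => sq0.
have U2 : Num.sqrt (sq2 v) ^+ 2 = sq2 v by rewrite sqr_sqrtr.
have s2 : t^-1 = s ^+ 2 by rewrite exprVn st.
rewrite s2; rewrite -U2 in h2; move: h2 h3.
move: (Num.sqrt (sq2 v)) (crossK N B) (qf M v v) (qf M (delta 0 1) v) => U K q b h2 h3.
have : 0 <= c' * (U - s * K / c') ^+ 2 by rewrite mulr_ge0 ?sqr_ge0// ltW.
have -> : c' * (U - s * K / c') ^+ 2 = c' * U ^+ 2 - 2 * (s * U * K) + s ^+ 2 * (K ^+ 2 / c').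
  by field; rewrite gt_eqF.
by move=> h4; lra.
Qed.

End pmmse_bounds.

(** * Continuity in the moments *)

Section pmmse_kernel.
Context {R : realType}.
Local Notation leb := (@lebesgue_measure R).
Variable n : nat.
(** Room for the estimators of degree [n], for the monomial [r] itself, and for the index 2, so that
    [B] below also bounds the second moment. *)
Local Notation N := n.+2.
Local Notation I := ('I_N.+1 * 'I_N.+1)%type.

Definition ecoef (t : R) (c : 'I_n.+1 -> R) (k : I) : R :=
  delta 1 0 k - pcf n (Num.sqrt t) 1 (fun m => c (inord m)) k.

Definition qerr (M : nat -> R) (t : R) (c : 'I_n.+1 -> R) : R := qf M (ecoef t c) (ecoef t c).

Lemma continuous_qerr M c : continuous (qerr M ^~ c).
Proof.
have ce k : continuous (fun t => ecoef t c k).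
  move=> t; apply: cvgB; first exact: cvg_cst.
  rewrite /pcf; case: ifP => _; last exact: cvg_cst.
  apply: cvgM; last exact: cvg_cst; apply: cvgM; first exact: cvg_cst.
  apply: (cvg_comp _ (fun x : R => x ^+ k.1)); first exact: sqrt_continuous.
  exact: exprn_continuous.
apply: continuous_big => [|k _ t]; first exact: add_continuous.
by apply: cvgM; last exact: cvg_cst; apply: cvgM; exact: ce.
Qed.

Variables (E : (R -> \bar R) -> \bar R) (M : nat -> R) (c0 B : R).
Hypothesis hM : has_moments E M.
Hypothesis M0 : M 0%N = 1.
Hypothesis c00 : 0 < c0.
Hypothesis Hc : forall u : I -> R, c0 * sq2 u <= qf M u u.
Hypothesis MB : forall i, (i <= N)%N -> `|M i| <= B.

Lemma pmmse_errq t (c : 'I_n.+1 -> R) : pmmse_err E t c = (qerr M t c)%:E.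
Proof. by rewrite (@pmmse_errE R N n E M t c hM)// ltnW. Qed.

Lemma qerr_ge0 t c : 0 <= qerr M t c.
Proof. by apply: le_trans (Hc _); rewrite mulr_ge0 ?sq2_ge0// ltW. Qed.

Definition rpmmse (t : R) : R := fine (pmmse n E t).

Lemma rpmmseE t : pmmse n E t = (rpmmse t)%:E.
Proof.
rewrite /rpmmse fineK// fin_numElt; apply/andP; split.
  apply: (@lt_le_trans _ _ 0%E); first exact: ltNyr.
  by apply: le_ereal_inf_tmp => _ [c _ <-]; rewrite pmmse_errq lee_fin qerr_ge0.
by apply: le_lt_trans (pmmse_le_var hM n t) _; exact: ltry.
Qed.

Lemma rpmmse_le t c : rpmmse t <= qerr M t c.
Proof.
rewrite -lee_fin -rpmmseE -pmmse_errq; apply: ereal_inf_lbound; by exists c.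
Qed.

Lemma rpmmse_ge x t : (forall c, x <= qerr M t c) -> x <= rpmmse t.
Proof.
move=> H; rewrite -lee_fin -rpmmseE; apply: le_ereal_inf_tmp => _ [c _ <-].
by rewrite pmmse_errq lee_fin.
Qed.

Lemma rpmmse_ge0 t : 0 <= rpmmse t.
Proof. by apply: rpmmse_ge => c; exact: qerr_ge0. Qed.

Lemma rpmmse_leB t : rpmmse t <= B.
Proof.
rewrite -lee_fin -rpmmseE; apply: le_trans (pmmse_le_var hM n t) _.
by rewrite lee_fin; apply: le_trans (MB _); [exact: ler_norm|].
Qed.

(** The infimum runs over uncountably many [c], but each [qerr M ^~ c] is continuous, so the sets
    where [rpmmse < a] are unions of open sets. *)
Lemma measurable_rpmmse : measurable_fun setT rpmmse.
Proof.
apply: (measurability _ (RGenInftyO.measurableE R)) => // _ [_ [a ->] <-].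
rewrite setTI; apply: open_measurable.
rewrite (_ : _ @^-1` _ = \bigcup_(c in [set: 'I_n.+1 -> R]) [set t | qerr M t c < a]).
  apply: bigcup_open => c _.
  rewrite (_ : [set t | _] = qerr M ^~ c @^-1` [set x | x < a])//.
  by apply: open_comp; [move=> t _; exact: continuous_qerr|exact: open_lt].
apply/seteqP; split => t /=; rewrite in_itv/=.
  move=> h; apply: contrapT => H; move: h; rewrite ltNge => /negP; apply.
  by apply: rpmmse_ge => c; rewrite leNgt; apply/negP => hc; apply: H; exists c.
by move=> [c _ hc]; apply: le_lt_trans hc; exact: rpmmse_le.
Qed.

Local Notation a := (2 * pi * expR 1 : R).

Lemma twopie_ge1 : 1 <= a.
Proof.
have h1 := @pi_ge2 R; have h2 := @expR_ge1Dx R 1.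
rewrite -[leLHS]mulr1; apply: ler_pM => //; lra.
Qed.

(** The truncation [Num.max t 0] removes the pole at [t = - a] without changing the values for
    [t >= 0]. *)
Lemma continuous_shiftV : continuous (fun t : R => (a + Num.max t 0)^-1).
Proof.
move=> t; apply: cvgV.
  have := twopie_ge1 => a1; have : 0 <= Num.max t 0 by rewrite le_max lexx orbT.
  by move=> h; rewrite gt_eqF// ltr_wpDr// (lt_le_trans ltr01).
apply: cvgD; first exact: cvg_cst.
by apply: continuous_max; [exact: cvg_id|exact: cvg_cst].
Qed.

Definition hker (t : R) : R := \1_(`[0, +oo[%classic) t * (rpmmse t - (a + t)^-1).

Lemma h_nE : h_n n E = ((2^-1)%:E * \int[leb]_t (hker t)%:E)%E.
Proof.
rewrite /h_n; congr (_ * _)%E; rewrite integral_mkcond; apply: eq_integral => t _.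
rewrite patchE /hker indicE; case: ifP => _; last by rewrite mul0r.
by rewrite mul1r rpmmseE EFinB.
Qed.

Lemma measurable_hker : measurable_fun setT hker.
Proof.
have -> : hker = fun t => \1_(`[0, +oo[%classic) t * (rpmmse t - (a + Num.max t 0)^-1).
  apply/funext => t; rewrite /hker indicE; case: (boolP (t \in _)); rewrite ?mul0r//.
  by rewrite mem_setE in_itv/= andbT => t0; rewrite (max_l t0).
apply: measurable_funM; first exact: measurable_indic.
apply: measurable_funB; first exact: measurable_rpmmse.
by apply: continuous_measurable_fun; exact: continuous_shiftV.
Qed.

Definition hdom : R := 2 * (crossK N B ^+ 2 / c0 + a + B + 1).

(** For [t >= 1] both [rpmmse] and [1 / (a + t)] lie within a multiple of [t^-2] of [1 / t]; for
    [0 <= t < 1] both are bounded. The factor 2 in [hdom] turns [t^-2], respectively [1], into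
    [2 / (1 + t^2)]. *)
Lemma hker_le t : (0 < n)%N -> `|hker t| <= hdom / (1 + t ^+ 2).
Proof.
move=> n0; have a1 := twopie_ge1.
have B0 : 0 <= B by apply: le_trans (MB (isT : 0 <= N)%N).
have K0 : 0 <= crossK N B ^+ 2 / c0 by rewrite divr_ge0 ?sqr_ge0// ltW.
have p1 : 0 < 1 + t ^+ 2 by rewrite ltr_wpDr ?sqr_ge0.
have D0 : 0 <= hdom by rewrite /hdom; lra.
rewrite /hker indicE; case: (boolP (t \in _)) => [|_]; last by rewrite mul0r normr0 divr_ge0// ltW.
rewrite mem_setE in_itv/= andbT mul1r => t0.
have at0 : 0 < a + t by rewrite ltr_wpDr// (lt_le_trans ltr01).
have r0 := rpmmse_ge0 t.
have [t1|t1] := leP 1 t.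
  have tp : 0 < t by exact: lt_le_trans t1.
  have up := pmmse_le_inv hM M0 n0 tp; rewrite rpmmseE lee_fin in up.
  have lo := @pmmse_ge_inv R E M hM M0 n N c0 B t n0 (leqW (leqW (leqnn n))) c00 Hc MB t1.
  rewrite rpmmseE lee_fin in lo.
  have e : t^-1 - (a + t)^-1 = a * (t^-1 * (a + t)^-1).
    by move: a at0 => b at0; field; rewrite !gt_eqF.
  have ti : 0 < t^-1 by rewrite invr_gt0.
  have le1 : t^-1 * (a + t)^-1 <= (t ^+ 2)^-1.
    rewrite expr2 invfM ler_pM2l// lef_pV2 ?posrE//; lra.
  have ge1 : 0 <= t^-1 * (a + t)^-1 by rewrite mulr_ge0 ?invr_ge0 ?ltW.
  have h2 : (t ^+ 2)^-1 <= 2 / (1 + t ^+ 2).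
    rewrite ler_pdivlMr// mulrDr mulr1 mulVf ?expf_neq0 ?gt_eqF//.
    have : (t ^+ 2)^-1 <= 1 by rewrite invf_le1 ?exprn_gt0// exprn_ege1.
    lra.
  apply: (@le_trans _ _ ((crossK N B ^+ 2 / c0 + a) * (t ^+ 2)^-1)).
    move: lo; rewrite mulrBr mulr1 mulrA -expr2 exprVn.
    have aq : a * (t^-1 * (a + t)^-1) <= a * (t ^+ 2)^-1 by rewrite ler_pM2l// (lt_le_trans ltr01).
    have aq0 : 0 <= a * (t^-1 * (a + t)^-1) by rewrite mulr_ge0// (le_trans ler01).
    have q0 : 0 <= crossK N B ^+ 2 / c0 * (t ^+ 2)^-1 by rewrite mulr_ge0// invr_ge0 sqr_ge0.
    move: e up aq aq0 q0.
    move: (a * (t^-1 * (a + t)^-1)) (a + t)^-1 (t ^+ 2)^-1 (crossK N B ^+ 2 / c0) t^-1 (rpmmse t) a.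
    move=> x y z K w r b e up aq aq0 q0 lo.
    by rewrite ler_norml; apply/andP; split; lra.
  apply: (@le_trans _ _ ((crossK N B ^+ 2 / c0 + a) * (2 / (1 + t ^+ 2)))).
    by rewrite ler_wpM2l//; lra.
  rewrite mulrA ler_pM2r ?invr_gt0// /hdom; lra.
have rB := rpmmse_leB t.
have i0 : 0 <= (a + t)^-1 by rewrite invr_ge0 ltW.
have i1 : (a + t)^-1 <= 1 by rewrite invf_le1//; lra.
apply: (@le_trans _ _ (B + 1)).
  by rewrite ler_norml; apply/andP; split; lra.
rewrite ler_pdivlMr//.
have t2 : t ^+ 2 <= 1 by rewrite exprn_ile1// ltW.
have : (B + 1) * (1 + t ^+ 2) <= (B + 1) * 2 by rewrite ler_wpM2l//; lra.
by rewrite /hdom; lra.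
Qed.

Lemma integrable_hker : (0 < n)%N -> leb.-integrable setT (fun t => (hker t)%:E).
Proof.
move=> n0; apply: (integrable_bnd measurable_hker) => t; exact: (hker_le t n0).
Qed.

End pmmse_kernel.

Section degree_zero.
Context {R : realType}.
Local Notation leb := (@lebesgue_measure R).

(** A constant estimator leaves the coefficient of [r] equal to 1, so the error is at least [c0] for
    every [t], and the integrand stays above [c0 / 2] for large [t]. *)
Lemma h_0_pinfty (E : (R -> \bar R) -> \bar R) (M : nat -> R) (c0 : R) :
  has_moments E M -> 0 < c0 ->
  (forall u : 'I_3 * 'I_3 -> R, c0 * sq2 u <= qf M u u) ->
  h_n 0 E = +oo%E.
Proof.
move=> hM c00 Hc; rewrite (h_nE hM c00 Hc).
have lb t : c0 <= rpmmse 0 E t.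
  apply: (rpmmse_ge hM c00 Hc) => c; apply: le_trans (Hc _).
  rewrite -[leLHS]mulr1 ler_pM2l//; apply: le_trans (le_sq2 _ (inord 1, inord 0)).
  by rewrite /ecoef /delta /pcf/= !inordK//= subr0 expr1n.
have a1 := @twopie_ge1 R.
(* Chosen so that [C / (1 + t^2) >= 1] for [0 <= t <= 2 / c0]: subtracting the integrable [h] then
   keeps [r] above [c0 / 2] on the whole half-line. *)
pose C : R := 1 + (2 / c0) ^+ 2.
pose h t : R := - (\1_(`[0, +oo[%classic) t * (C * (1 + t ^+ 2)^-1)).
pose r t : R := hker 0 E t - h t.
have mh : measurable_fun setT h.
  apply: measurable_funN; apply: measurable_funM; first exact: measurable_indic.
  by apply: measurable_funM => //; apply: continuous_measurable_fun; exact: continuous_oneDsqrV.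
have ih : leb.-integrable setT (fun t => (h t)%:E).
  apply: (@integrable_bnd _ _ C) => // t; rewrite /h normrN indicE.
  have p1 : 0 < 1 + t ^+ 2 by rewrite ltr_wpDr ?sqr_ge0.
  have C0 : 0 <= C by rewrite addr_ge0 ?sqr_ge0.
  case: (_ \in _); rewrite ?mul0r ?normr0 ?mul1r ?ger0_norm// ?divr_ge0// ltW//.
have mr : measurable_fun setT r.
  by apply: measurable_funB => //; exact: (measurable_hker hM c00 Hc).
have rlb t : \1_(`[0, +oo[%classic) t * (c0 / 2) <= r t.
  rewrite /r /h /hker indicE; case: (boolP (t \in _)); rewrite ?mul0r ?oppr0 ?subr0//.
  rewrite mem_setE in_itv/= andbT !mul1r opprK => t0.
  have at0 : 0 < 2 * pi * expR 1 + t by rewrite ltr_wpDr// (lt_le_trans ltr01).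
  have p1 : 0 < 1 + t ^+ 2 by rewrite ltr_wpDr ?sqr_ge0.
  have C0 : 0 <= C * (1 + t ^+ 2)^-1 by rewrite mulr_ge0// ?addr_ge0 ?sqr_ge0// invr_ge0 ltW.
  have := lb t; have [ht|ht] := leP (2 / c0) t.
    have : (2 * pi * expR 1 + t)^-1 <= c0 / 2.
      rewrite -[c0 / 2]invrK lef_pV2 ?posrE ?invr_gt0 ?divr_gt0// invf_div; lra.
    lra.
  have : (2 * pi * expR 1 + t)^-1 <= 1 by rewrite invf_le1//; lra.
  have : 1 <= C * (1 + t ^+ 2)^-1.
    rewrite ler_pdivlMr// mul1r lerD2l.
    by apply: lerXn2r; [rewrite nnegrE|rewrite nnegrE divr_ge0// ltW|exact: ltW].
  lra.
have r0 t : 0 <= r t.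
  apply: le_trans (rlb t); rewrite mulr_ge0// divr_ge0// ltW//.
have -> : (\int[leb]_t (hker 0 E t)%:E = \int[leb]_t (r t + h t)%:E)%E.
  by apply: eq_integral => t _; rewrite /r subrK.
rewrite (@integralD_ge0_integrable _ (measurableTypeR R) R leb)//.
suff -> : (\int[leb]_t (r t)%:E = +oo)%E by rewrite addye// mulry gtr0_sg ?invr_gt0// mul1e.
apply/eqP; rewrite -leye_eq.
apply: (@le_trans _ _ (\int[leb]_t (\1_(`[0, +oo[%classic) t * (c0 / 2))%:E)%E).
  under eq_integral do rewrite EFinM.
  rewrite ge0_integralZr//.
  - have -> : (\int[leb]_x (\1_(`[0%R, +oo[%classic) x)%:E = +oo)%E.
      transitivity (leb (`[0, +oo[%classic : set R)); last by rewrite lebesgue_measure_itv/= ltry; apply: addye.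
      by rewrite (@integral_indic _ (measurableTypeR R) R leb)// setIT.
    by rewrite mulyr gtr0_sg ?mul1e// divr_gt0.
  - by apply: measurable_funT_EFin; exact: measurable_indic.
  - by rewrite lee_fin divr_ge0// ltW.
apply: ge0_le_integral => //.
- by move=> t _; rewrite lee_fin mulr_ge0// divr_ge0// ltW.
- by apply: measurable_funT_EFin; apply: measurable_funM => //; exact: measurable_indic.
- exact: measurable_funT_EFin.
- by move=> t _; rewrite lee_fin.
Qed.

End degree_zero.

(** * Convergence of [h_n] under convergence of moments *)

Section convergence.
Context {R : realType}.
Local Notation leb := (@lebesgue_measure R).
Variable n : nat.
Local Notation N := n.+2.
Local Notation I := ('I_N.+1 * 'I_N.+1)%type.

(** The relative bound holds for each [c] and thus for the infima; [B], which bounds the infimum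
    itself, makes it absolute. *)
Lemma rpmmse_perturb (E E' : (R -> \bar R) -> \bar R) (M M' : nat -> R) (c0 c0' B e t : R) :
  has_moments E M -> 0 < c0 -> (forall u : I -> R, c0 * sq2 u <= qf M u u) ->
  has_moments E' M' -> 0 < c0' -> (forall u : I -> R, c0' * sq2 u <= qf M' u u) ->
  (forall i, (i <= N)%N -> `|M i| <= B) -> 0 <= e <= 1 ->
  (forall u : I -> R, `|qf M' u u - qf M u u| <= e * qf M u u) ->
  `|rpmmse n E' t - rpmmse n E t| <= e * B.
Proof.
move=> hM c00 Hc hM' c00' Hc' MB /andP[e0 e1] H.
have up (c : 'I_n.+1 -> R) : qerr M' t c <= (1 + e) * qerr M t c.
  by have := H (@ecoef R n t c); rewrite ler_norml /qerr => /andP[_]; lra.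
have lo (c : 'I_n.+1 -> R) : (1 - e) * qerr M t c <= qerr M' t c.
  by have := H (@ecoef R n t c); rewrite ler_norml /qerr => /andP[+ _]; lra.
have e1' : 0 < 1 + e by lra.
have h1 : rpmmse n E' t <= (1 + e) * rpmmse n E t.
  rewrite mulrC -ler_pdivrMr//; apply: (rpmmse_ge hM c00 Hc) => c.
  by rewrite ler_pdivrMr// mulrC; apply: le_trans (up c); exact: (rpmmse_le hM' c00' Hc').
have h2 : (1 - e) * rpmmse n E t <= rpmmse n E' t.
  apply: (rpmmse_ge hM' c00' Hc') => c; apply: le_trans (lo c).
  by apply: ler_wpM2l; [lra|exact: (rpmmse_le hM c00 Hc)].
have h3 : e * rpmmse n E t <= e * B.
  by apply: ler_wpM2l => //; exact: (rpmmse_leB hM c00 Hc MB).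
by rewrite ler_norml; apply/andP; split; lra.
Qed.

Lemma cvg_h_n (E_ : nat -> (R -> \bar R) -> \bar R) (M_ : nat -> nat -> R)
    (E : (R -> \bar R) -> \bar R) (M : nat -> R) (c0 : R) :
  (forall m, has_moments (E_ m) (M_ m)) -> has_moments E M ->
  (\forall m \near \oo, M_ m 0%N = 1) -> M 0%N = 1 ->
  (forall k, M_ ^~ k @ \oo --> M k) ->
  0 < c0 -> (forall u : I -> R, c0 * sq2 u <= qf M u u) ->
  (fun m => h_n n (E_ m)) @ \oo --> h_n n E.
Proof.
move=> hM_ hM M_0 M0 cM c00 Hc.
have half : (0 : R) < 1 / 2 by lra.
have ch : 0 < c0 / 2 by lra.
(* A relative error of [1/2] preserves positive definiteness with constant [c0 / 2]; this is how it
   reaches the laws [E_ m]. *)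
have near1 := qf_near cM c00 Hc half.
have Hc_ : \forall m \near \oo, forall u : I -> R, c0 / 2 * sq2 u <= qf (M_ m) u u.
  apply: filterS near1 => m h u; have := h u; rewrite ler_norml => /andP[+ _].
  by have := Hc u; lra.
have [n0|n0] := posnP n.
  move: Hc Hc_ {near1}; rewrite n0 => Hc Hc_.
  rewrite (h_0_pinfty hM c00 Hc).
  apply: cvg_near_cst; near=> m.
  by apply: (h_0_pinfty (hM_ m) (c0 := c0 / 2)) => //; near: m.
(* The extra 1 in each summand lets [B] eventually bound the moments [M_ m] as well. *)
pose B : R := \sum_(i < N.+1) (`|M i| + 1).
have leB (i : nat) : (i <= N)%N -> `|M i| + 1 <= B.
  move=> iN; rewrite /B (bigD1 (Ordinal (iN : (i < N.+1)%N)))//= lerDl.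
  by apply: sumr_ge0 => j _; rewrite addr_ge0.
have MB i : (i <= N)%N -> `|M i| <= B by move=> /leB; lra.
have MB_ : \forall m \near \oo, forall i, (i <= N)%N -> `|M_ m i| <= B.
  have : \forall m \near \oo, forall i : 'I_N.+1, `|M_ m i| <= B.
    apply: filter_forall => i; have := cM i => /cvgrPdist_le /(_ 1 ltr01).
    apply: filterS => m h; apply: le_trans (leB i _); last by rewrite -ltnS.
    rewrite -[M_ m i](subrK (M i)) addrC (le_trans (ler_normD _ _))// lerD2l.
    by rewrite distrC.
  by apply: filterS => m h i iN; exact: (h (Ordinal (iN : (i < N.+1)%N))).
(* Beyond [m0] the bounds hold with constants free of [m], so a single function dominates all the
   integrands. *)
have [m0 _ Hm0] := filterI M_0 (filterI Hc_ MB_).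
have {}Hm0 m : [/\ M_ (m + m0)%N 0%N = 1,
    forall u : I -> R, c0 / 2 * sq2 u <= qf (M_ (m + m0)%N) u u &
    forall i, (i <= N)%N -> `|M_ (m + m0)%N i| <= B].
  by have [|? []] := Hm0 (m + m0)%N; first exact: leq_addl.
rewrite (h_nE hM c00 Hc).
rewrite -(cvg_shiftn m0).
have -> : (fun m => h_n n (E_ (m + m0)%N)) =
    (fun m => (2^-1 * \int[leb]_t hker n (E_ (m + m0)%N) t)%:E).
  apply/funext => m; have [a1 a2 a3] := Hm0 m.
  rewrite (h_nE (hM_ _) ch a2) RintE ?EFinM//.
  exact: (integrable_hker (hM_ _) a1 ch a2 a3).
rewrite RintE; last exact: (integrable_hker hM M0 c00 Hc MB).
rewrite -EFinM; apply: cvg_EFin; first exact: nearW.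
apply: cvgM; first exact: cvg_cst.
apply: (@Rdominated _ (measurableTypeR R) R leb (fun m => hker n (E_ (m + m0)%N)) (hker n E)
  (fun t => hdom n (c0 / 2) B / (1 + t ^+ 2)) _ _ _ _).2.
- by move=> m; have [a1 a2 a3] := Hm0 m; exact: (measurable_hker (hM_ _) ch a2).
- move=> t; rewrite /hker; apply: cvgM; first exact: cvg_cst.
  apply: cvgB; last exact: cvg_cst.
  apply/cvgrPdist_le => e e0.
  have B1 : 1 <= B by apply: le_trans (leB 0%N _) => //; rewrite lerDr.
  pose e' := Num.min 1 (e / B).
  have e'0 : 0 < e' by rewrite lt_min ltr01 divr_gt0// (lt_le_trans ltr01).
  have [m1 _ Hm1] := qf_near cM c00 Hc e'0.
  exists m1 => // m /= m1m; have [a1 a2 a3] := Hm0 m.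
  rewrite distrC.
  have e'1 : 0 <= e' <= 1 by rewrite (ltW e'0)/= ge_min lexx.
  have := @rpmmse_perturb E (E_ (m + m0)%N) M (M_ (m + m0)%N) c0 (c0 / 2) B e' t hM c00 Hc
    (hM_ _) ch a2 MB e'1 (Hm1 (m + m0)%N (leq_trans m1m (leq_addr _ _))).
  move=> h; apply: (le_trans h); rewrite -ler_pdivlMr ?(lt_le_trans ltr01)//.
  by rewrite ge_min lexx orbT.
- under eq_fun do rewrite EFinM.
  by have := @integrableZ _ (measurableTypeR R) R leb (hdom n (c0 / 2) B) _ (@integrable_oneDsqrV R).
- by move=> m t; have [a1 a2 a3] := Hm0 m; exact: (hker_le (hM_ _) a1 ch a2 a3).
Unshelve. all: by end_near. Qed.

End convergence.

(** * The limit in the degree *)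

Section degree_limit.
Context {R : realType} d (T : measurableType d) (P : probability T R) (X : T -> R) (f : R -> R).
Hypothesis mX : measurable_fun setT X.
Hypothesis mgf : has_mgf P X.
Local Notation phi := (@normal_pdf R 0 1).
Local Notation leb := (@lebesgue_measure R).

Lemma integrable_norm_pow k : P.-integrable setT (fun w => (`|X w| ^+ k)%:E).
Proof.
have [e e0 ie] := mgf_abs mX mgf.
apply: (integrable_dom _ (integrableZ (k`!%:R / e ^+ k) ie)).
  by apply: measurable_funX; apply: measurableT_comp => //; exact: normr_measurable.
move=> w; rewrite ger0_norm ?exprn_ge0// mulrAC ler_pdivlMr ?exprn_gt0//.
rewrite mulrC -exprMn; apply: pow_fact_le_expR; by rewrite mulr_ge0// ltW.
Qed.

Local Notation hm := integrable_norm_pow.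
Local Notation E := (rv_expect P X).
Local Notation M := (fun k => \int[P]_w (X w ^+ k)).

Lemma moment0 : \int[P]_w (X w ^+ 0) = 1.
Proof. by under eq_Rintegral do rewrite expr0; exact: Rintegral_cstP. Qed.

Lemma pmmse_errP n (t : R) (c : 'I_n.+1 -> R) :
  pmmse_err E t c = (\int[P]_w \int[leb]_z (phi z *
    (X w - (\poly_(i < n.+1) c (inord i)).[Num.sqrt t * X w + z]) ^+ 2)%:E)%E.
Proof.
rewrite /pmmse_err /rv_expect; apply: eq_integral => w _; apply: eq_integral => z _.
by rewrite horner_poly; do 5 f_equal; apply: eq_bigr => i _; rewrite inord_val.
Qed.

Lemma mmse_le_pmmse n (t : R) : ((mmse P X (Num.sqrt t))%:E <= pmmse n E t)%E.
Proof.
apply: le_ereal_inf_tmp => _ [c _ <-].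
rewrite pmmse_errP (integral_err_poly mX hm) leeDl//.
apply: wsq_ge0 => y; exact: ltW (gmom00_gt0 mX hm _ _).
Qed.

Lemma pmmse_le_poly n (t : R) (q : {poly R}) : (size q <= n.+1)%N ->
  (pmmse n E t <= \int[P]_w \int[leb]_z (phi z * (X w - q.[Num.sqrt t * X w + z]) ^+ 2)%:E)%E.
Proof.
move=> sq; pose c (i : 'I_n.+1) := q`_i.
apply: ereal_inf_le; exists (pmmse_err E t c); first by exists c.
rewrite pmmse_errP (_ : \poly_(i < n.+1) c (inord i) = q)//.
apply/polyP => i; rewrite coef_poly; case: ltnP => [iN|iN]; first by rewrite /c inordK.
by rewrite nth_default// (leq_trans sq).
Qed.

Lemma pmmse_nonincr n n' (t : R) : (n <= n')%N -> (pmmse n' E t <= pmmse n E t)%E.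
Proof.
move=> nn; apply: le_ereal_inf_tmp => _ [c _ <-]; rewrite pmmse_errP.
by apply: pmmse_le_poly; rewrite (leq_trans (size_poly _ _)).
Qed.

Hypothesis dens : is_density P X f.

Local Notation a := (2 * pi * expR 1 : R).
Let w (t : R) : R := (a + Num.max t 0)^-1.
Let m (t : R) : R := mmse P X (Num.sqrt t).
Let r n (t : R) : R := rpmmse n E t.

Lemma rv_good n : exists2 c0 : R, 0 < c0 &
  forall u : 'I_n.+3 * 'I_n.+3 -> R, c0 * sq2 u <= qf M u u.
Proof. exact: (qf_rv_lb mX hm dens n.+2). Qed.

Lemma pmmseE n t : pmmse n E t = (r n t)%:E.
Proof. by have [c0 c00 Hc] := rv_good n; exact: (rpmmseE (has_moments_rv mX hm) c00 Hc). Qed.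

Lemma measurable_r n : measurable_fun setT (r n).
Proof. by have [c0 c00 Hc] := rv_good n; exact: (measurable_rpmmse (has_moments_rv mX hm) c00 Hc). Qed.

Lemma integrable_h n : (0 < n)%N -> leb.-integrable setT (fun t => (hker n E t)%:E).
Proof.
move=> n0; have [c0 c00 Hc] := rv_good n.
pose B : R := \sum_(i < n.+3) `|M i|.
apply: (@integrable_hker R n E M c0 B (has_moments_rv mX hm) moment0 c00 Hc _ n0).
move=> i iN; rewrite /B (bigD1 (Ordinal (iN : (i < n.+3)%N)))//= lerDl.
exact: sumr_ge0.
Qed.

Lemma h_n_rvE n : (0 < n)%N -> h_n n E = (2^-1 * \int[leb]_t hker n E t)%:E.
Proof.
move=> n0; have [c0 c00 Hc] := rv_good n.
rewrite (h_nE (has_moments_rv mX hm) c00 Hc) RintE ?EFinM//; exact: integrable_h.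
Qed.

Lemma m_le_r n t : m t <= r n t.
Proof. by rewrite -lee_fin -pmmseE; exact: mmse_le_pmmse. Qed.

Lemma r_nonincr n n' t : (n <= n')%N -> r n' t <= r n t.
Proof. by move=> nn; rewrite -lee_fin -!pmmseE; exact: pmmse_nonincr. Qed.

Lemma cvg_r t : r ^~ t @ \oo --> m t.
Proof.
apply/cvgrPdist_le => e e0.
have [q hq] := err_poly_inf mX hm mgf (Num.sqrt t) e0.
near=> n; rewrite distrC ger0_norm ?subr_ge0 ?m_le_r//.
rewrite lerBlDl -lee_fin -pmmseE; apply: le_trans (ltW hq).
apply: pmmse_le_poly; rewrite leqW//; near: n; exact: nbhs_infty_ge.
Unshelve. all: by end_near. Qed.

Lemma m_ge0 t : 0 <= m t.
Proof. by apply: Rintegral_ge0 => y _; exact: (mmsek_ge0 mX hm). Qed.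

Lemma continuous_m : continuous m.
Proof.
move=> t; apply: (cvg_comp _ (mmse P X)); first exact: sqrt_continuous.
exact: (continuous_mmse mX hm).
Qed.

Lemma continuous_w : continuous w.
Proof. exact: continuous_shiftV. Qed.

Let S := `[0, +oo[%classic : set R.
(** Degree 1, the first with an integrable [hker], serves as reference: [v n] is nonnegative for
    [n >= 1] and increases with [n], so monotone convergence applies even if the limit [Lv] is
    infinite, the case of entropy [-oo]. *)
Let v n (t : R) : R := \1_S t * (r 1 t - r n t).
Let vm (t : R) : R := \1_S t * (r 1 t - m t).
Let Lv : \bar R := (\int[leb]_t (vm t)%:E)%E.

Lemma measurable_m : measurable_fun setT m.
Proof. by apply: continuous_measurable_fun; exact: continuous_m. Qed.

Lemma measurable_vm : measurable_fun setT vm.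
Proof.
apply: measurable_funM; first by apply: measurable_indic; exact: measurable_itv.
by apply: measurable_funB; [exact: measurable_r|exact: measurable_m].
Qed.

Lemma vm_ge0 t : 0 <= vm t.
Proof. by rewrite mulr_ge0// subr_ge0 m_le_r. Qed.

Lemma cvg_h_n_rv :
  (fun n => h_n n.+1 E) @ \oo --> ((2^-1)%:E * ((\int[leb]_t hker 1 E t)%:E - Lv))%E.
Proof.
have vE n t : v n t = hker 1 E t - hker n E t.
  by rewrite /v /hker -/S -!/(r _ _); ring.
have iv n : leb.-integrable setT (fun t => (v n.+1 t)%:E).
  under eq_fun do rewrite vE.
  by apply: (@integrableBE _ (measurableTypeR R) R leb); exact: integrable_h.
have cv : (\int[leb]_t (v n.+1 t)%:E)%E @[n --> \oo] --> Lv.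
  rewrite (_ : Lv = (\int[leb]_t (limn (fun n => (v n.+1 t)%:E)))%E); last first.
    apply: eq_integral => t _; apply/esym/cvg_lim => //.
    apply: cvg_EFin; first exact: nearW.
    apply: cvgM; first exact: cvg_cst.
    apply: cvgB; first exact: cvg_cst.
    have := @cvg_r t; rewrite -(cvg_shiftS (r ^~ t)); exact.
  apply: (@cvg_monotone_convergence _ (measurableTypeR R) R leb) => //.
  - move=> n; apply: measurable_funT_EFin; apply: measurable_funM.
      by apply: measurable_indic; exact: measurable_itv.
    by apply: measurable_funB; exact: measurable_r.
  - by move=> n t _; rewrite lee_fin mulr_ge0// subr_ge0 r_nonincr.
  - by move=> t _ n n' nn; rewrite lee_fin ler_wpM2l// lerD2l lerN2 r_nonincr.
have -> : (fun n => h_n n.+1 E) =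
   (fun n => (2^-1)%:E * ((\int[leb]_t hker 1 E t)%:E - \int[leb]_t (v n.+1 t)%:E))%E.
  apply/funext => n; rewrite h_n_rvE// (RintE (iv n)) -EFinB -EFinM; congr EFin.
  have -> : \int[leb]_t v n.+1 t = \int[leb]_t hker 1 E t - \int[leb]_t hker n.+1 E t.
    by rewrite -RintegralB//; [apply: eq_Rintegral => t _; rewrite vE|exact: integrable_h|exact: integrable_h].
  by rewrite subKr.
apply: cvgeZl => //; apply: cvgeB => //; last exact: cvg_cst.
Qed.

(** The end point is a square, so that its root is the [k.+1] at which [cvg_Ent] is stated. *)
Let cut k : set R := `[0, k.+1%:R ^+ 2]%classic.

Lemma integral_cut_m k : (\int[leb]_t (\1_(cut k) t * m t)%:E = (2 * (Ent P X k.+1%:R - Ent P X 0))%:E)%E.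
Proof.
have k0 : 0 < k.+1%:R ^+ 2 :> R by rewrite exprn_gt0// ltr0n.
have := integral_mmse mX hm k0; rewrite sqrtr_sqr ger0_norm// EFinM => <-.
rewrite [in RHS]integral_mkcond -ge0_integralZl//.
- apply: eq_integral => t _; rewrite patchE indicE /cut; case: ifP => _; last by rewrite mul0r mule0.
  by rewrite mul1r -EFinM; congr EFin; rewrite mulrC divfK.
- apply: measurable_restrictR => //; apply: measurable_funM => //; exact: measurable_m.
- by move=> t _; rewrite patchE; case: ifP => // _; rewrite lee_fin divr_ge0// m_ge0.
Qed.

Lemma integral_cut_w k : (\int[leb]_t (\1_(cut k) t * w t)%:E = (ln (a + k.+1%:R ^+ 2) - ln a)%:E)%E.
Proof.
set b : R := k.+1%:R ^+ 2.
have b0 : 0 < b by rewrite exprn_gt0// ltr0n.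
have a0 : 0 < a by apply: lt_le_trans (@twopie_ge1 R).
have at0 t : 0 <= t -> 0 < a + t by move=> t0; rewrite ltr_wpDr.
pose F (t : R) := ln (a + t).
have dF (t : R) : 0 <= t -> is_derive t 1 F (w t).
  move=> t0; have h1 := is_derive1_ln (at0 t t0).
  have h2 : is_derive t 1 (fun t : R => a + t) (0 + 1) by exact: is_deriveD.
  rewrite add0r in h2; have := is_derive1_comp h1 h2.
  by rewrite mulr1 /w max_l.
have cF (t : R) : 0 <= t -> {for t, continuous F}.
  by move=> t0; apply/differentiable_continuous/derivable1_diffP; apply: ex_derive; exact: dF.
have h1 : {within `[0, b], continuous w} by apply: continuous_subspaceT; exact: continuous_w.
have h2 : derivable_oo_LRcontinuous F 0 b.
  split.
  + by move=> t tab; have t0 : 0 <= t by [rewrite (itvP tab)]; exact: (@ex_derive _ _ _ _ _ _ _ (dF t t0)).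
  + by apply: cvg_at_right_filter; exact: cF.
  + by apply: cvg_at_left_filter; apply: cF; exact: ltW.
have h3 : {in `]0, b[, derive1 F =1 w}.
  by move=> t tab; have t0 : 0 <= t by [rewrite (itvP tab)]; rewrite derive1E; exact: (@derive_val _ _ _ _ _ _ _ (dF t t0)).
have := continuous_FTC2 b0 h1 h2 h3; rewrite /F addr0 -EFinB => <-.
rewrite [in RHS]integral_mkcond; apply: eq_integral => t _.
by rewrite patchE indicE /cut -/b; case: ifP => _; rewrite ?mul1r ?mul0r.
Qed.

Lemma cvg_ln_ratio :
  (fun k => ln (k.+1%:R) - 2^-1 * ln (a + k.+1%:R ^+ 2) : R) @ \oo --> (0 : R).
Proof.
have a0 : 0 < a by apply: lt_le_trans (@twopie_ge1 R).
have -> : (fun k => ln (k.+1%:R) - 2^-1 * ln (a + k.+1%:R ^+ 2) : R) =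
    (fun k => - 2^-1 * ln (1 + a * (k.+1%:R ^+ 2)^-1)).
  apply/funext => k; set x : R := k.+1%:R; have x0 : 0 < x by rewrite ltr0n.
  have x2 : 0 < x ^+ 2 by rewrite exprn_gt0.
  have -> : a + x ^+ 2 = x ^+ 2 * (1 + a * (x ^+ 2)^-1) by field; rewrite gt_eqF.
  rewrite lnM ?posrE//; last by rewrite addr_gt0// mulr_gt0// invr_gt0.
  by rewrite lnXn// -mulr_natl; field.
rewrite -[X in _ --> X](mulr0 (- 2^-1)); apply: cvgM; first exact: cvg_cst.
rewrite -[X in _ --> X](@ln1 R); apply: continuous_cvg; first exact: continuous_ln.
rewrite -[X in _ --> X]addr0 -[X in _ --> _ + X](mulr0 a).
apply: cvgD; first exact: cvg_cst.
by apply: cvgM; [exact: cvg_cst|exact: cvg_invSn2].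
Qed.

(** On [cut k] everything is finite, and half the integral of [m - w] is [Ent k.+1 - Ent 0 - (ln (a
    + k.+1^2) - ln a) / 2]. Here [Ent 0 = ln a / 2] cancels, and comparing the remaining logarithm
    with [ln k.+1] leads to the limit in [cvg_Ent]. *)
Lemma limit_value : ((2^-1)%:E * ((\int[leb]_t hker 1 E t)%:E - Lv))%E = diff_entropy f.
Proof.
have ih := integrable_h (isT : (0 < 1)%N).
have mh : measurable_fun setT (hker 1 E) by apply/measurable_EFinP; exact: measurable_int ih.
have mcut k : measurable_fun setT (\1_(cut k) : R -> R) by apply: measurable_indic; exact: measurable_itv.
have im k : leb.-integrable setT (fun t => (\1_(cut k) t * m t)%:E).
  apply/integrableP; split.
    exact: (measurable_funT_EFin (measurable_funM (mcut k) measurable_m)).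
  under eq_integral do rewrite gee0_abs ?lee_fin ?mulr_ge0 ?m_ge0//.
  by rewrite integral_cut_m ltry.
have w0 t : 0 <= w t.
  rewrite invr_ge0 addr_ge0//; last by rewrite le_max lexx orbT.
  by apply: le_trans (@twopie_ge1 R).
have iw k : leb.-integrable setT (fun t => (\1_(cut k) t * w t)%:E).
  apply/integrableP; split.
    exact: (measurable_funT_EFin (measurable_funM (mcut k) (continuous_measurable_fun continuous_w))).
  under eq_integral do rewrite gee0_abs ?lee_fin ?mulr_ge0//.
  by rewrite integral_cut_w ltry.
have ich k : leb.-integrable setT (fun t => (\1_(cut k) t * hker 1 E t)%:E).
  apply: (@integrable_domR _ _ (fun t => `|hker 1 E t|)); last first.
  - by move=> t; rewrite normrM indicE; case: (_ \in _); rewrite ?normr1 ?normr0 ?mul1r ?mul0r.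
  - exact: (integrable_norm ih).
  - exact: (measurable_funM (mcut k) mh).
have cutS k t : \1_(cut k) t * \1_S t = \1_(cut k) t :> R.
  rewrite !indicE; case: (boolP (t \in cut k)); rewrite ?mul0r// => tk.
  have -> : t \in S; last by rewrite mulr1.
  by move: tk; rewrite !mem_setE !in_itv/= andbT => /andP[].
have vmE k t : \1_(cut k) t * vm t =
    \1_(cut k) t * hker 1 E t + (\1_(cut k) t * w t - \1_(cut k) t * m t).
  rewrite /vm /hker -/S -/(r _ _) !mulrA cutS.
  have [t0|t0] := leP 0 t; last first.
    have -> : \1_(cut k) t = 0 :> R; last by ring.
    by rewrite indicE; case: (boolP (_ \in _)) => //; rewrite mem_setE in_itv/= leNgt t0.
  by rewrite /w max_l//; ring.
have iwm k := @integrableBE _ (measurableTypeR R) R leb _ _ (iw k) (im k).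
have ivm k : leb.-integrable setT (fun t => (\1_(cut k) t * vm t)%:E).
  under eq_fun do rewrite vmE.
  exact: (@integrableDE _ (measurableTypeR R) R leb).
have near_cut (t : R) : \forall k \near \oo, \1_(cut k) t = \1_S t :> R.
  near=> k; rewrite !indicE; congr (_ %:R); rewrite !mem_setE !in_itv/= andbT; case: leP => //= t0.
  have k1 : `|t| <= k.+1%:R :> R.
    apply: (@le_trans _ _ k%:R); last by rewrite ler_nat.
    by near: k; exact: nbhs_infty_ger.
  rewrite (le_trans (ler_norm t))// (le_trans k1)// expr2 ler_peMl ?ler1n//.
have cI : (fun k => \int[leb]_t (\1_(cut k) t * hker 1 E t)) @ \oo --> \int[leb]_t hker 1 E t.
  apply: (@Rdominated _ (measurableTypeR R) R leb (fun k t => \1_(cut k) t * hker 1 E t) (hker 1 E)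
    (fun t => `|hker 1 E t|) _ _ _ _).2.
  - by move=> k; exact: (measurable_funM (mcut k) mh).
  - move=> t; apply: cvg_near_cst; apply: filterS (near_cut t) => k ->.
    rewrite /hker mulrA; congr (_ * _); rewrite -/S indicE; by case: (_ \in _); rewrite ?mul1r ?mul0r.
  - exact: (integrable_norm ih).
  - by move=> k t; rewrite normrM indicE; case: (_ \in _); rewrite ?normr1 ?normr0 ?mul1r ?mul0r.
have cU : (\int[leb]_t (\1_(cut k) t * vm t)%:E)%E @[k --> \oo] --> Lv.
  rewrite (_ : Lv = (\int[leb]_t (limn (fun k => (\1_(cut k) t * vm t)%:E)))%E); last first.
    apply: eq_integral => t _; apply/esym/cvg_lim => //.
    apply: cvg_near_cst; apply: filterS (near_cut t) => k ->.
    by rewrite /vm mulrA indicE; case: (_ \in _); rewrite ?mul1r ?mul0r.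
  apply: (@cvg_monotone_convergence _ (measurableTypeR R) R leb) => //.
  - by move=> k; exact: (measurable_funT_EFin (measurable_funM (mcut k) measurable_vm)).
  - by move=> k t _; rewrite lee_fin mulr_ge0// vm_ge0.
  - move=> t _ k k' kk; rewrite lee_fin ler_wpM2r ?vm_ge0// !indicE ler_nat.
    case: (boolP (t \in cut k)) => //; rewrite !mem_setE !in_itv/= => /andP[-> tk] /=.
    by rewrite (le_trans tk)// lerXn2r ?nnegrE// ler_nat ltnS.
have c1 : ((2^-1)%:E * ((\int[leb]_t (\1_(cut k) t * hker 1 E t))%:E
     - \int[leb]_t (\1_(cut k) t * vm t)%:E))%E @[k --> \oo] -->
    ((2^-1)%:E * ((\int[leb]_t hker 1 E t)%:E - Lv))%E.
  apply: cvgeZl => //; apply: cvgeB => //; apply: cvg_EFin => //; exact: nearW.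
have c2 := cvg_Ent mX hm dens.
have c3 : (Ent P X k.+1%:R - ln k.+1%:R)%:E + (ln (k.+1%:R) - 2^-1 * ln (a + k.+1%:R ^+ 2))%:E
    @[k --> \oo] --> (diff_entropy f + 0)%E.
  apply: cvgeD => //; first by rewrite fin_num_adde_defl.
  by apply: cvg_EFin; [exact: nearW|exact: cvg_ln_ratio].
rewrite adde0 in c3; apply: (cvg_unique _ c1) => //.
rewrite (_ : (fun k => _) = (fun k => (Ent P X k.+1%:R - ln k.+1%:R)%:E +
   (ln (k.+1%:R) - 2^-1 * ln (a + k.+1%:R ^+ 2))%:E)%E)//.
apply/funext => k; rewrite (RintE (ivm k)) -EFinB -EFinM -EFinD; congr EFin.
have -> : \int[leb]_t (\1_(cut k) t * vm t) = \int[leb]_t (\1_(cut k) t * hker 1 E t) +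
   (\int[leb]_t (\1_(cut k) t * w t) - \int[leb]_t (\1_(cut k) t * m t)).
  under eq_Rintegral do rewrite vmE.
  rewrite (RintegralD measurableT (ich k) (iwm k)); congr (_ + _).
  exact: (RintegralB measurableT (iw k) (im k)).
have -> : \int[leb]_t (\1_(cut k) t * w t) = ln (a + k.+1%:R ^+ 2) - ln a.
  by rewrite /Rintegral integral_cut_w.
have -> : \int[leb]_t (\1_(cut k) t * m t) = 2 * (Ent P X k.+1%:R - Ent P X 0).
  by rewrite /Rintegral integral_cut_m.
have -> : Ent P X 0 = ln a / 2.
  rewrite Ent0; congr (_ / 2); rewrite lnM ?posrE ?expR_gt0 ?mulr_gt0 ?pi_gt0//.
  by rewrite expRK mulr_natl.
by field.
Unshelve. all: by end_near.
Qed.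

Lemma cvg_h_n_entropy : (fun n => h_n n E) @ \oo --> diff_entropy f.
Proof. by rewrite -(cvg_shiftS (fun n => h_n n E)) -limit_value; exact: cvg_h_n_rv. Qed.

End degree_limit.

Theorem theorem11p3 (R : realType) (d : measure_display) (T : measurableType d)
    (P : probability T R) (X : T -> R) (f : R -> R) (Xs : nat -> T -> R) :
  measurable_fun setT X ->
  is_density P X f ->
  has_mgf P X ->
  (forall i, measurable_fun setT (Xs i)) ->
  mutually_independent P Xs ->
  identically_distributed_as P Xs X ->
  (forall n : nat,
     {ae P, forall w, (fun m : nat => h_n_hat n m (fun j => Xs j w)) @ \oo -->
                        h_n n (rv_expect P X)}) /\
  {ae P, forall w,
     (fun n : nat => lim ((fun m : nat => h_n_hat n m (fun j => Xs j w)) @ \oo))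
       @ \oo --> diff_entropy f}.
Proof.
move=> mX dens mgf mXs indep idist.
have hm := integrable_norm_pow mX mgf.
(* One null set serves all [n], because the strong law holds for all powers at once; the iterated
   limit can then be taken pointwise. *)
have key : {ae P, forall w, forall n, (fun m : nat => h_n_hat n m (fun j => Xs j w)) @ \oo -->
    h_n n (rv_expect P X)}.
  have := slln_moments mX mXs indep idist hm.
  apply: filterS => w slln n; have [c0 c00 Hc] := rv_good mX mgf dens n.
  apply: (@cvg_h_n R n (fun m => unif_expect m (fun j => Xs j w))
    (fun m k => (\sum_(j < m) Xs j w ^+ k) / m%:R) _ (fun k => \int[P]_w (X w ^+ k)) c0) => //.
  - by move=> m; exact: has_moments_unif.
  - exact: (has_moments_rv mX hm).
  (* The empirical moment of order 0 is 1 only from [m = 1] on; at [m = 0] the quotient is 0. *)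
  - exists 1%N => // m /= m1; under eq_bigr do rewrite expr0.
    by rewrite sumr_const card_ord divff// pnatr_eq0 -lt0n.
  - exact: moment0.
split=> [n|]; first by apply: filterS key => w; exact.
apply: filterS key => w H.
rewrite (_ : (fun n => _) = (fun n => h_n n (rv_expect P X))); first exact: cvg_h_n_entropy.
by apply/funext => n; apply/cvg_lim => //; exact: H.
Qed.
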